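(* Let $\mathcal{H}$ be a complex separable Hilbert space, $d\ge 1$ an integer, and $\Gamma$ the symmetric Fock space over $L^2(\mathbb{R}_+;\mathbb{C}^d)$. Let $H, R_k, S_{kl}$ ($k,l=1,\dots,d$) be bounded operators on $\mathcal{H}$ with $H^*=H$ and $\sum_j S_{jk}^*S_{jl}=\sum_j S_{kj}S_{lj}^*=\delta_{kl}\mathbb{1}$ for all $k,l$, and let $U=(U(t))_{t\ge0}$ be the strongly continuous family of unitary operators on $\mathcal{H}\otimes\Gamma$ solving the associated Hudson–Parthasarathy equation with $U(0)=\mathbb{1}$ (written out in the context). Let $\rho$ be any statistical operator on $\mathcal{H}$ and let $f\in L^2(\mathbb{R}_+;\mathbb{C}^d)$ be arbitrary, so that $\rho\otimes\varrho_\Gamma(f)$, with $\varrho_\Gamma(f)=|e(f)\rangle\langle e(f)|$ the coherent state of $f$, is the initial state. For $T>0$, $\mu\in\mathbb{R}$, an angle $\vartheta$ and a frequency $\nu>0$, let $S_T^{\mathrm{inel}}(\mu;\vartheta,\nu)$ be the inelastic part of the spectrum up to time $T$ of the output of the continual measurement of the field quadrature $Q(\cdot;\vartheta,\nu)$, as defined in the context. Then, for every choice of these data and for each choice of the sign $\pm$, $$\frac12\Bigl(S_T^{\mathrm{inel}}(\mu;\vartheta,\nu)+S_T^{\mathrm{inel}}\bigl(\mu;\vartheta\pm\tfrac{\pi}{2},\nu\bigr)\Bigr)\ \ge\ 1$$ and $$S_T^{\mathrm{inel}}(\mu;\vartheta,\nu)\;S_T^{\mathrm{inel}}\bigl(\mu;\vartheta\pm\tfrac{\pi}{2},\nu\bigr)\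 \ge\ 1 .$$
   Context: Fields. $\Gamma$ is the symmetric (boson) Fock space over $L^2(\mathbb{R}_+;\mathbb{C}^d)$. For $f\in L^2(\mathbb{R}_+;\mathbb{C}^d)$ the (normalized) coherent vector is $e(f)=\exp(-\tfrac12\|f\|^2)\,\bigl(1,f,(2!)^{-1/2}f\otimes f,\dots,(n!)^{-1/2}f^{\otimes n},\dots\bigr)$, and $f_k(t)=\langle z_k|f(t)\rangle$, with $\{z_k\}$ the canonical basis of $\mathbb{C}^d$. The annihilation, creation and conservation processes $A_k(t),A_k^\dagger(t),\Lambda_{kl}(t)$ are determined by $$A_k(t)e(f)=\int_0^t f_k(s)\,ds\;e(f),\qquad \langle e(g)|A_k^\dagger(t)e(f)\rangle=\int_0^t\overline{g_k(s)}\,ds\,\langle e(g)|e(f)\rangle,$$ $$\langle e(g)|\Lambda_{kl}(t)e(f)\rangle=\int_0^t\overline{g_k(s)}f_l(s)\,ds\,\langle e(g)|e(f)\rangle .$$ Dynamics. With $K:=-\mathrm{i}H-\tfrac12\sum_kR_k^*R_k$, the family $U(t)$ is the unique solution (unitary and strongly continuous) of the quantum stochastic differential equation (Hudson–Parthasarathy quantum stochastic calculus) $$dU(t)=\Bigl\{\sum_kR_k\,dA_k^\dagger(t)+\sum_{kl}(S_{kl}-\delta_{kl})\,d\Lambda_{kl}(t)-\sum_{kl}R_k^*S_{kl}\,dA_l(t)+K\,dt\Bigr\}U(t),\qquad U(0)=\mathbb{1}.$$ A statistical operator is a positive trace-class operator of trace one. Observables. For an angle $\vartheta$ and $\nu>0$,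 the field quadratures are the selfadjoint operators (closures from the linear span of the coherent vectors) $$Q(t;\vartheta,\nu)=\int_0^t e^{-\mathrm{i}(\nu s+\vartheta)}\,dA_1^\dagger(s)+\int_0^t e^{\mathrm{i}(\nu s+\vartheta)}\,dA_1(s),\qquad t\ge0 .$$ For fixed $(\vartheta,\nu)$ they commute (in the sense of their unitary groups) for different times. The angle $\vartheta$ is taken in $(-\pi,\pi]$; $\vartheta\pm\pi/2$ is understood modulo $2\pi$ (the formula is $2\pi$-periodic in $\vartheta$). Output process. For real bounded measurable $k$ on $\mathbb{R}_+$ and $T>0$ let $$\Phi_T(k;\vartheta,\nu)=\operatorname{Tr}\Bigl\{\exp\Bigl(\mathrm{i}\int_0^Tk(s)\,dQ(s;\vartheta,\nu)\Bigr)\,U(T)\bigl(\rho\otimes\varrho_\Gamma(f)\bigr)U(T)^*\Bigr\},$$ where $\int_0^T k\,dQ(\cdot;\vartheta,\nu)=\int_0^T k(s)e^{-\mathrm{i}(\nu s+\vartheta)}dA_1^\dagger(s)+\int_0^T k(s)e^{\mathrm{i}(\nu s+\vartheta)}dA_1(s)$ and field operators are identified with their ampliations to $\mathcal{H}\otimes\Gamma$. The output is a real stochastic process $X(t)$, $t\ge0$, $X(0)=0$, whose law $\mathbb{P}_\rho^{\vartheta,\nu}$ is the quantum mechanical joint distribution of the commuting output observables $U(t)^*Q(t;\vartheta,\nu)U(t)$ in the state $\rho\otimes\varrho_\Gamma(f)$. Explicitly, for $0=t_0<t_1<\dots<t_n\le T$ and $\kappa_j\in\mathbb{R}$, the joint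 characteristic function $\mathbb{E}_\rho^{\vartheta,\nu}\bigl[\exp\{\mathrm{i}\sum_j\kappa_j(X(t_j)-X(t_{j-1}))\}\bigr]$ equals $\Phi_T(k;\vartheta,\nu)$ with $k=\sum_j\kappa_j1_{(t_{j-1},t_j)}$. Correspondingly, $\int_0^T\cos(\mu t)\,dX(t)$ and $\int_0^T\sin(\mu t)\,dX(t)$ are random variables with joint characteristic function $(a,b)\mapsto\Phi_T(a\cos(\mu\,\cdot)+b\sin(\mu\,\cdot);\vartheta,\nu)$. Spectrum. The spectrum up to time $T$ is $S_T(\mu;\vartheta,\nu)=\frac1T\,\mathbb{E}_\rho^{\vartheta,\nu}\bigl[\bigl|\int_0^Te^{\mathrm{i}\mu t}\,dX(t)\bigr|^2\bigr]$. Its elastic part is $S_T^{\mathrm{el}}(\mu;\vartheta,\nu)=\frac1T\bigl|\mathbb{E}_\rho^{\vartheta,\nu}\bigl[\int_0^Te^{\mathrm{i}\mu t}\,dX(t)\bigr]\bigr|^2$, and its inelastic part is $$S_T^{\mathrm{inel}}(\mu;\vartheta,\nu)=S_T(\mu;\vartheta,\nu)-S_T^{\mathrm{el}}(\mu;\vartheta,\nu)=\frac1T\operatorname{Var}_\rho^{\vartheta,\nu}\Bigl[\int_0^T\cos\mu t\,dX(t)\Bigr]+\frac1T\operatorname{Var}_\rho^{\vartheta,\nu}\Bigl[\int_0^T\sin\mu t\,dX(t)\Bigr].$$ Equivalently, in terms of the reduced field state $\Pi_T(f)=\operatorname{Tr}_{\mathcal{H}}\{U(T)(\rho\otimes\varrho_\Gamma(f))U(T)^*\}$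 and the operator $Q_T(\mu;\vartheta,\nu)=\frac1{\sqrt T}\int_0^Te^{\mathrm{i}\mu t}\,dQ(t;\vartheta,\nu)$, one has $$S_T^{\mathrm{inel}}(\mu;\vartheta,\nu)=\operatorname{Tr}\{\Pi_T(f)\,\tilde Q_T^*\tilde Q_T\},\qquad \tilde Q_T=Q_T(\mu;\vartheta,\nu)-\operatorname{Tr}\{\Pi_T(f)Q_T(\mu;\vartheta,\nu)\}.$$ In the two inequalities, the quantities at $\vartheta$ and at $\vartheta\pm\pi/2$ are computed with the same $\rho,f,U,T,\mu,\nu$. *)

(* Defs.v *)
From HB Require Import structures.
From mathcomp Require Import all_boot all_order all_algebra.
From mathcomp Require Import complex.
From mathcomp Require Import all_classical all_reals all_analysis.

Set Implicit Arguments.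
Unset Strict Implicit.
Unset Printing Implicit Defensive.

Import Order.TTheory GRing.Theory Num.Theory Num.Def.
Import numFieldNormedType.Exports.

Local Open Scope classical_set_scope.
Local Open Scope ring_scope.
Local Open Scope complex_scope.

(* MathComp-Analysis, over an arbitrary [R : realType]; the complex numbers
   are [R[i]].  Hilbert tensor products and Fock spaces are given by their
   characterizing data on an arbitrary Hilbert space; statements quantify over
   all such realizations. *)

(** * Hilbert spaces *)

Record hilbert (R : realType) := Hilbert {
  hilbert_sort :> completeNormedModType R[i];
  hdot : {dot hilbert_sort for (@conjC R[i])};
  hdotE : forall x : hilbert_sort, `|x| ^+ 2 = hdot x x }.

(* Physicists' convention: antilinear in the first argument, linear in the
   second one; [hdot] is linear in its first argument. *)
Definition ip (R : realType) (V : hilbert R) (x y : V) : R[i] := hdot V y x.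

Definition lspan (K : nzRingType) (V : lmodType K) (A : set V) : set V :=
  [set x | exists (n : nat) (c : 'I_n -> K) (a : 'I_n -> V),
     (forall i, A (a i)) /\ x = \sum_(i < n) c i *: a i].

Section Operators.
Context {R : realType} {V : hilbert R}.
Implicit Types (A : V -> V) (W : R -> V -> V).

Definition separable_hilbert := exists2 D : set V, countable D & dense D.

Definition bounded_op A := linear A /\ continuous A.

(* The adjoint of a bounded operator: such a [z] exists (Riesz) and is unique. *)
Definition adj A (y : V) : V :=
  xget 0 [set z | forall x, ip (A x) y = ip x z].

Definition unitary_op A :=
  [/\ linear A, forall x y, ip (A x) (A y) = ip x y
    & forall y, exists x, A x = y].

(* Enumerated orthonormal bases.  Null vectors are allowed in the enumeration,
   so that finite bases are covered by the same notion. *)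
Definition onb (b : nat -> V) :=
  [/\ forall n, b n = 0 \/ ip (b n) (b n) = 1,
      forall n m, n <> m -> ip (b n) (b m) = 0
    & dense (lspan (range b))].

(* Meant for trace-class [A], whose trace does not depend on the basis.  The
   first conjunct prevents the second one from being void. *)
Definition trace_is A (z : R[i]) :=
  (exists b, onb b) /\
  forall b, onb b ->
    ((\sum_(0 <= n < N) ip (b n) (A (b n)) : R[i]^o) @[N --> \oo] --> (z : R[i]^o)).

(* A positive bounded operator is trace class as soon as its diagonal sums
   converge. *)
Definition statistical_op A :=
  [/\ bounded_op A, forall x, 0 <= ip x (A x) & trace_is A 1].

Definition ketbra (u : V) : V -> V := fun x => ip u x *: u.

Definition unitary_group W :=
  [/\ forall t, unitary_op (W t), forall s t x, W (s + t) x = W s (W t x)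
    & forall x, continuous (fun t => W t x)].

(* Graph of the selfadjoint operator [B] such that [W t = exp (i t B)]. *)
Definition generator_graph W : set (V * V) :=
  [set p | ((t^-1)%:C *: (W t p.1 - p.1)) @[t --> 0^'] --> 'i *: p.2].

(* By Stone's theorem a selfadjoint operator, given by its graph [G],
   determines its unitary group. *)
Definition is_exp_i (G : set (V * V)) A :=
  exists W, [/\ unitary_group W, generator_graph W = G & A = W 1].

End Operators.
Arguments separable_hilbert {R} V.

(** * Tensor products *)

Section Tensor.
Context {R : realType} {V1 V2 V : hilbert R}.

(* [V] with [tens] is a Hilbert tensor product of [V1] and [V2].  Bilinearity
   follows, and these conditions fix [(V, tens)] up to a unique unitary. *)
Definition is_tensor (tens : V1 -> V2 -> V) :=
  (forall x y x' y',
     ip (tens x y) (tens x' y') = ip x x' * ip y y') /\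
  dense (lspan [set z | exists x y, z = tens x y]).

Definition is_optens (tens : V1 -> V2 -> V)
    (A : V1 -> V1) (B : V2 -> V2) (C : V -> V) :=
  bounded_op C /\ forall x y, C (tens x y) = tens (A x) (B y).

(* The ampliation [A (x) 1] of a bounded operator, which exists and is unique. *)
Definition ampl (tens : V1 -> V2 -> V) (A : V1 -> V1) (z : V) : V :=
  xget 0 [set C z | C in is_optens tens A id].

End Tensor.

(** * Square-integrable functions and symmetric Fock space *)

Definition cintegral (R : realType) (dT : measure_display)
    (T : measurableType dT) (m : {measure set T -> \bar R}) (D : set T)
    (F : T -> R[i]) : R[i] :=
  Rintegral m D (fun x => complex.Re (F x))
    +i* Rintegral m D (fun x => complex.Im (F x)).

Definition cis (R : realType) (x : R) : R[i] := cos x +i* sin x.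

Section Fock.
Context {R : realType} {d : nat}.

(* The functions from R_+ to C^d, as tuples of component functions: the k-th
   component at time [s] is [f k s].  Values at [s < 0] are irrelevant. *)
Definition cfun := 'I_d -> R -> R[i].
Implicit Types f g : cfun.

Local Notation Rplus := (`[0%R, +oo[%classic : set R).

Definition leb (D : set R) (F : R -> R[i]) : R[i] :=
  cintegral lebesgue_measure D F.

Definition sqint f := forall k : 'I_d,
  [/\ measurable_fun Rplus (fun s => complex.Re (f k s)),
      measurable_fun Rplus (fun s => complex.Im (f k s))
    & (\int[lebesgue_measure]_(s in Rplus)
         (complex.Re (f k s) ^+ 2 + complex.Im (f k s) ^+ 2)%:E < +oo)%E].

Definition l2ip f g : R[i] :=
  \sum_k leb Rplus (fun s => (f k s)^* * g k s).

Definition before (t : R) f : cfun := fun k s => if s < t then f k s else 0.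
Definition after (t : R) f : cfun := fun k s => if s < t then 0 else f k s.

Context {G : hilbert R}.

(* [G] is the symmetric Fock space over L^2(R_+; C^d), [pow n f] being the
   n-fold tensor power of [f] in the n-particle sector (the vacuum if [n = 0]).
   By polarization the powers are total in the symmetric n-particle space, so
   these conditions fix [(G, pow)] up to a unique unitary.  Functions equal
   almost everywhere have equal powers. *)
Definition is_fock (pow : nat -> cfun -> G) :=
  (forall n m f g, sqint f -> sqint g ->
     ip (pow n f) (pow m g) = if n == m then l2ip f g ^+ n else 0) /\
  dense (lspan [set x | exists n f, sqint f /\ x = pow n f]).

(* Normalized coherent vector; the series converges in [G]. *)
Definition coh (pow : nat -> cfun -> G) f : G :=
  (expR (- complex.Re (l2ip f f) / 2))%:C *:
  lim ((\sum_(0 <= n < N) ((Num.sqrt (n`!%:R : R))^-1)%:C *: pow n f : G)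
         @[N --> \oo]).

End Fock.
Arguments cfun : clear implicits.

Section Dynamics.
Context {R : realType} {d : nat} {H G HG : hilbert R}.
Variables (tens : H -> G -> HG) (pow : nat -> cfun R d.+1 -> G).
Local Notation e := (coh pow).
Local Notation "u ⊗ x" := (tens u x) (at level 38).

(** * Quantum stochastic calculus *)

(* [M t] acts as the identity on the Fock space over [t, +oo[, expressed on
   the total family of the vectors [u (x) e(f)]. *)
Definition adapted (M : R -> HG -> HG) := forall t, 0 <= t ->
  forall (u v : H) (f g : cfun R d.+1), sqint f -> sqint g ->
    ip (v ⊗ e g) (M t (u ⊗ e f)) =
    ip (v ⊗ e (before t g)) (M t (u ⊗ e (before t f)))
      * ip (e (after t g)) (e (after t f)).

(* The quantum stochastic integral
     M(t) = \int_0^t ( \sum_k D_k dA_k^+ + \sum_kl L_kl dLambda_kl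
                       + \sum_l E_l dA_l + N ds )
   of adapted integrands is determined by its matrix elements between the
   vectors [v (x) e(g)] and [u (x) e(f)] (first fundamental formula), obtained
   by the replacements dA_k^+ -> conj(g_k) ds, dA_l -> f_l ds and
   dLambda_kl -> conj(g_k) f_l ds. *)
Definition is_qs_integral
    (D : 'I_d.+1 -> R -> HG -> HG) (L : 'I_d.+1 -> 'I_d.+1 -> R -> HG -> HG)
    (E : 'I_d.+1 -> R -> HG -> HG) (N : R -> HG -> HG) (M : R -> HG -> HG) :=
  forall t, 0 <= t ->
  forall (u v : H) (f g : cfun R d.+1), sqint f -> sqint g ->
    let x := u ⊗ e f in let y := v ⊗ e g in
    ip y (M t x) =
    leb `[0, t] (fun s =>
        \sum_k (g k s)^* * ip y (D k s x)
      + \sum_k \sum_l (g k s)^* * f l s * ip y (L k l s x)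
      + \sum_l f l s * ip y (E l s x)
      + ip y (N s x)).

(* Unitary, strongly continuous, adapted solution of
     dU = { \sum_k R_k dA_k^+ + \sum_kl (S_kl - delta_kl) dLambda_kl
            - \sum_kl R_k^* S_kl dA_l + K dt } U,    U(0) = 1,
   with K = - i Ham - 1/2 \sum_k R_k^* R_k. *)
Definition HP_solution (Ham : H -> H) (Rk : 'I_d.+1 -> H -> H)
    (S : 'I_d.+1 -> 'I_d.+1 -> H -> H) (U : R -> HG -> HG) :=
  let K (x : H) : H :=
    - ('i *: Ham x) - 2^-1 *: \sum_k adj (Rk k) (Rk k x) in
  [/\ forall t, 0 <= t -> unitary_op (U t),
      forall x, {within `[0, +oo[, continuous (fun t => U t x)},
      forall x, U 0 x = x,
      adapted U
    & is_qs_integral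
        (fun k s x => ampl tens (Rk k) (U s x))
        (fun k l s x =>
           ampl tens (fun y => S k l y - (k == l)%:R *: y) (U s x))
        (fun l s x =>
           ampl tens (fun y => - \sum_k adj (Rk k) (S k l y)) (U s x))
        (fun s x => ampl tens K (U s x))
        (fun t x => U t x - x)].

(** * Field quadratures and output *)

(* Graph of \int_0^T k(s) dQ(s; th, nu): the closure of its restriction to the
   span of the coherent vectors, on which the dA_1-part is diagonal and the
   dA_1^+-part maps [e f] to the vector [w] with the prescribed matrix
   elements.  The component of index 1 is [ord0]. *)
Definition quadrature_graph (T : R) (k : R -> R) (th nu : R) : set (G * G) :=
  closure (lspan [set p : G * G | exists f w,
    [/\ sqint f,
        forall g, sqint g ->
          ip (e g) w =
          leb `[0, T] (fun s => (g ord0 s)^* * ((k s)%:C * cis (- (nu * s + th))))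
            * ip (e g) (e f)
      & p = (e f, w + leb `[0, T] (fun s => (k s)%:C * cis (nu * s + th) * f ord0 s)
                        *: e f)]]).

(* Phi_T(k; th, nu) = z. *)
Definition Phi_is (U : R -> HG -> HG) (rho : H -> H) (f : cfun R d.+1)
    (T : R) (k : R -> R) (th nu : R) (z : R[i]) :=
  exists (W : G -> G) (V sigma : HG -> HG),
    [/\ is_exp_i (quadrature_graph T k th nu) W,
        is_optens tens id W V,
        is_optens tens rho (ketbra (e f)) sigma
      & trace_is (fun x => V (U T (sigma (adj (U T) x)))) z].

Section Output.
Context {dO : measure_display} {Om : measurableType dO} (P : probability Om R).
Variables (U : R -> HG -> HG) (rho : H -> H) (f : cfun R d.+1) (th nu : R).

(* Complex expectation of exp(i Y). *)
Definition exp_char (Y : Om -> R) : R[i] :=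
  cintegral P setT (fun w => cis (Y w)).

Definition is_output (X : R -> {RV P >-> R}) :=
  (forall w, X 0 w = 0) /\
  forall (T : R) (n : nat) (t kap : nat -> R),
    0 < T -> t 0%N = 0 -> (forall j, (j < n)%N -> t j < t j.+1) -> t n <= T ->
    Phi_is U rho f T
      (fun s => \sum_(j < n) kap j * \1_(`]t j, t j.+1[%classic : set R) s) th nu
      (exp_char (fun w => \sum_(j < n) kap j * (X (t j.+1) w - X (t j) w))).

(* [I] is \int_0^T k dX, the limit in probability of Riemann sums. *)
Definition is_integral (X : R -> {RV P >-> R}) (k : R -> R) (T : R)
    (I : {RV P >-> R}) :=
  forall eps : R, 0 < eps ->
    P [set w | eps <=
         `| \sum_(j < n) k (T * j%:R / n%:R) *
              (X (T * j.+1%:R / n%:R) w - X (T * j%:R / n%:R) w) - I w | ]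
      @[n --> \oo] --> 0%E.

(* [X] is the output process, [IC] and [IS] are \int_0^T cos(mu t) dX(t) and
   \int_0^T sin(mu t) dX(t). *)
Definition output_model (T mu : R) (X : R -> {RV P >-> R})
    (IC IS : {RV P >-> R}) :=
  [/\ is_output X,
      is_integral X (fun s => cos (mu * s)) T IC,
      is_integral X (fun s => sin (mu * s)) T IS
    & forall a b : R,
        Phi_is U rho f T (fun s => a * cos (mu * s) + b * sin (mu * s)) th nu
          (exp_char (fun w => a * IC w + b * IS w))].

(* Inelastic part of the spectrum: total minus elastic part, i.e. the sum of
   the two variances over T.  Extended-real valued, so that no finiteness of
   the variances needs to be assumed. *)
Definition S_inel (T : R) (IC IS : {RV P >-> R}) : \bar R :=
  ((T^-1)%:E * 'V_P[IC] + (T^-1)%:E * 'V_P[IS])%E.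

End Output.
End Dynamics.

(* Main.v *)
Require Import Defs.
From HB Require Import structures.
From mathcomp Require Import all_boot all_order all_algebra.
From mathcomp Require Import complex.
From mathcomp Require Import all_classical all_reals all_analysis.
From mathcomp Require Import ring lra.

Set Implicit Arguments.
Unset Strict Implicit.
Unset Printing Implicit Defensive.

Import Order.TTheory GRing.Theory Num.Theory Num.Def.
Import numFieldNormedType.Exports.

Local Open Scope classical_set_scope.
Local Open Scope ring_scope.
Local Open Scope complex_scope.

(** For g in L^2, the exponential of the field operator a^*(g) + a(g) acts on
    exponential vectors by a displacement f |-> f + i g and a scalar factor.
    Indeed the displaced curve is strongly differentiable and its derivative is
    the generator, so a unitary group with that generator must follow it.  Two
    such unitaries A, B therefore satisfy the Weyl relation A B = eta B A with a
    scalar eta.  From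

      (eta - 1) <phi, B A phi> = <phi, ((A - 1)(B - 1) - (B - 1)(A - 1)) phi>

    one gets |eta - 1| |<phi, B A phi>| <= 2 |(A - 1) phi| |(B - 1) phi|.  The
    output state is a sum of projections on vectors phi (Cholesky
    decomposition), and the sum of |(A - 1) phi|^2 over these vectors is
    E|exp(ia(X - c)) - 1|^2 <= a^2 E(X - c)^2, a quantity that only involves the
    characteristic function of the output X.  Letting the parameters of A and B
    tend to 0 gives Var(X) Var(X') >= (\int_0^T k^2)^2 for the integrals
    X = \int k dX_th and X' = \int k dX_th' of quadratures of orthogonal angles.
    Cauchy-Schwarz for k = cos and k = sin, whose squares add up to 1, yields the
    bound for the product, and the arithmetic-geometric mean inequality the bound
    for the mean. *)

(** The bounded unitaries stand in for the field operators for two reasons. The law of the output is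
    given by characteristic functions, which are expectations of exactly these unitaries. And the
    vectors of the state need not lie in the domain of a commutator, nor need the variances be
    finite. The constants survive the detour. For orthogonal angles and parameters a, b the scalar
    is eta = exp(2 i a b \int_0^T k^2) up to the sign of the exponent, so |eta - 1| is 2 a b \int
    k^2 to leading order, and this 2 cancels the 2 of the commutator estimate. Replacing A by
    exp(-iac) A centres X at c and leaves eta unchanged. Since 0 * +oo = 0 for extended reals, an
    infinite variance could hide a vanishing one. That case needs its own argument: if one variance
    is 0, its unitary acts trivially on the state for every parameter, while the other parameter is
    kept fixed with A - 1 small; then eta can be moved away from 1, a contradiction. *)

Local Ltac cring := apply/eqP; rewrite eq_complex /=; apply/andP; split; apply/eqP; first [ring | by field].

(** * Norms as real numbers *)

Section Nm.
Variable R : realType.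
(* The norm of a normed space over [R[i]] takes its values in [R[i]]; [nm] is
   this norm as a real number. *)
Definition nm (V : normedZmodType R[i]) (x : V) : R := complex.Re `|x|.

Lemma nmE (V : normedZmodType R[i]) (x : V) : `|x| = (nm x)%:C.
Proof. by rewrite /nm RRe_real // normr_real. Qed.

Lemma nm_ge0 (V : normedZmodType R[i]) (x : V) : 0 <= nm x.
Proof. by rewrite -lecR -nmE normr_ge0. Qed.

Lemma nm0 (V : normedZmodType R[i]) : nm (0 : V) = 0.
Proof. by rewrite /nm normr0. Qed.

Lemma nm_eq0 (V : normedZmodType R[i]) (x : V) : nm x = 0 -> x = 0.
Proof. by move=> h; apply/eqP; rewrite -normr_eq0 nmE h. Qed.

Lemma nmD (V : normedZmodType R[i]) (x y : V) : nm (x + y) <= nm x + nm y.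
Proof. by rewrite -lecR rmorphD /= -!nmE ler_normD. Qed.

Lemma nmN (V : normedZmodType R[i]) (x : V) : nm (- x) = nm x.
Proof. by rewrite /nm normrN. Qed.

Lemma nmBC (V : normedZmodType R[i]) (x y : V) : nm (x - y) = nm (y - x).
Proof. by rewrite /nm distrC. Qed.

Lemma nmB_trans (V : normedZmodType R[i]) (y x z : V) :
  nm (x - z) <= nm (x - y) + nm (y - z).
Proof. by apply: le_trans (nmD _ _); rewrite addrA subrK. Qed.

Lemma nm_dist (V : normedZmodType R[i]) (x y : V) : nm x - nm y <= nm (x - y).
Proof. by rewrite lerBlDr -[in X in X <= _](subrK y x) nmD. Qed.

Lemma nm_sum (V : normedZmodType R[i]) I (r : seq I) (P : pred I) (F : I -> V) :
  nm (\sum_(i <- r | P i) F i) <= \sum_(i <- r | P i) nm (F i).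
Proof.
elim/big_rec2: _ => [|i x y _ h]; first by rewrite nm0.
by apply: le_trans (nmD _ _) _; rewrite lerD2l.
Qed.

Lemma nmM (z w : R[i]) : nm (z * w) = nm z * nm w.
Proof. by apply: complexI; rewrite rmorphM /= -!nmE normrM. Qed.

Lemma nmX (z : R[i]) n : nm (z ^+ n) = nm z ^+ n.
Proof. by apply: complexI; rewrite rmorphXn /= -!nmE normrX. Qed.

Lemma nmZ (V : normedModType R[i]) (z : R[i]) (x : V) : nm (z *: x) = nm z * nm x.
Proof. by apply: complexI; rewrite rmorphM /= -!nmE normrZ. Qed.

Lemma nmR (x : R) : nm x%:C = `|x|.
Proof. by rewrite /nm normc_def /= expr0n /= addr0 sqrtr_sqr. Qed.

Lemma nm_i : nm ('i : R[i]) = 1.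
Proof. by rewrite /nm normc_def /= expr0n /= add0r expr1n sqrtr1. Qed.

Lemma nm_conj (z : R[i]) : nm (conjc z) = nm z.
Proof. by case: z => a b; rewrite /nm !normc_def /= sqrrN. Qed.

Lemma Re_le_nm (z : R[i]) : complex.Re z <= nm z.
Proof.
case: z => a b; rewrite /nm normc_def /=; apply: le_trans (ler_norm _) _.
by rewrite -sqrtr_sqr ler_sqrt ?lerDl ?sqr_ge0 // addr_ge0 ?sqr_ge0.
Qed.

Lemma nm_sq (z : R[i]) : nm z ^+ 2 = complex.Re z ^+ 2 + complex.Im z ^+ 2.
Proof. by case: z => a b; rewrite /nm normc_def /= sqr_sqrtr // addr_ge0 ?sqr_ge0. Qed.

Lemma Re_abs_nm (z : R[i]) : `|complex.Re z| <= nm z.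
Proof. by rewrite ler_norml Re_le_nm andbT lerNl -raddfN -nmN Re_le_nm. Qed.

Lemma conjMnm (z : R[i]) : conjc z * z = (nm z ^+ 2)%:C.
Proof. by rewrite nm_sq; case: z => a b; cring. Qed.

Lemma cvg_nmP (V : pseudoMetricNormedZmodType R[i]) T (F : set_system T)
  (FF : Filter F) (f : T -> V) (l : V) :
  f @ F --> l <-> forall eps : R, 0 < eps -> \forall x \near F, nm (l - f x) < eps.
Proof.
rewrite cvgrPdist_lt; split=> [h e e0|h e].
  have /h : 0 < e%:C by rewrite ltcR.
  by apply: filterS => x; rewrite nmE ltcR.
case: e => a b; rewrite ltcE /= => /andP[/eqP-> a0].
by have := h _ a0; apply: filterS => x; rewrite nmE -ltcR.
Qed.


Lemma eqcR (a b : R) : (a%:C == b%:C :> R[i]) = (a == b).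
Proof. by rewrite eq_complex /= eqxx andbT. Qed.

Lemma nm_dist_abs (V : normedZmodType R[i]) (x y : V) :
  `|nm x - nm y| <= nm (x - y).
Proof. by rewrite ler_norml lerNl opprB nm_dist andbT nmBC nm_dist. Qed.

Lemma iE : ('i%R : R[i]) = 'i%C. Proof. by []. Qed.

Lemma Im_abs_nm (z : R[i]) : `|complex.Im z| <= nm z.
Proof.
rewrite -(ler_pXn2r (n := 2)) ?nnegrE ?nm_ge0 // nm_sq real_normK ?num_real //.
by rewrite lerDr sqr_ge0.
Qed.

End Nm.

(** * Inner products, linear maps and density arguments *)

Section Hilb.
Context {R : realType} {V : hilbert R}.
Implicit Types x y z : V.

Lemma ipDr x y z : ip x (y + z) = ip x y + ip x z.
Proof. exact: linearDl. Qed.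
Lemma ipDl x y z : ip (x + y) z = ip x z + ip y z.
Proof. exact: linearDr. Qed.
Lemma ipZr x a y : ip x (a *: y) = a * ip x y.
Proof. exact: linearZl_LR. Qed.
Lemma ipZl x a y : ip (a *: x) y = conjc a * ip x y.
Proof. exact: linearZr_LR. Qed.
Lemma ip0l x : ip 0 x = 0.
Proof. exact: linear0r. Qed.
Lemma ip0r x : ip x 0 = 0.
Proof. exact: linear0l. Qed.
Lemma ipNr x y : ip x (- y) = - ip x y.
Proof. exact: linearNl. Qed.
Lemma ipBr x y z : ip x (y - z) = ip x y - ip x z.
Proof. exact: linearBl. Qed.
Lemma ipBl x y z : ip (x - y) z = ip x z - ip y z.
Proof. exact: linearBr. Qed.
Lemma ip_sumr x I (r : seq I) (P : pred I) (F : I -> V) :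
  ip x (\sum_(i <- r | P i) F i) = \sum_(i <- r | P i) ip x (F i).
Proof. exact: linear_sumlz. Qed.
Lemma ip_suml x I (r : seq I) (P : pred I) (F : I -> V) :
  ip (\sum_(i <- r | P i) F i) x = \sum_(i <- r | P i) ip (F i) x.
Proof. exact: linear_sumr. Qed.

Lemma ip_conj x y : ip x y = (ip y x)^*.
Proof. by rewrite /ip hermC /= expr0 mul1r. Qed.

Lemma ipxx x : ip x x = (nm x ^+ 2)%:C.
Proof. by rewrite rmorphXn /= -nmE hdotE. Qed.

Lemma nm_sqD x y : nm (x + y) ^+ 2 = nm x ^+ 2 + nm y ^+ 2 + 2 * complex.Re (ip x y).
Proof.
apply: complexI; rewrite -ipxx !(ipDl, ipDr) !ipxx (ip_conj y x).
by case: (ip x y) => a b; cring.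
Qed.

Lemma nm_sqB x y : nm (x - y) ^+ 2 = nm x ^+ 2 + nm y ^+ 2 - 2 * complex.Re (ip x y).
Proof. by rewrite nm_sqD ipNr nmN raddfN /= mulrN. Qed.

Lemma CS x y : nm (ip x y) <= nm x * nm y.
Proof.
have [y0|y0] := eqVneq (nm y) 0.
  by rewrite (nm_eq0 y0) ip0r !nm0 mulr0.
have h := ip_conj x y.
have y2 : 0 < nm y ^+ 2 by rewrite exprn_even_gt0.
rewrite -(ler_pXn2r (n:=2)) ?nnegrE ?mulr_ge0 ?nm_ge0 // exprMn.
rewrite -ler_pdivrMr //.
have := sqr_ge0 (nm (x - ((nm y ^+ 2)^-1%:C * ip y x) *: y)).
rewrite nm_sqB nmZ nmM ipZr nmR.
suff -> : complex.Re ((nm y ^+ 2)^-1%:C * ip y x * ip x y) = nm (ip x y) ^+ 2 / nm y ^+ 2.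
  rewrite ger0_norm ?invr_ge0 ?sqr_ge0 // (_ : nm (ip y x) = nm (ip x y)); last by rewrite h nm_conj.
  by move=> h2; rewrite -subr_ge0; apply: le_trans h2 _; rewrite le_eqVlt; apply/orP; left; apply/eqP; field.
rewrite (ip_conj y x) -mulrA conjMnm -rmorphM /= mulrC //.
Qed.

Lemma isometry_nm (A : V -> V) : (forall x y, ip (A x) (A y) = ip x y) ->
  forall x, nm (A x) = nm x.
Proof.
by move=> h x; apply/eqP; rewrite -(eqrXn2 (n := 2)) ?nm_ge0 // -eqcR -!ipxx h.
Qed.

End Hilb.

Section Lin.
Context {R : realType} {V W : hilbert R}.
Variable A : V -> W.
Hypothesis Al : linear A.
Lemma linD x y : A (x + y) = A x + A y.
Proof. by have := Al 1 x y; rewrite !scale1r. Qed.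
Lemma lin0 : A 0 = 0.
Proof. by have := linD 0 0; rewrite addr0 => /eqP; rewrite -subr_eq0 opprD addNKr oppr_eq0 => /eqP. Qed.
Lemma linZ a x : A (a *: x) = a *: A x.
Proof. by have := Al a x 0; rewrite !addr0 lin0 addr0. Qed.
Lemma linB x y : A (x - y) = A x - A y.
Proof. by rewrite linD -scaleN1r linZ scaleN1r. Qed.
Lemma lin_sum I (r : seq I) (P : pred I) (F : I -> V) :
  A (\sum_(i <- r | P i) F i) = \sum_(i <- r | P i) A (F i).
Proof. by elim/big_rec2: _ => [|i x y _ h]; rewrite ?lin0 // linD h. Qed.
End Lin.

Section Dense.
Context {R : realType} {V : hilbert R}.
Implicit Types (x y z : V) (A : set V).

Lemma dense_nm A x (eps : R) : dense A -> 0 < eps -> exists2 a, A a & nm (x - a) < eps.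
Proof.
move=> dA e0.
have e0' : 0 < eps%:C by rewrite ltcR.
have [||a [/= h aA]] := dA (ball x eps%:C).
- by exists x; apply: ballxx.
- exact: ball_open.
by exists a => //; move: h; rewrite -ball_normE /= nmE ltcR.
Qed.

Lemma ip_inj x y : (forall z, ip z x = ip z y) -> x = y.
Proof.
move=> h; apply/eqP; rewrite -subr_eq0; apply/eqP/nm_eq0/eqP.
by rewrite -sqrf_eq0 -eqcR -ipxx ipBr h subrr.
Qed.

Lemma eq0_small (r : R) : 0 <= r -> (forall eps, 0 < eps -> r <= eps) -> r = 0.
Proof.
move=> r0 h; apply/eqP; rewrite eq_le r0 andbT leNgt; apply/negP => rp.
by have := h (r / 2); rewrite divr_gt0 // => /(_ isT); rewrite leNgt ltr_pdivrMr // ltr_pMr // ltr1n.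
Qed.

Lemma total_inj A x y : dense (lspan A) -> (forall z, A z -> ip z x = ip z y) -> x = y.
Proof.
move=> dA h; apply/eqP; rewrite -subr_eq0; apply/eqP/nm_eq0/eq0_small; first exact: nm_ge0.
move=> eps e0; have [a [n [c [v [Av ->]]]] hx] := dense_nm (x - y) dA e0.
set u := x - y in hx *.
have h0 : ip (\sum_(i < n) c i *: v i) u = 0.
  rewrite ip_suml big1 // => i _; rewrite ipZl /u ipBr h ?subrr ?mulr0 //.
have [->|u0] := eqVneq (nm u) 0; first exact: ltW.
have : nm (ip (u - \sum_(i < n) c i *: v i) u) <= eps * nm u.
  by apply: le_trans (CS _ _) _; rewrite ler_wpM2r ?nm_ge0 // ltW.
rewrite ipBl h0 subr0 ipxx nmR ger0_norm ?sqr_ge0 // expr2 ler_pM2r // lt_def u0 nm_ge0 //.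
Qed.

End Dense.

Section Bounded.
Context {R : realType} {V W : hilbert R}.
Implicit Types (x y z : V) (A : V -> V).

Lemma bounded_opP A : bounded_op A ->
  exists2 C : R, 0 <= C & forall x, nm (A x) <= C * nm x.
Proof.
move=> [Al Ac]; have /cvg_nmP/(_ _ ltr01) := Ac 0; rewrite (lin0 Al).
move=> /nbhs_ballP [[e e'] /=]; rewrite ltcE /= => /andP[/eqP-> e0] h.
exists (2 / e); first by rewrite divr_ge0 // ltW.
move=> x; have [x0|x0] := eqVneq (nm x) 0.
  by rewrite (nm_eq0 x0) (lin0 Al) !nm0 mulr0.
have xp : 0 < nm x by rewrite lt_def x0 nm_ge0.
have := h ((e / 2 / nm x)%:C *: x).
rewrite -ball_normE /= !sub0r !nmN normrN nmE nmZ nmR ger0_norm; last by rewrite !mulr_ge0 // ?invr_ge0 // ltW.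
rewrite divfK // ltcR ltr_pdivrMr // ltr_pMr // ltr1n => /(_ isT).
rewrite (linZ Al) nmZ nmR ger0_norm; last by rewrite !mulr_ge0 // ?invr_ge0 // ltW.
move=> /ltW h1; rewrite -(ler_pM2l (_ : 0 < e / 2 / nm x)) ?divr_gt0 //.
by apply: le_trans h1 _; rewrite le_eqVlt; apply/orP; left; apply/eqP; field; rewrite x0 gt_eqF.
Qed.

Lemma total_op_eq (B : set V) (A A' : V -> V) :
  bounded_op A -> bounded_op A' -> dense (lspan B) ->
  (forall x, B x -> A x = A' x) -> forall x, A x = A' x.
Proof.
move=> bA bA' dB h x; have [Al _] := bA; have [Al' _] := bA'.
have [C C0 hC] := bounded_opP bA; have [C' C0' hC'] := bounded_opP bA'.
apply/eqP; rewrite -subr_eq0; apply/eqP/nm_eq0/eq0_small; first exact: nm_ge0.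
move=> eps e0; have e1 : 0 < eps / (C + C' + 1) by rewrite divr_gt0 // ltr_wpDl // addr_ge0.
have [a [n [c [v [Bv aE]]]] hx] := dense_nm x dB e1.
have aa : A a = A' a.
  rewrite aE (lin_sum Al) (lin_sum Al'); apply: eq_bigr => i _.
  by rewrite (linZ Al) (linZ Al') h.
have -> : A x - A' x = A (x - a) - A' (x - a).
  by rewrite (linB Al) (linB Al') aa opprB addrA subrK.
apply: le_trans (nmD _ _) _; rewrite nmN.
apply: le_trans (lerD (hC _) (hC' _)) _; rewrite -mulrDl.
apply: le_trans (_ : (C + C' + 1) * nm (x - a) <= _); first by rewrite ler_wpM2r ?nm_ge0 // lerDl.
by rewrite -ler_pdivlMl; [rewrite mulrC ltW | rewrite ltr_wpDl // addr_ge0].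
Qed.

(** The hypothesis is on inner products and not on norms, since the norm of a linear combination of
    generators involves the cross terms. *)
Lemma total_isometry (B : set V) (A : V -> V) :
  bounded_op A -> dense (lspan B) ->
  (forall x y, B x -> B y -> ip (A x) (A y) = ip x y) -> forall x, nm (A x) = nm x.
Proof.
move=> bA dB h x; have [Al _] := bA; have [C C0 hC] := bounded_opP bA.
apply/eqP; rewrite -subr_eq0 -normr_eq0; apply/eqP/eq0_small; first exact: normr_ge0.
move=> eps e0; have e1 : 0 < eps / (C + 1) by rewrite divr_gt0 // ltr_wpDl.
have [a [n [c [v [Bv aE]]]] hx] := dense_nm x dB e1.
have na : nm (A a) = nm a.
  apply/eqP; rewrite -(eqrXn2 (n := 2)) ?nm_ge0 // -eqcR -!ipxx aE (lin_sum Al) !ip_suml.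
  apply/eqP; apply: eq_bigr => i _; rewrite !ip_sumr; apply: eq_bigr => j _.
  by rewrite !(linZ Al) !(ipZl, ipZr) h.
have h1 : `|nm (A x) - nm (A a)| <= C * nm (x - a).
  by apply: le_trans (nm_dist_abs _ _) _; rewrite -(linB Al).
have h2 : `|nm a - nm x| <= nm (x - a).
  by rewrite nmBC nm_dist_abs.
have -> : nm (A x) - nm x = nm (A x) - nm (A a) + (nm a - nm x) by rewrite na addrA subrK.
apply: le_trans (ler_normD _ _) _; apply: le_trans (lerD h1 h2) _.
rewrite -{2}(mul1r (nm (x - a))) -mulrDl.
by rewrite -ler_pdivlMl; [rewrite mulrC ltW | rewrite ltr_wpDl].
Qed.

End Bounded.

(** * The complex exponential and its power series *)

Section ComplexExponential.

(** Stated over any [numFieldType], so that the real series, which dominates the complex one, obeys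
    the same identities. *)
Definition texp (F : numFieldType) (z : F) (n : nat) : F := n`!%:R^-1 * z ^+ n.
Definition sexp (F : numFieldType) (z : F) (N : nat) : F := \sum_(0 <= n < N) texp z n.

Lemma texpD (F : numFieldType) (z w : F) n :
  texp (z + w) n = \sum_(0 <= i < n.+1) texp z i * texp w (n - i).
Proof.
rewrite /texp addrC exprDn mulr_sumr big_mkord; apply: eq_bigr => i _.
have hi : (i <= n)%N by rewrite -ltnS.
rewrite -mulr_natl.
have := bin_fact hi; move/(congr1 (fun k => k%:R : F)); rewrite !natrM => <-.
have h1 : i`!%:R != 0 :> F by rewrite pnatr_eq0 -lt0n fact_gt0.
have h2 : (n - i)`!%:R != 0 :> F by rewrite pnatr_eq0 -lt0n fact_gt0.
have h3 : 'C(n, i)%:R != 0 :> F by rewrite pnatr_eq0 -lt0n bin_gt0.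
by field; rewrite h1 h2 h3.
Qed.

Lemma sexpD (F : numFieldType) (z w : F) N :
  sexp (z + w) N = \sum_(0 <= i < N) \sum_(0 <= j < N - i) texp z i * texp w j.
Proof.
elim: N => [|N IH]; first by rewrite /sexp !big_geq.
rewrite /sexp big_nat_recr //= -/(sexp _ _) IH texpD.
rewrite [in RHS]big_nat_recr //= subSnn big_nat1 [X in _ + X]big_nat_recr //= subnn addrA.
congr (_ + _); rewrite -big_split /=; apply: eq_big_nat => i /andP[_ iN].
by rewrite subSn ?(ltnW iN) // big_nat_recr.
Qed.

(** The product of two partial sums runs over the square i, j < N, the partial sum at z + w over the
    triangle i + j < N; what is left is the corner i + j >= N. *)
Lemma sexpM_sub (F : numFieldType) (z w : F) N :
  sexp z N * sexp w N - sexp (z + w) N =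
  \sum_(0 <= i < N) \sum_(N - i <= j < N) texp z i * texp w j.
Proof.
rewrite sexpD {1}/sexp mulr_suml -sumrB; apply: eq_big_nat => i _.
rewrite /sexp mulr_sumr (big_cat_nat (n := N - i)) ?leq_subr //=.
by rewrite addrAC subrr add0r.
Qed.
Context {R : realType}.
Implicit Types z w : R[i].

Lemma nm_texp z n : nm (texp z n) = texp (nm z) n.
Proof. by rewrite /texp nmM nmX -(rmorph_nat (real_complex R)) -fmorphV nmR ger0_norm // invr_ge0. Qed.

(* The terms that distinguish the product of two partial sums from the partial
   sum at [z + w] are bounded by their real counterparts, which tend to 0. *)
Lemma nm_sexpM_sub z w N : nm (sexp z N * sexp w N - sexp (z + w) N) <=
  sexp (nm z) N * sexp (nm w) N - sexp (nm z + nm w) N.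
Proof.
rewrite !sexpM_sub; apply: le_trans (nm_sum _ _ _) _; apply: ler_sum => i _.
apply: le_trans (nm_sum _ _ _) _; apply: ler_sum => j _.
by rewrite nmM !nm_texp.
Qed.

Lemma cvg_sexpR (x : R) : sexp x N @[N --> \oo] --> expR x.
Proof.
have := @is_cvg_series_exp_coeff R x; rewrite /expR.
suff -> : series (exp_coeff x) = sexp x by [].
by apply/funext => N; rewrite /series /sexp /=; apply: eq_bigr => n _; rewrite /texp mulrC.
Qed.

Lemma cvg_ReIm T (F : set_system T) (FF : Filter F) (u : T -> R[i]) (l : R[i]) :
  complex.Re (u x) @[x --> F] --> complex.Re l ->
  complex.Im (u x) @[x --> F] --> complex.Im l ->
  (u x : R[i]^o) @[x --> F] --> (l : R[i]^o).
Proof.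
move=> /cvgrPdist_lt hr /cvgrPdist_lt hi; apply/cvg_nmP => e e0.
have e2 : 0 < e / 2 by rewrite divr_gt0.
apply: filterS2 (hr _ e2) (hi _ e2) => x h1 h2.
have -> : l - u x = (complex.Re l - complex.Re (u x))%:C + 'i * (complex.Im l - complex.Im (u x))%:C.
  by case: l {hr hi h1 h2} => a b; case: (u x) => c d; apply/eqP; rewrite eq_complex /=; apply/andP; split; apply/eqP; ring.
apply: le_lt_trans (nmD _ _) _; rewrite nmM nm_i mul1r !nmR (splitr e).
exact: ltrD.
Qed.

(** The closed form makes additivity and the modulus immediate. The power series is still needed,
    because inner products in Fock space arise as such series. *)
Definition cexp z : R[i] := (expR (complex.Re z))%:C * cis (complex.Im z).

Lemma cisD (x y : R) : cis (x + y) = cis x * cis y.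
Proof. by rewrite /cis cosD sinD; apply/eqP; rewrite eq_complex /=; apply/andP; split; apply/eqP; ring. Qed.

Lemma nm_cis (x : R) : nm (cis x) = 1.
Proof. by rewrite /nm normc_def /= cos2Dsin2 sqrtr1. Qed.

Lemma cexpD z w : cexp (z + w) = cexp z * cexp w.
Proof. by rewrite /cexp !raddfD expRD cisD rmorphM /= mulrACA. Qed.

Lemma cexp0 : cexp 0 = 1.
Proof. by rewrite /cexp /= expR0 /cis cos0 sin0 mul1r. Qed.

Lemma nm_cexp z : nm (cexp z) = expR (complex.Re z).
Proof. by rewrite /cexp nmM nm_cis mulr1 nmR ger0_norm ?expR_ge0. Qed.

Lemma texp_im (y : R) n : texp ('i * y%:C) n = cos_coeff y n +i* sin_coeff y n.
Proof.
rewrite /texp exprMn -(rmorph_nat (real_complex R)) -fmorphV -rmorphXn /= mulrCA -rmorphM /=.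
rewrite /cos_coeff /sin_coeff /=.
have i2 : ('i : R[i]) ^+ 2 = - 1 by rewrite expr2; apply/eqP; rewrite eq_complex /= !(mul0r, mulr0, mul1r, mulr1, subr0, add0r, addr0, sub0r) eqxx oppr0 eqxx.
rewrite -{1}(odd_double_half n) exprD -mul2n exprM i2.
have -> : (-1 : R[i]) ^+ n./2 = ((-1) ^+ n./2)%:C by rewrite rmorphXn /= rmorphN1.
rewrite -exprnP; case: (boolP (odd n)) => on; rewrite /= ?expr0 ?expr1.
  have -> : n.-1./2 = n./2 by rewrite -{1}(odd_double_half n) on add1n /= doubleK.
  by move: (_ ^+ n./2) (y ^+ n) (_`!%:R^-1) => s u v; cring.
by move: (_ ^+ n./2) (_ ^+ n.-1./2) (y ^+ n) (_`!%:R^-1) => s s' u v; cring.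
Qed.


(** On the two axes the series reduces to the real series of exp, cos and sin. The product of their
    partial sums differs from the partial sum at z by the corner terms, which vanish because the
    real exponential is additive. *)
Lemma cvg_sexp z : (sexp z N : R[i]^o) @[N --> \oo] --> (cexp z : R[i]^o).
Proof.
have [x [y zE]] : exists x y, z = x%:C + 'i * y%:C.
  by exists (complex.Re z), (complex.Im z); case: z => a b /=; cring.
have hx : (sexp (x%:C : R[i]) N : R[i]^o) @[N --> \oo] --> ((expR x)%:C : R[i]^o).
  apply: (cvg_ReIm _).
    rewrite [X in _ --> X](_ : _ = expR x) //.
    have -> : (fun N => complex.Re (sexp (x%:C : R[i]) N)) = sexp x.
      apply/funext => N; rewrite /sexp raddf_sum; apply: eq_bigr => n _.
      by rewrite /texp -(rmorph_nat (real_complex R)) -fmorphV -rmorphXn -rmorphM.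
    exact: cvg_sexpR.
  rewrite [X in X @ _](_ : _ = fun=> 0); first exact: cvg_cst.
  apply/funext => N; rewrite /sexp raddf_sum big1 // => n _.
  by rewrite /texp -(rmorph_nat (real_complex R)) -fmorphV -rmorphXn -rmorphM.
have hy : (sexp ('i * y%:C : R[i]) N : R[i]^o) @[N --> \oo] --> (cis y : R[i]^o).
  apply: (cvg_ReIm _).
    have -> : (fun N => complex.Re (sexp ('i * y%:C : R[i]) N)) = series (cos_coeff y).
      apply/funext => N; rewrite /sexp raddf_sum; apply: eq_bigr => n _.
      by rewrite texp_im.
    by rewrite /= unlock; exact: is_cvg_series_cos_coeff.
  have -> : (fun N => complex.Im (sexp ('i * y%:C : R[i]) N)) = series (sin_coeff y).
    apply/funext => N; rewrite /sexp raddf_sum; apply: eq_bigr => n _.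
    by rewrite texp_im.
  by rewrite /= unlock; exact: is_cvg_series_sin_coeff.
have hxy : (sexp (x%:C : R[i]) N * sexp ('i * y%:C : R[i]) N : R[i]^o) @[N --> \oo] --> ((expR x)%:C * cis y : R[i]^o).
  exact: cvgM hx hy.
have hr : (sexp (nm (x%:C : R[i])) N * sexp (nm ('i * y%:C : R[i])) N -
   sexp (nm (x%:C : R[i]) + nm ('i * y%:C : R[i])) N) @[N --> \oo] --> (0 : R).
  rewrite -[X in _ --> X](subrr (expR (nm (x%:C : R[i])) * expR (nm ('i * y%:C : R[i])))).
  by apply: cvgB; [apply: cvgM; exact: cvg_sexpR | rewrite -expRD; exact: cvg_sexpR].
have -> : cexp z = (expR x)%:C * cis y.
  by rewrite /cexp zE /= !(mul0r, mulr0, mul1r, addr0, add0r, subr0).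
apply/cvg_nmP => e e0; have e2 : 0 < e / 2 by rewrite divr_gt0.
move/cvgrPdist_lt: hr => /(_ _ e2) h1; move/cvg_nmP: hxy => /(_ _ e2) h2.
apply: filterS2 h1 h2 => N h1 h2.
apply: le_lt_trans (nmB_trans (sexp (x%:C : R[i]) N * sexp ('i * y%:C : R[i]) N) _ _) _.
rewrite (splitr e) ltrD //; apply: le_lt_trans h1; rewrite sub0r normrN zE.
by apply: le_trans (nm_sexpM_sub _ _ _) (ler_norm _).
Qed.



Lemma le_sexpR (x : R) N : 0 <= x -> sexp x N <= expR x.
Proof.
move=> x0.
have nd : {homo (sexp x : nat -> R) : n m / (n <= m)%N >-> n <= m}.
  apply/nondecreasing_seqP => n; rewrite /sexp big_nat_recr //= lerDl.
  by rewrite /texp mulr_ge0 ?exprn_ge0 // invr_ge0.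
have := nondecreasing_cvgn_le nd (cvgP _ (@cvg_sexpR x)) N.
by rewrite (cvg_lim _ (@cvg_sexpR x)).
Qed.

(** For |z| <= 1 every term of degree n >= 2 is at most |z|^2 / n!, and the sum of the 1 / n! is at
    most e; the bound thus holds for all partial sums. *)
Lemma cexp_taylor z : nm z <= 1 -> nm (cexp z - 1 - z) <= expR 1 * nm z ^+ 2.
Proof.
move=> z1.
have h N : nm (sexp z N.+2 - 1 - z) <= expR 1 * nm z ^+ 2.
  have -> : sexp z N.+2 - 1 - z = \sum_(2 <= n < N.+2) texp z n.
    rewrite /sexp big_nat_recl // big_nat_recl //= /texp.
    rewrite fact0 (_ : 1`! = 1)%N // expr0 expr1 invr1 !mul1r.
    by rewrite !big_add1 /=; move: (\sum_(_ <= _ < _) _) => S; ring.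
  apply: le_trans (nm_sum _ _ _) _.
  apply: le_trans (_ : sexp 1 N.+2 * nm z ^+ 2 <= _); last first.
    by rewrite ler_wpM2r ?sqr_ge0 // le_sexpR.
  rewrite /sexp [X in _ <= X * _](big_cat_nat (n := 2)) //= mulrDl -[X in X <= _]add0r; apply: lerD.
    apply: mulr_ge0 (sqr_ge0 _); apply: sumr_ge0 => n _.
    by rewrite /texp mulr_ge0 ?exprn_ge0 // invr_ge0.
  rewrite mulr_suml big_nat [X in _ <= X]big_nat; apply: ler_sum => n /andP[n2 _].
  rewrite nm_texp /texp -mulrA ler_wpM2l ?invr_ge0 // expr1n mul1r.
  by rewrite ler_wiXn2l // nm_ge0.
apply/ler_addgt0Pr => e e0.
have /cvg_nmP/(_ _ e0)[N _ hN] := @cvg_sexp z.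
have -> : cexp z - 1 - z = (sexp z N.+2 - 1 - z) + (cexp z - sexp z N.+2) by ring.
apply: le_trans (nmD _ _) (lerD (h _) _); apply/ltW/hN => /=.
by rewrite -addn2 leq_addr.
Qed.

End ComplexExponential.

Lemma sexp_rmorph (F F' : numFieldType) (phi : {rmorphism F -> F'}) (z : F) N :
  phi (sexp z N) = sexp (phi z) N.
Proof.
rewrite /sexp rmorph_sum; apply: eq_bigr => n _.
by rewrite /texp rmorphM fmorphV rmorph_nat rmorphXn.
Qed.

Lemma sexpC (R : realType) (x : R) N : sexp (x%:C : R[i]) N = (sexp x N)%:C.
Proof. by rewrite -(sexp_rmorph (real_complex R)). Qed.

Lemma sexp_conj (R : realType) (z : R[i]) N : sexp (conjc z) N = conjc (sexp z N).
Proof. by rewrite -(sexp_rmorph (@conjc R)). Qed.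

(** * Projections on the first vectors of an orthonormal basis *)

Section OrthonormalBasis.
Context {R : realType} {V : hilbert R} (b : nat -> V).
Hypothesis b_onb : onb b.
Implicit Types x y : V.

Definition onproj N x : V := \sum_(0 <= n < N) ip (b n) x *: b n.

Lemma ip_onproj N n x : (n < N)%N -> ip (b n) (onproj N x) = ip (b n) x.
Proof.
move=> nN; have [b01 bo _] := b_onb.
rewrite ip_sumr (bigD1_seq n) ?mem_index_iota ?iota_uniq //=.
rewrite big1 ?addr0 => [|m mn]; last by rewrite ipZr bo ?mulr0 //; apply/eqP; rewrite eq_sym.
by rewrite ipZr; have [->|->] := b01 n; rewrite ?ip0l ?mul0r ?mulr1.
Qed.

Lemma onproj_idem N x : ip (onproj N x) (onproj N x) = ip (onproj N x) x.
Proof.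
rewrite {1}/onproj [in RHS]/onproj !ip_suml; apply: eq_big_nat => n /andP[_ nN].
by rewrite !ipZl ip_onproj.
Qed.

Lemma nm_onproj N x : nm (onproj N x) <= nm x.
Proof.
have [->|p0] := eqVneq (nm (onproj N x)) 0; first exact: nm_ge0.
rewrite -(ler_pM2l (_ : 0 < nm (onproj N x))) ?lt_def ?p0 ?nm_ge0 //.
have := CS (onproj N x) x.
by rewrite -onproj_idem ipxx nmR ger0_norm ?sqr_ge0 // expr2.
Qed.

Lemma onproj_cvg x (e : R) : 0 < e ->
  exists N0, forall N, (N0 <= N)%N -> nm (x - onproj N x) < e.
Proof.
move=> e0; have [b01 bo bd] := b_onb.
have e2 : 0 < e / 2 by rewrite divr_gt0.
have [y [n [c [v [bv yE]]]] hy] := dense_nm x bd e2.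
have [|k hk] := @boolp.choice _ _ (fun i k => b k = v i).
  by move=> i; have [k _ <-] := bv i; exists k.
(* Beyond all the indices that occur in [y], the projection fixes [y]; the error then comes from
   [x - y] alone. *)
exists (\max_(i < n) (k i)).+1 => N hN.
have bK m : (m < N)%N -> onproj N (b m) = b m.
  move=> mN; rewrite /onproj (bigD1_seq m) ?mem_index_iota ?iota_uniq //=.
  rewrite big1 ?addr0 => [|l lm]; last by rewrite bo ?scale0r //; exact/eqP.
  by have [->|->] := b01 m; rewrite ?scaler0 ?scale1r.
have pl : linear (onproj N).
  move=> a u w; rewrite /onproj scaler_sumr -big_split /=; apply: eq_bigr => i _.
  by rewrite ipDr ipZr scalerDl scalerA.
have yK : onproj N y = y.
  rewrite yE (lin_sum pl); apply: eq_bigr => i _; rewrite (linZ pl) -hk bK //.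
  by apply: leq_trans hN; rewrite ltnS leq_bigmax.
have -> : x - onproj N x = (x - y) - onproj N (x - y).
  by rewrite (linB pl) yK opprB addrA subrK.
rewrite (splitr e); apply: le_lt_trans (nmD _ _) _; rewrite nmN.
by apply: ltrD => //; apply: le_lt_trans (nm_onproj _ _) hy.
Qed.

Lemma ip_onproj_sum N x y :
  ip x (onproj N y) = \sum_(0 <= n < N) ip x (b n) * ip (b n) y.
Proof. by rewrite ip_sumr; apply: eq_bigr => n _; rewrite ipZr mulrC. Qed.

Lemma ip_onproj_le N x y : nm (ip x (onproj N y)) <= nm x * nm y.
Proof. by apply: le_trans (CS _ _) _; rewrite ler_wpM2l ?nm_ge0 ?nm_onproj. Qed.

Lemma ip_onproj_cvg x y (e : R) : 0 < e ->
  exists N0, forall N, (N0 <= N)%N -> nm (ip x y - ip x (onproj N y)) < e.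
Proof.
move=> e0; have e1 : 0 < e / (nm x + 1) by rewrite divr_gt0 // ltr_wpDl ?nm_ge0.
have [N0 h] := onproj_cvg y e1; exists N0 => N /h hN.
rewrite -ipBr; apply: le_lt_trans (CS _ _) _.
apply: le_lt_trans (_ : (nm x + 1) * nm (y - onproj N y) < _).
  by rewrite ler_wpM2r ?nm_ge0 // lerDl.
by rewrite mulrC -ltr_pdivlMr // ltr_wpDl ?nm_ge0.
Qed.

End OrthonormalBasis.

(** * Positive operators and the decomposition of a state into vectors *)

Section Cholesky.
Context {R : realType} {V : hilbert R}.
Implicit Types (x y : V) (t : V -> V).

Definition psd t := linear t /\ forall x, 0 <= ip x (t x).

Definition qf t x : R := complex.Re (ip x (t x)).

Lemma psd_qf t x : psd t -> ip x (t x) = (qf t x)%:C.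
Proof. by move=> [_ /(_ x)]; rewrite /qf => /ger0_real/RRe_real. Qed.

Lemma qf_ge0 t x : psd t -> 0 <= qf t x.
Proof. by move=> h; rewrite -lecR -psd_qf //; case: h. Qed.

Lemma psd_herm t x y : psd t -> ip x (t y) = (ip y (t x))^*.
Proof.
move=> pt; have tl := pt.1.
(* The form is real at x, y, x + y and x + i y. The vanishing imaginary parts at the last two give
   the two real equations that make the sesquilinear form Hermitian. *)
have h1 := psd_qf (x + y) pt; have h2 := psd_qf (x + 'i%C *: y) pt.
have h3 := psd_qf x pt; have h4 := psd_qf y pt.
move: h1 h2; rewrite !(linD tl) !(linZ tl) !(ipDl, ipDr, ipZl, ipZr) h3 h4.
move: (ip x (t y)) (ip y (t x)) (qf t x) (qf t y) (qf t (x + y)) (qf t (x + 'i%C *: y)).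
move=> [a c] [a' c'] p q r s /eqP; rewrite eq_complex /= => /andP[_ /eqP h5].
move=> /eqP; rewrite eq_complex /= => /andP[_ /eqP h6].
apply/eqP; rewrite eq_complex /=; apply/andP; split; apply/eqP; lra.
Qed.

Lemma psd_CS t x y : psd t -> nm (ip x (t y)) ^+ 2 <= qf t x * qf t y.
Proof.
move=> pt; have tl := pt.1; set B := ip x (t y).
(* The form at x - s conj(B) y: the factor conj(B) turns the cross term into |B|^2, which leaves a
   real polynomial in s. *)
have h (s : R) : 0 <= qf t x - 2 * s * nm B ^+ 2 + s ^+ 2 * nm B ^+ 2 * qf t y.
  have := qf_ge0 (x - (s%:C * B^*) *: y) pt; rewrite /qf.
  rewrite (linB tl) !(linZ tl) !(ipBl, ipBr, ipZl, ipZr).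
  rewrite (psd_herm y x pt) -/B (psd_qf x pt) (psd_qf y pt) nm_sq.
  case: B => a c /=; congr (_ <= _); ring.
have [y0|y0] := eqVneq (qf t y) 0.
  rewrite y0 mulr0 leNgt; apply/negP => Bp.
  (* When [qf t y] is 0 the polynomial is affine in s, and this s would give it the value -1. *)
  have := h ((qf t x + 1) / (2 * nm B ^+ 2)); rewrite y0 mulr0 addr0.
  have -> : 2 * ((qf t x + 1) / (2 * nm B ^+ 2)) * nm B ^+ 2 = qf t x + 1.
    by field; rewrite -sqrf_eq0 gt_eqF.
  by rewrite opprD addrA subrr sub0r oppr_ge0 ler10.
have yp : 0 < qf t y by rewrite lt_def y0 qf_ge0.
rewrite -ler_pdivrMr // -subr_ge0; apply: le_trans (h (qf t y)^-1) _.
by rewrite le_eqVlt; apply/orP; left; apply/eqP; field.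
Qed.

Lemma psd_qf0 t y : psd t -> qf t y = 0 -> t y = 0.
Proof.
move=> pt y0; apply: ip_inj => x; rewrite ip0r; apply/nm_eq0/eqP.
by rewrite -sqrf_eq0 eq_le sqr_ge0 andbT -(mulr0 (qf t x)) -{1}y0 psd_CS.
Qed.

(** Schur complement: the rank-one operator along [t y] that is subtracted is the one that makes the
    rest vanish at [y], and by the Cauchy-Schwarz inequality for the form of [t] the rest stays
    positive. If [qf t y] is 0, its inverse is 0 by convention and nothing is subtracted, which is
    right since then [t y] is 0. *)
Definition schur t y : V -> V :=
  fun x => t x - ((qf t y)^-1%:C * ip (t y) x) *: t y.

Lemma schur_psd t y : psd t -> psd (schur t y).
Proof.
move=> pt; have tl := pt.1; split=> [a u v|x].
  rewrite /schur (linD tl) (linZ tl) ipDr ipZr scalerBr scalerA mulrDr scalerDl.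
  rewrite opprD addrACA; congr (_ + _ + _); congr (- (_ *: _)); ring.
rewrite /schur ipBr ipZr (psd_qf x pt) -mulrA.
have -> : ip (t y) x = (ip x (t y))^* by rewrite -ip_conj.
rewrite conjMnm -rmorphM -rmorphB /= ler0c subr_ge0.
have [->|y0] := eqVneq (qf t y) 0; first by rewrite invr0 mul0r qf_ge0.
by rewrite mulrC ler_pdivrMr ?psd_CS // lt_def y0 qf_ge0.
Qed.

Lemma schur_self t y : psd t -> schur t y y = 0.
Proof.
move=> pt; rewrite /schur (ip_conj (t y)) (psd_qf y pt).
have [y0|y0] := eqVneq (qf t y) 0; first by rewrite (psd_qf0 pt y0) scaler0 subr0.
rewrite (_ : (qf t y)%:C^* = (qf t y)%:C); last by cring.
by rewrite -rmorphM /= mulVf // scale1r subrr.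
Qed.

Lemma schur_ker t y x : psd t -> t x = 0 -> schur t y x = 0.
Proof.
move=> pt x0; rewrite /schur x0 (ip_conj (t y)) (psd_herm x y pt) x0 ip0r.
by rewrite !conjc0 mulr0 scale0r subr0.
Qed.

Variable b : nat -> V.
Variable w : V -> V.
Hypothesis b_onb : onb b.
Hypothesis w_psd : psd w.

(* Cholesky decomposition: [w] is the sum of the operators
   [ketbra (chol m)], which replaces the spectral theorem for trace-class
   operators. *)
Fixpoint chol_rest n : V -> V :=
  if n is n'.+1 then schur (chol_rest n') (b n') else w.

Definition chol n : V :=
  (Num.sqrt (qf (chol_rest n) (b n)))^-1%:C *: chol_rest n (b n).

Lemma chol_rest_psd n : psd (chol_rest n).
Proof. by elim: n => //= n IH; exact: schur_psd. Qed.

Lemma chol_rest_ker n m : (m < n)%N -> chol_rest n (b m) = 0.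
Proof.
elim: n => // n IH; rewrite ltnS leq_eqVlt => /predU1P[->|mn] /=.
  exact/schur_self/chol_rest_psd.
by apply: schur_ker (IH mn); exact: chol_rest_psd.
Qed.

Lemma chol_expand n x :
  w x = \sum_(0 <= m < n) ip (chol m) x *: chol m + chol_rest n x.
Proof.
elim: n => [|n IH]; first by rewrite big_geq // add0r.
rewrite big_nat_recr //= {1}IH -addrA; congr (_ + _).
rewrite /schur addrC -[LHS](subrK (ip (chol n) x *: chol n)); congr (_ - _ + _).
rewrite /chol ipZl scalerA; congr (_ *: _).
rewrite (_ : ((Num.sqrt _)^-1%:C)^* = (Num.sqrt (qf (chol_rest n) (b n)))^-1%:C); last by cring.
rewrite mulrAC -rmorphM /= -invfM -expr2 sqr_sqrtr //.
exact/qf_ge0/chol_rest_psd.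
Qed.

Hypothesis w_tr : (\sum_(0 <= n < N) ip (b n) (w (b n)) : R[i]^o) @[N --> \oo] --> (1 : R[i]^o).

Lemma qf_cvg : \sum_(0 <= n < N) qf w (b n) @[N --> \oo] --> (1 : R).
Proof.
apply/cvgrPdist_lt => e e0; move/cvg_nmP: w_tr => /(_ _ e0).
apply: filterS => N; rewrite (_ : \sum_(_ <= _ < _) _ = (\sum_(0 <= n < N) qf w (b n))%:C).
  by rewrite -(rmorph1 (real_complex R)) -rmorphB nmR.
by rewrite rmorph_sum; apply: eq_bigr => n _; rewrite psd_qf.
Qed.

Lemma chol_bessel N M :
  \sum_(0 <= m < M) \sum_(0 <= n < N) nm (ip (chol m) (b n)) ^+ 2 <= \sum_(0 <= n < N) qf w (b n).
Proof.
rewrite exchange_big; apply: ler_sum => n _ /=.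
rewrite -lecR -psd_qf // (chol_expand M) ipDr ip_sumr rmorph_sum.
rewrite -[X in X <= _]addr0; apply: lerD; last by case: (chol_rest_psd M) => _; exact.
by apply: ler_sum => m _; rewrite ipZr (ip_conj (b n)) mulrC conjMnm.
Qed.

Definition chol_mass M : R := \sum_(0 <= m < M) nm (chol m) ^+ 2.

(** Parseval for each of the finitely many vectors [chol m] with m < M turns their squared norms
    into the double sum of [chol_bessel], with a total error that is as small as desired. *)
Lemma chol_mass_le1 M : chol_mass M <= 1.
Proof.
have qle N : \sum_(0 <= n < N) qf w (b n) <= 1.
  have nd : {homo (fun N => \sum_(0 <= n < N) qf w (b n)) : n m / (n <= m)%N >-> n <= m}.
    by apply/nondecreasing_seqP => n; rewrite big_nat_recr //= lerDl qf_ge0.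
  have := nondecreasing_cvgn_le nd (cvgP _ qf_cvg) N.
  by rewrite (cvg_lim _ qf_cvg).
have e_ (e : R) m : 0 < e -> exists N0, forall N, (N0 <= N)%N ->
    nm (chol m) ^+ 2 <= \sum_(0 <= n < N) nm (ip (chol m) (b n)) ^+ 2 + e.
  move=> e0; have [N0 h] := ip_onproj_cvg b_onb (chol m) (chol m) e0.
  exists N0 => N /h; rewrite ip_onproj_sum ipxx.
  rewrite (_ : \sum_(_ <= _ < _) _ = (\sum_(0 <= n < N) nm (ip (chol m) (b n)) ^+ 2)%:C).
    by rewrite -rmorphB nmR => /(le_lt_trans (ler_norm _)) /ltW; rewrite lerBlDl.
  rewrite rmorph_sum; apply: eq_bigr => n _; rewrite (ip_conj (b n)) mulrC conjMnm //.
have {}e_ (e : R) : 0 < e -> exists N0, forall N, (N0 <= N)%N ->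
    chol_mass M <= \sum_(0 <= m < M) \sum_(0 <= n < N) nm (ip (chol m) (b n)) ^+ 2 + e *+ M.
  move=> e0; rewrite /chol_mass; elim: M => [|M [N1 IH]].
    by exists 0%N => N _; rewrite !big_geq // addr0.
  have [N2 h] := e_ e M e0; exists (maxn N1 N2) => N.
  rewrite geq_max => /andP[/IH h1 /h h2]; rewrite !big_nat_recr //= mulrSr addrACA.
  exact: lerD.
apply/ler_addgt0Pr => e e0.
have [|N0 h] := e_ (e / M.+1%:R); first by rewrite divr_gt0.
apply: le_trans (h N0 (leqnn _)) _; apply: lerD.
  exact: le_trans (chol_bessel _ _) (qle _).
by rewrite -[X in X <= _]mulr_natr mulrAC ler_pdivrMr // ler_pM2l // ler_nat.
Qed.

(** [chol_rest M] vanishes at [b n] for n < M, so that the first M vectors already account for the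
    first M diagonal entries, whose sum tends to 1. *)
Lemma chol_mass_cvg (e : R) : 0 < e ->
  exists M0, forall M, (M0 <= M)%N -> 1 - chol_mass M < e.
Proof.
move=> e0; move/cvgrPdist_lt: qf_cvg => /(_ _ e0)[M0 _ h]; exists M0 => M /h.
move=> /(le_lt_trans (ler_norm _)); apply: le_lt_trans; rewrite lerD2l lerN2.
rewrite (_ : \sum_(0 <= n < M) qf w (b n) =
  \sum_(0 <= m < M) \sum_(0 <= n < M) nm (ip (chol m) (b n)) ^+ 2).
  apply: ler_sum => m _.
  apply: le_trans (_ : nm (ip (chol m) (onproj b M (chol m))) <= _); last first.
    by rewrite expr2; exact: ip_onproj_le.
  rewrite (_ : ip _ _ = (\sum_(0 <= n < M) nm (ip (chol m) (b n)) ^+ 2)%:C).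
    by rewrite nmR ler_norm.
  rewrite ip_onproj_sum rmorph_sum; apply: eq_bigr => n _.
  by rewrite (ip_conj (b n)) mulrC conjMnm.
apply: complexI; rewrite exchange_big rmorph_sum [RHS]rmorph_sum /=.
apply: eq_big_nat => n /andP[_ nM].
rewrite -psd_qf // (chol_expand M) (chol_rest_ker nM) addr0 ip_sumr rmorph_sum.
by apply: eq_bigr => m _; rewrite ipZr (ip_conj (b n)) mulrC conjMnm.
Qed.

(** Let P be the projection on the first N basis vectors. As [chol_rest N] vanishes on them, the
    N-th partial trace of A w equals the sum over m < N of <chol m, P A chol m>. For m < M, with M
    fixed, P can be removed as N grows; the terms from M on are bounded by the tail of the mass,
    uniformly in N. *)
Lemma chol_trace (A : V -> V) (z : R[i]) : linear A -> (forall x, nm (A x) <= nm x) ->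
  (\sum_(0 <= n < N) ip (b n) (A (w (b n))) : R[i]^o) @[N --> \oo] --> (z : R[i]^o) ->
  (\sum_(0 <= m < M) ip (chol m) (A (chol m)) : R[i]^o) @[M --> \oo] --> (z : R[i]^o).
Proof.
move=> Al An /cvg_nmP hz; apply/cvg_nmP => e e0.
have e3 : 0 < e / 3%:R by rewrite divr_gt0.
have [M0 hM] := chol_mass_cvg e3; have [N0 _ hN] := hz _ e3.
exists M0 => // M /= /hM {}hM.
pose t N m := ip (chol m) (onproj b N (A (chol m))).
have TE N : \sum_(0 <= n < N) ip (b n) (A (w (b n))) = \sum_(0 <= m < N) t N m.
  rewrite [RHS](eq_bigr (fun m => \sum_(0 <= n < N) ip (chol m) (b n) * ip (b n) (A (chol m)))); last first.
    by move=> m _; rewrite /t ip_onproj_sum.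
  rewrite [RHS]exchange_big; apply: eq_big_nat => n /andP[_ nN] /=.
  rewrite (chol_expand N) (chol_rest_ker nN) addr0 (lin_sum Al) ip_sumr.
  by apply: eq_bigr => m _; rewrite (linZ Al) ipZr.
have [N1 hN1] : exists N1, forall N, (N1 <= N)%N ->
    nm (\sum_(0 <= m < M) ip (chol m) (A (chol m)) - \sum_(0 <= m < M) t N m) < e / 3%:R.
  suff H (k : nat) : exists N1, forall N, (N1 <= N)%N ->
    nm (\sum_(0 <= m < k) ip (chol m) (A (chol m)) - \sum_(0 <= m < k) t N m) <= k%:R * (e / 3%:R / M.+1%:R).
    have [N1 h] := H M; exists N1 => N /h h1; apply: le_lt_trans h1 _.
    by rewrite mulrC mulrAC ltr_pdivrMr // ltr_pM2l // ltr_nat.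
  elim: k => [|k [N1 IH]]; first by exists 0%N => N _; rewrite !big_geq // subrr nm0 mul0r.
  have e4 : 0 < e / 3%:R / M.+1%:R by rewrite divr_gt0.
  have [N2 h2] := ip_onproj_cvg b_onb (chol k) (A (chol k)) e4.
  exists (maxn N1 N2) => N; rewrite geq_max => /andP[/IH h1 /h2 {}h2].
  rewrite !big_nat_recr //= opprD addrACA -natr1 mulrDl mul1r.
  by apply: le_trans (nmD _ _) (lerD h1 (ltW h2)).
pose N := maxn M (maxn N0 N1).
have MN : (M <= N)%N by rewrite leq_maxl.
have := hN N; rewrite /= !leq_max leqnn orbT /= => /(_ isT) {}hN.
have := hN1 N; rewrite !leq_max leqnn !orbT => /(_ isT) {}hN1.
rewrite TE (big_cat_nat (n := M)) //= in hN.
have tail : nm (\sum_(M <= m < N) t N m) < e / 3%:R.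
  apply: le_lt_trans hM; apply: le_trans (nm_sum _ _ _) _.
  have := chol_mass_le1 N; rewrite /chol_mass (big_cat_nat (n := M)) //= -lerBrDl.
  apply: le_trans; apply: ler_sum => m _.
  by apply: le_trans (ip_onproj_le b_onb _ _ _) _; rewrite expr2 ler_wpM2l ?nm_ge0.
have -> : e = e / 3%:R + e / 3%:R + e / 3%:R by field.
have -> : z - \sum_(0 <= m < M) ip (chol m) (A (chol m)) =
  (z - (\sum_(0 <= m < M) t N m + \sum_(M <= m < N) t N m)) + \sum_(M <= m < N) t N m
  + - (\sum_(0 <= m < M) ip (chol m) (A (chol m)) - \sum_(0 <= m < M) t N m) by ring.
apply: le_lt_trans (nmD _ _) _; rewrite nmN ltrD //.
by apply: le_lt_trans (nmD _ _) _; rewrite ltrD.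
Qed.

End Cholesky.

(** * The commutator estimate for vectors and for states *)

Section Uncertainty.
Context {R : realType}.

Lemma sum_cauchy_schwarz (a b : nat -> R) M :
  (forall m, 0 <= a m) -> (forall m, 0 <= b m) ->
  \sum_(0 <= m < M) a m * b m <=
  Num.sqrt (\sum_(0 <= m < M) a m ^+ 2) * Num.sqrt (\sum_(0 <= m < M) b m ^+ 2).
Proof.
move=> a0 b0; elim: M => [|M IH]; first by rewrite !big_geq // mulr_ge0 ?sqrtr_ge0.
rewrite !big_nat_recr //=.
have : 0 <= \sum_(0 <= m < M) a m ^+ 2 by apply: sumr_ge0 => m _; exact: sqr_ge0.
have : 0 <= \sum_(0 <= m < M) b m ^+ 2 by apply: sumr_ge0 => m _; exact: sqr_ge0.
move: (\sum_(_ <= _ < _) b _ ^+ 2) (\sum_(_ <= _ < _) a _ ^+ 2) IH => Y X IH Y0 X0.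
apply: le_trans (lerD IH (lexx _)) _.
rewrite -(ler_pXn2r (n := 2)) ?nnegrE ?addr_ge0 ?mulr_ge0 ?sqrtr_ge0 //.
rewrite [X in _ <= X]exprMn !sqr_sqrtr ?addr_ge0 ?sqr_ge0 //.
rewrite -{2}(sqr_sqrtr X0) -{2}(sqr_sqrtr Y0) -subr_ge0.
move: (Num.sqrt X) (Num.sqrt Y) (a M) (b M) => x y c e.
by apply: le_trans (sqr_ge0 (x * e - c * y)) _; rewrite le_eqVlt; apply/orP; left; apply/eqP; ring.
Qed.

Context {V : hilbert R}.
Implicit Types (x y : V) (A B : V -> V).

Lemma isometry_ip A : linear A -> (forall x, nm (A x) = nm x) ->
  forall x y, ip (A x) (A y) = ip x y.
Proof.
move=> Al An x y.
have hRe u v : complex.Re (ip (A u) (A v)) = complex.Re (ip u v).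
  have := nm_sqD (A u) (A v); rewrite -(linD Al) !An nm_sqD => /addrI /mulfI -> //.
have := hRe x ('i%C *: y); have := hRe x y; rewrite (linZ Al) !ipZr.
case: (ip (A x) (A y)) => a b; case: (ip x y) => c e /= -> h.
by congr (_ +i* _); move: h; lra.
Qed.

Lemma weyl_commutator_bound A B (eta : R[i]) :
  linear A -> linear B -> (forall x, nm (A x) = nm x) -> (forall x, nm (B x) = nm x) ->
  (forall x, A (B x) = eta *: B (A x)) ->
  forall x, nm (eta - 1) * (nm x ^+ 2 - nm x * nm (A x - x) - nm x * nm (B x - x)) <=
    2 * (nm (A x - x) * nm (B x - x)).
Proof.
move=> Al Bl An Bn AB x.
(* Moves A - 1 to the left argument without an adjoint: <x, u> is rewritten as <A x, A u>. *)
have ipA u : ip x (A u - u) = ip (x - A x) (A u).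
  by rewrite ipBr ipBl (isometry_ip Al An).
have ipB u : ip x (B u - u) = ip (x - B x) (B u).
  by rewrite ipBr ipBl (isometry_ip Bl Bn).
have comm : (eta - 1) * ip x (B (A x)) = ip (x - A x) (A (B x - x)) - ip (x - B x) (B (A x - x)).
  by rewrite -ipA -ipB (linB Al) (linB Bl) AB !(ipBr, ipZr); ring.
apply: le_trans (_ : nm ((eta - 1) * ip x (B (A x))) <= _); last first.
  rewrite comm; apply: le_trans (nmD _ _) _; rewrite nmN mulr_natl mulr2n; apply: lerD.
    by apply: le_trans (CS _ _) _; rewrite An nmBC.
  by apply: le_trans (CS _ _) _; rewrite Bn nmBC mulrC.
rewrite nmM ler_wpM2l ?nm_ge0 //.
(* Expansion around [x]: it bounds <x, B A x> from below by |x|^2 minus terms that are small with A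
   x - x and B x - x. *)
have -> : ip x (B (A x)) = ip x x + ip x (B (A x - x)) + ip x (B x - x).
  by rewrite (linB Bl) !ipBr; ring.
rewrite -[in X in _ <= X]addrA ipxx; set v := _ + ip x (B x - x).
have hv : nm v <= nm x * nm (A x - x) + nm x * nm (B x - x).
  apply: le_trans (nmD _ _) (lerD _ _); apply: le_trans (CS _ _) _ => //.
  by rewrite Bn.
apply: le_trans (_ : nm (nm x ^+ 2)%:C - nm v <= _).
  by rewrite nmR ger0_norm ?sqr_ge0 // -addrA lerD2l -opprD lerN2.
by rewrite -[v]opprK nmN nm_dist.
Qed.

Lemma state_uncertainty A B (eta : R[i]) (phi : nat -> V) (dA dB : R) :
  linear A -> linear B -> (forall x, nm (A x) = nm x) -> (forall x, nm (B x) = nm x) ->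
  (forall x, A (B x) = eta *: B (A x)) ->
  (forall M, \sum_(0 <= m < M) nm (phi m) ^+ 2 <= 1) ->
  (forall e : R, 0 < e -> exists M, 1 - \sum_(0 <= m < M) nm (phi m) ^+ 2 < e) ->
  (forall M, \sum_(0 <= m < M) nm (A (phi m) - phi m) ^+ 2 <= dA) ->
  (forall M, \sum_(0 <= m < M) nm (B (phi m) - phi m) ^+ 2 <= dB) ->
  nm (eta - 1) * (1 - Num.sqrt dA - Num.sqrt dB) <= 2 * (Num.sqrt dA * Num.sqrt dB).
Proof.
move=> Al Bl An Bn AB N1 Ncvg hA hB; set E := nm (eta - 1).
have E0 : 0 <= E by exact: nm_ge0.
pose a m := nm (A (phi m) - phi m); pose b m := nm (B (phi m) - phi m).
pose n m := nm (phi m).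
have cs (u v : nat -> R) (du dv : R) M : (forall m, 0 <= u m) -> (forall m, 0 <= v m) ->
    \sum_(0 <= m < M) u m ^+ 2 <= du -> \sum_(0 <= m < M) v m ^+ 2 <= dv ->
    \sum_(0 <= m < M) u m * v m <= Num.sqrt du * Num.sqrt dv.
  move=> u0 v0 hu hv; apply: le_trans (sum_cauchy_schwarz _ u0 v0) _.
  by rewrite ler_pM ?sqrtr_ge0 // ler_wsqrtr.
apply/ler_addgt0Pr => e e0.
(* The missing mass costs at most E * (e / (E + 1)) <= e; E + 1 is used because E may be 0. *)
have [|M hM] := Ncvg (e / (E + 1)); first by rewrite divr_gt0 // ltr_wpDl.
have hsum : E * (\sum_(0 <= m < M) n m ^+ 2 - \sum_(0 <= m < M) n m * a m
    - \sum_(0 <= m < M) n m * b m) <= 2 * \sum_(0 <= m < M) a m * b m.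
  rewrite -!sumrB !mulr_sumr; apply: ler_sum => m _.
  exact: weyl_commutator_bound.
have h1 := cs n a 1 dA M (fun=> nm_ge0 _) (fun=> nm_ge0 _) (N1 M) (hA M).
have h2 := cs n b 1 dB M (fun=> nm_ge0 _) (fun=> nm_ge0 _) (N1 M) (hB M).
have h3 := cs a b dA dB M (fun=> nm_ge0 _) (fun=> nm_ge0 _) (hA M) (hB M).
rewrite sqrtr1 !mul1r in h1 h2.
have h4 : E * (1 - Num.sqrt dA - Num.sqrt dB) <=
    E * (\sum_(0 <= m < M) n m ^+ 2 - \sum_(0 <= m < M) n m * a m
    - \sum_(0 <= m < M) n m * b m) + E * (e / (E + 1)).
  rewrite -mulrDr ler_wpM2l //; move: hM; rewrite -/n; lra.
apply: le_trans h4 _; apply: lerD; first by apply: le_trans hsum _; rewrite ler_pM2l.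
by rewrite mulrA ler_pdivrMr ?ltr_wpDl // mulrC ler_pM2l // lerDl.
Qed.

End Uncertainty.

(** * Complex integrals and square-integrable functions *)

Section RealIntegrable.
Context d (T : measurableType d) {R : realType} (mu : {measure set T -> \bar R}) (D : set T).
Hypothesis mD : measurable D.
Implicit Types f g : T -> R.

Lemma integrableZ_EFin (c : R) f : mu.-integrable D (EFin \o f) ->
  mu.-integrable D (EFin \o (fun x => c * f x)).
Proof.
move=> h; rewrite (_ : EFin \o _ = (fun x => c%:E * (EFin \o f) x)%E) //.
exact: integrableZl.
Qed.

Lemma integrableD_EFin f g : mu.-integrable D (EFin \o f) -> mu.-integrable D (EFin \o g) ->
  mu.-integrable D (EFin \o (fun x => f x + g x)).
Proof.
by move=> h1 h2; rewrite (_ : EFin \o _ = ((EFin \o f) \+ (EFin \o g))%E) //; exact: integrableD.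
Qed.
End RealIntegrable.

Section ComplexIntegral.
Context {R : realType}.
Notation mu := (@lebesgue_measure R).
Notation Rplus := (`[0%R, +oo[%classic : set R).
Implicit Types (D : set R) (F G : R -> R[i]).

Definition cintegrable D F :=
  mu.-integrable D (EFin \o (fun x => complex.Re (F x))) /\
  mu.-integrable D (EFin \o (fun x => complex.Im (F x))).

Lemma lebD D F G : measurable (D : set (measurableTypeR R)) -> cintegrable D F -> cintegrable D G ->
  leb D (fun s => F s + G s) = leb D F + leb D G.
Proof.
move=> mD [F1 F2] [G1 G2]; apply/eqP; rewrite eq_complex /=.
by apply/andP; split; apply/eqP; rewrite -RintegralD //; apply: eq_Rintegral => x _; rewrite raddfD.
Qed.

Lemma lebZ D F z : measurable (D : set (measurableTypeR R)) -> cintegrable D F ->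
  leb D (fun s => z * F s) = z * leb D F.
Proof.
move=> mD [F1 F2]; rewrite /leb /cintegral; case: z => a b.
have i1 (c : R) : mu.-integrable D (EFin \o (fun x => c * complex.Re (F x))) by exact: (integrableZ_EFin mD c F1).
have i2 (c : R) : mu.-integrable D (EFin \o (fun x => c * complex.Im (F x))) by exact: (integrableZ_EFin mD c F2).
apply/eqP; rewrite eq_complex /=.
by apply/andP; split; apply/eqP; rewrite -!RintegralZl // -?RintegralB -?RintegralD //;
  apply: eq_Rintegral => x _; case: (F x).
Qed.

Lemma leb_conj D F : measurable (D : set (measurableTypeR R)) -> cintegrable D F ->
  leb D (fun s => conjc (F s)) = conjc (leb D F).
Proof.
move=> mD [F1 F2]; apply/eqP; rewrite eq_complex /=; apply/andP; split; apply/eqP.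
  by apply: eq_Rintegral => x _; case: (F x).
rewrite -mulN1r -RintegralZl //; apply: eq_Rintegral => x _.
by rewrite mulN1r; case: (F x).
Qed.

Lemma eq_leb D F G : (forall x, D x -> F x = G x) -> leb D F = leb D G.
Proof.
move=> h; rewrite /leb /cintegral.
by congr (_ +i* _); apply: eq_Rintegral => x; rewrite inE => /h ->.
Qed.

Lemma leb0 D : leb D (fun=> 0 : R[i]) = 0.
Proof. by rewrite /leb /cintegral /= /Rintegral integral0 /=. Qed.

Context {d : nat}.
Implicit Types f g h : cfun R d.

Definition cadd f (z : R[i]) g : cfun R d := fun k s => f k s + z * g k s.

Lemma sqintP f : sqint f <-> forall k : 'I_d,
  [/\ measurable_fun Rplus (fun s => complex.Re (f k s)),
      measurable_fun Rplus (fun s => complex.Im (f k s))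
    & mu.-integrable Rplus
       (EFin \o (fun s => complex.Re (f k s) ^+ 2 + complex.Im (f k s) ^+ 2))].
Proof.
split=> hf k; have [m1 m2 h] := hf k; split=> //.
  apply/integrableP; split.
    apply/measurable_realfun.measurable_EFinP; apply: measurable_realfun.measurable_funD; exact: measurable_realfun.measurable_funX.
  apply: le_lt_trans h; rewrite le_eqVlt; apply/orP; left; apply/eqP.
  by apply: eq_integral => x _ /=; rewrite ger0_norm // addr_ge0 ?sqr_ge0.
move/integrableP : h => [_]; apply: le_lt_trans; rewrite le_eqVlt; apply/orP; left; apply/eqP.
by apply: eq_integral => x _ /=; rewrite ger0_norm // addr_ge0 ?sqr_ge0.
Qed.

Let mRplus : measurable (Rplus : set (measurableTypeR R)).
Proof. exact: measurable_itv. Qed.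

Lemma sqint_cintegrable f g k : sqint f -> sqint g ->
  cintegrable Rplus (fun s => conjc (f k s) * g k s).
Proof.
move=> /sqintP/(_ k)[f1 f2 f3] /sqintP/(_ k)[g1 g2 g3].
have hfg := integrableD_EFin mRplus f3 g3.
have bd s : nm (conjc (f k s) * g k s) <=
    complex.Re (f k s) ^+ 2 + complex.Im (f k s) ^+ 2 +
    (complex.Re (g k s) ^+ 2 + complex.Im (g k s) ^+ 2).
  rewrite nmM nm_conj -!nm_sq; move: (nm _) (nm _) (nm_ge0 (f k s)) (nm_ge0 (g k s)) => a b a0 b0.
  rewrite -subr_ge0; apply: le_trans (_ : 0 <= (a - b) ^+ 2 + a * b) _.
    by rewrite addr_ge0 ?sqr_ge0 ?mulr_ge0.
  by rewrite le_eqVlt; apply/orP; left; apply/eqP; ring.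
split; apply: le_integrable hfg => //.
- apply/measurable_realfun.measurable_EFinP.
  rewrite (_ : (fun _ => _) = fun s => complex.Re (f k s) * complex.Re (g k s) +
      complex.Im (f k s) * complex.Im (g k s)).
    by apply: measurable_realfun.measurable_funD; apply: measurable_realfun.measurable_funM.
  by apply/funext => s; case: (f k s) => a b; case: (g k s) => c e /=; rewrite mulNr opprK.
- move=> s _; rewrite lee_fin.
  exact: le_trans (Re_abs_nm _) (le_trans (bd s) (ler_norm _)).
- apply/measurable_realfun.measurable_EFinP.
  rewrite (_ : (fun _ => _) = fun s => complex.Re (f k s) * complex.Im (g k s) -
      complex.Im (f k s) * complex.Re (g k s)).
    by apply: measurable_realfun.measurable_funB; apply: measurable_realfun.measurable_funM.
  by apply/funext => s; case: (f k s) => a b; case: (g k s) => c e /=; rewrite mulNr.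
- move=> s _; rewrite lee_fin.
  exact: le_trans (Im_abs_nm _) (le_trans (bd s) (ler_norm _)).
Qed.

Lemma sqint_cadd f z g : sqint f -> sqint g -> sqint (cadd f z g).
Proof.
move=> sf sg; apply/sqintP => k.
have /sqintP/(_ k)[f1 f2 f3] := sf; have /sqintP/(_ k)[g1 g2 g3] := sg.
have m1 : measurable_fun Rplus (fun s => complex.Re (cadd f z g k s)).
  rewrite (_ : (fun _ => _) = (fun s => complex.Re (f k s) + (complex.Re z * complex.Re (g k s) - complex.Im z * complex.Im (g k s)))).
    apply: measurable_realfun.measurable_funD => //; apply: measurable_realfun.measurable_funB;
    exact: measurable_realfun.measurable_funM.
  by apply/funext => s; rewrite /cadd; case: (f k s) => a b; case: (g k s) => c e; case: z {sf sg}.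
have m2 : measurable_fun Rplus (fun s => complex.Im (cadd f z g k s)).
  rewrite (_ : (fun _ => _) = (fun s => complex.Im (f k s) + (complex.Re z * complex.Im (g k s) + complex.Im z * complex.Re (g k s)))).
    apply: measurable_realfun.measurable_funD => //; apply: measurable_realfun.measurable_funD;
    exact: measurable_realfun.measurable_funM.
  by apply/funext => s; rewrite /cadd; case: (f k s) => a b; case: (g k s) => c e; case: z {sf sg m1}.
split=> //.
have hfg := integrableD_EFin mRplus (integrableZ_EFin mRplus 2 f3) (integrableZ_EFin mRplus (2 * nm z ^+ 2) g3).
apply: le_integrable hfg => //.
  by apply/measurable_realfun.measurable_EFinP; apply: measurable_realfun.measurable_funD; exact: measurable_realfun.measurable_funX.
move=> s _ /=; rewrite lee_fin -!nm_sq; apply: le_trans (ler_norm _); rewrite ger0_norm ?sqr_ge0 //.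
rewrite /cadd; apply: le_trans (_ : (nm (f k s) + nm (z * g k s)) ^+ 2 <= _).
  by rewrite ler_sqr ?nnegrE ?addr_ge0 ?nm_ge0 // nmD.
rewrite nmM -subr_ge0; apply: le_trans (sqr_ge0 (nm (f k s) - nm z * nm (g k s))) _.
by rewrite le_eqVlt; apply/orP; left; apply/eqP; ring.
Qed.

Lemma l2ipDr h f z g : sqint h -> sqint f -> sqint g ->
  l2ip h (cadd f z g) = l2ip h f + z * l2ip h g.
Proof.
move=> sh sf sg; rewrite /l2ip mulr_sumr -big_split /=; apply: eq_bigr => k _.
have h1 := sqint_cintegrable k sh sf; have h2 := sqint_cintegrable k sh sg.
rewrite -lebZ // -lebD //; first by apply: eq_leb => s _; rewrite /cadd; ring.
have [[i1 i2]] := (h2); case: {sh sf sg} z => a b.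
split.
  rewrite (_ : (fun _ => _) = (fun s => a * complex.Re (conjc (h k s) * g k s)  + (- b) * complex.Im (conjc (h k s) * g k s))).
    exact: (integrableD_EFin mRplus (integrableZ_EFin mRplus _ i1) (integrableZ_EFin mRplus _ i2)).
  by apply/funext => s; case: (_ * g k s) => u v /=; ring.
rewrite (_ : (fun _ => _) = (fun s => a * complex.Im (conjc (h k s) * g k s)  + b * complex.Re (conjc (h k s) * g k s))).
  exact: (integrableD_EFin mRplus (integrableZ_EFin mRplus _ i2) (integrableZ_EFin mRplus _ i1)).
by apply/funext => s; case: (_ * g k s) => u v /=; ring.
Qed.

Lemma l2ipC f g : sqint f -> sqint g -> l2ip g f = conjc (l2ip f g).
Proof.
move=> sf sg; rewrite /l2ip (rmorph_sum (@conjc R)); apply: eq_bigr => k _.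
apply: etrans (leb_conj mRplus (sqint_cintegrable k sf sg)).
by apply: eq_leb => s _; case: (f k s) => a b; case: (g k s) => c e; cring.
Qed.

Lemma l2ipDl h f z g : sqint h -> sqint f -> sqint g ->
  l2ip (cadd f z g) h = l2ip f h + conjc z * l2ip g h.
Proof.
move=> sh sf sg; rewrite l2ipC ?l2ipDr //; last exact: sqint_cadd.
by rewrite (l2ipC (g := f) (f := h)) // (l2ipC (g := g) (f := h)) // rmorphD rmorphM.
Qed.

End ComplexIntegral.

(** * Limits in Hilbert space and the exponential vectors of Fock space *)

Section Limits.
Context {R : realType} {V : hilbert R}.
Implicit Types (x y l : V).

Lemma nm_cauchy_cvg T (F : set_system T) {FF : ProperFilter F} (u : T -> V) :
  (forall e : R, 0 < e -> exists2 A : set T, F A &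
     forall s t, A s -> A t -> nm (u s - u t) < e) ->
  exists l, u @ F --> l.
Proof.
move=> h; suff : cvg (u @ F) by move=> /cvg_ex.
apply: cauchy_cvg; apply: cauchy_exP => -[e e']; rewrite ltcE /= => /andP[/eqP-> /h[A FA hA]].
have [s As] := filter_ex FA.
exists (u s); rewrite /nbhs /= ; apply: filterS FA => t At.
by rewrite -ball_normE /= nmE ltcR hA.
Qed.

Lemma ip_cvg T (F : set_system T) {FF : Filter F} (u : T -> V) l y :
  u @ F --> l -> (ip y (u t) : R[i]^o) @[t --> F] --> (ip y l : R[i]^o).
Proof.
move=> /cvg_nmP h; apply/cvg_nmP => e e0.
have e1 : 0 < e / (nm y + 1) by rewrite divr_gt0 // ltr_wpDl ?nm_ge0.
apply: filterS (h _ e1) => t; rewrite ltr_pdivlMr ?ltr_wpDl ?nm_ge0 // -ipBr.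
apply: le_lt_trans; apply: le_trans (CS _ _) _.
by rewrite mulrC ler_wpM2l ?nm_ge0 // lerDl.
Qed.

Lemma cplx_cvg_uniq T (F : set_system T) {FF : ProperFilter F} (u : T -> R[i]) (l l' : R[i]) :
  (u t : R[i]^o) @[t --> F] --> (l : R[i]^o) -> (u t : R[i]^o) @[t --> F] --> (l' : R[i]^o) -> l = l'.
Proof. by move=> h h'; apply: (cvg_unique (@norm_hausdorff _ (R[i]^o))) h h'. Qed.

End Limits.

Section Fock.
Context {R : realType} {d : nat} {G : hilbert R} (pow : nat -> cfun R d -> G).
Hypothesis G_fock : is_fock pow.
Implicit Types f g : cfun R d.

Let nrm n : R[i] := ((Num.sqrt (n`!%:R : R))^-1)%:C.

Lemma nrm_sq n : nrm n * nrm n = n`!%:R^-1.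
Proof.
by rewrite /nrm -rmorphM /= -invfM -expr2 sqr_sqrtr // fmorphV rmorph_nat.
Qed.

Lemma nrm_conj n : conjc (nrm n) = nrm n.
Proof. by rewrite /nrm; cring. Qed.

Definition expv_part f N : G := \sum_(0 <= n < N) nrm n *: pow n f.
(** Exponential vector: [coh] without its normalizing factor. That factor would change under
    displacements, and without it inner products are plain exponentials. *)
Definition expv f : G := lim (expv_part f N @[N --> \oo]).

Lemma ip_pow n m f g : sqint f -> sqint g ->
  ip (pow n f) (pow m g) = if n == m then l2ip f g ^+ n else 0.
Proof. by case: G_fock => h _; exact: h. Qed.

Lemma l2ip_ge0 f : sqint f -> l2ip f f = (nm (pow 1 f) ^+ 2)%:C.
Proof. by move=> sf; rewrite -ipxx ip_pow // eqxx expr1. Qed.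

Lemma ip_part f g N M : sqint f -> sqint g -> (N <= M)%N ->
  ip (expv_part f N) (expv_part g M) = sexp (l2ip f g) N.
Proof.
move=> sf sg NM; rewrite ip_suml; apply: eq_big_nat => n /andP[_ nN].
rewrite ipZl nrm_conj ip_sumr (bigD1_seq n) ?mem_index_iota ?iota_uniq ?(leq_trans nN) //=.
rewrite big1 => [|m mn]; last by rewrite ipZr ip_pow // eq_sym (negbTE mn) mulr0.
by rewrite addr0 ipZr ip_pow // eqxx mulrA nrm_sq.
Qed.

Lemma nm_part_sub f N M : sqint f -> (N <= M)%N ->
  nm (expv_part f M - expv_part f N) ^+ 2 =
  sexp (nm (pow 1 f) ^+ 2) M - sexp (nm (pow 1 f) ^+ 2) N.
Proof.
move=> sf NM; apply: complexI; rewrite -ipxx !(ipBl, ipBr).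
rewrite (ip_conj (expv_part f M) (expv_part f N)) !ip_part // l2ip_ge0 //.
by rewrite !sexpC; cring.
Qed.

Lemma expv_cvg f : sqint f -> expv_part f N @[N --> \oo] --> expv f.
Proof.
move=> sf; suff H : exists l : G, expv_part f N @[N --> \oo] --> l.
  by have [l hl] := H; rewrite /expv (cvg_lim (@norm_hausdorff _ G) hl).
apply: nm_cauchy_cvg => e e0; set r := nm (pow 1 f) ^+ 2.
have /cvgrPdist_lt h := @cvg_sexpR R r.
have e2 : 0 < e ^+ 2 / 2 by rewrite divr_gt0 ?exprn_gt0.
have [N0 _ hN] := h _ e2.
exists [set N | (N0 <= N)%N] => [|N M /= hn hm]; first by exists N0.
wlog NM : N M hn hm / (N <= M)%N.
  by move=> H; case: (leqP N M) => [/H|/ltnW /H]; rewrite 1?nmBC; apply.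
rewrite nmBC -(ltr_pXn2r (n := 2)) ?nnegrE ?nm_ge0 ?ltW // nm_part_sub // -/r.
have := hN N hn; have := hN M hm; rewrite /= !ltr_norml => /andP[h1 h2] /andP[h3 h4].
move: h1 h2 h3 h4; lra.
Qed.

(** [ip_part] requires N <= M, so the limits are taken one after the other: for fixed N the inner
    product no longer depends on M once M >= N. *)
Lemma ip_expv f g : sqint f -> sqint g -> ip (expv f) (expv g) = cexp (l2ip f g).
Proof.
move=> sf sg; apply: (@cplx_cvg_uniq R _ \oo _ (fun N => sexp (l2ip f g) N)); last exact: cvg_sexp.
have h N : ip (expv f) (expv_part g N) = sexp (l2ip f g) N.
  rewrite ip_conj; apply: (@cplx_cvg_uniq R _ \oo _ (fun M => (ip (expv_part g N) (expv_part f M))^*)).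
    have h : (ip (expv_part g N) (expv_part f M) : R[i]^o) @[M --> \oo] -->
        (ip (expv_part g N) (expv f) : R[i]^o) by exact: ip_cvg (expv_cvg sf).
    move/cvg_nmP : h => h; apply/cvg_nmP => e /h; apply: filterS => M; rewrite -(rmorphB (@conjc R)) nm_conj //.
  apply/cvg_nmP => e e0; exists N => // M /= NM.
  by rewrite ip_part // (l2ipC sf sg) sexp_conj conjcK subrr nm0.
by under eq_fun do rewrite -h; exact: ip_cvg (expv_cvg sg).
Qed.

Lemma cohE f : coh pow f = (expR (- complex.Re (l2ip f f) / 2))%:C *: expv f.
Proof. by []. Qed.

Lemma nm_expv_part f N : sqint f ->
  nm (expv f - expv_part f N) ^+ 2 <= expR (nm (pow 1 f) ^+ 2) - sexp (nm (pow 1 f) ^+ 2) N.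
Proof.
move=> sf; set r := nm (pow 1 f) ^+ 2; have r0 : 0 <= r by exact: sqr_ge0.
have h0 : 0 <= expR r - sexp r N by rewrite subr_ge0 le_sexpR.
suff : nm (expv f - expv_part f N) <= Num.sqrt (expR r - sexp r N).
  by move=> h; rewrite -(sqr_sqrtr h0) ler_sqr ?nnegrE ?nm_ge0 ?sqrtr_ge0.
apply/ler_addgt0Pr => e e0; have /cvg_nmP/(_ _ e0)[M0 _ hM] := expv_cvg sf.
pose M := maxn M0 N; have := hM M; rewrite /= leq_maxl => /(_ isT) h1.
apply: le_trans (nmB_trans (expv_part f M) _ _) _; rewrite addrC; apply: lerD; last exact: ltW.
have NM : (N <= M)%N by rewrite leq_maxr.
rewrite -[X in X <= _]ger0_norm ?nm_ge0 // -sqrtr_sqr ler_wsqrtr // nm_part_sub // -/r.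
by rewrite lerD2r le_sexpR.
Qed.

(** Each term of degree at least n carries a factor t^n, and what remains is dominated by the series
    at r. *)
Lemma sexp_tail_le (r t : R) n : 0 <= r -> 0 <= t <= 1 ->
  expR (t * r) - sexp (t * r) n <= t ^+ n * expR r.
Proof.
move=> r0 /andP[t0 t1]; apply/ler_addgt0Pr => e e0.
have /cvgrPdist_lt/(_ _ e0)[M0 _ hM] := @cvg_sexpR R (t * r).
pose M := maxn M0 n; have := hM M; rewrite /= leq_maxl => /(_ isT) h1.
have nM : (n <= M)%N by rewrite leq_maxr.
have -> : expR (t * r) - sexp (t * r) n = (sexp (t * r) M - sexp (t * r) n) + (expR (t * r) - sexp (t * r) M) by ring.
apply: lerD; last exact: le_trans (ler_norm _) (ltW h1).
rewrite {1}/sexp (big_cat_nat (n := n)) //= addrAC subrr add0r.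
apply: le_trans (_ : t ^+ n * sexp r M <= _); last by rewrite ler_wpM2l ?exprn_ge0 ?le_sexpR.
rewrite /sexp [X in _ <= _ * X](big_cat_nat (n := n)) //= mulrDr -[X in X <= _]add0r; apply: lerD.
  by apply: mulr_ge0; [exact: exprn_ge0 | apply: sumr_ge0 => m _; rewrite mulr_ge0 ?invr_ge0 ?exprn_ge0].
rewrite mulr_sumr big_nat [X in _ <= X]big_nat; apply: ler_sum => m /andP[nm' _].
rewrite /texp exprMn [X in _ <= X]mulrCA ler_wpM2l ?invr_ge0 // ler_wpM2r ?exprn_ge0 //.
exact: ler_wiXn2l.
Qed.

(** Multiplication by z, written as f + (z - 1) f in order to inherit the lemmas on [cadd]. *)
Definition cscale (z : R[i]) f : cfun R d := cadd f (z - 1) f.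

Lemma sqint_cscale z f : sqint f -> sqint (cscale z f).
Proof. by move=> sf; exact: sqint_cadd. Qed.

Lemma l2ip_cscale z f : sqint f -> l2ip f (cscale z f) = z * l2ip f f.
Proof. by move=> sf; rewrite l2ipDr //; ring. Qed.

Lemma l2ip_cscale2 z f : sqint f -> l2ip (cscale z f) (cscale z f) = conjc z * z * l2ip f f.
Proof.
move=> sf; have sc := sqint_cscale z sf.
by rewrite {2}/cscale l2ipDr // /cscale l2ipDl // rmorphB rmorph1; ring.
Qed.

(** Homogeneity of [pow] is not part of [is_fock]; it follows from the inner products, which give
    the difference of the two sides the norm 0. *)
Lemma pow_cscale (t : R) n f : sqint f -> pow n (cscale t%:C f) = (t ^+ n)%:C *: pow n f.
Proof.
move=> sf; apply/eqP; rewrite -subr_eq0; apply/eqP/nm_eq0/eqP.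
have sc := sqint_cscale t%:C sf.
rewrite -sqrf_eq0 -eqcR -ipxx !(ipBl, ipBr, ipZl, ipZr) !ip_pow // eqxx.
rewrite (l2ipC sf sc) l2ip_cscale // l2ip_cscale2 // l2ip_ge0 //.
have -> : conjc t%:C = t%:C by cring.
have -> : conjc (t ^+ n)%:C = (t ^+ n)%:C by cring.
move: (nm _ ^+ 2) => r; have -> : (t%:C * r%:C)^* = t%:C * r%:C by cring.
rewrite !exprMn -!rmorphXn /= -!rmorphM -!rmorphB /= eqcR; apply/eqP; ring.
Qed.

Definition in_expv_closure (x : G) := forall e : R, 0 < e ->
  exists2 a, lspan [set expv f | f in @sqint R d] a & nm (x - a) < e.

Lemma lspanD (A : set G) a b : lspan A a -> lspan A b -> lspan A (a + b).
Proof.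
move=> [n [c [v [Av ->]]]] [m [c' [v' [Av' ->]]]].
exists (n + m)%N, (fun i => match fintype.split i with inl j => c j | inr j => c' j end),
  (fun i => match fintype.split i with inl j => v j | inr j => v' j end); split.
  by move=> i; case: fintype.split.
rewrite big_split_ord /=; congr (_ + _); apply: eq_bigr => i _.
  by rewrite (unsplitK (inl i)).
by rewrite (unsplitK (inr i)).
Qed.

Lemma lspanZ (A : set G) z a : lspan A a -> lspan A (z *: a).
Proof.
move=> [n [c [v [Av ->]]]]; exists n, (fun i => z * c i), v; split=> //.
by rewrite scaler_sumr; apply: eq_bigr => i _; rewrite scalerA.
Qed.

Lemma lspan1 (A : set G) a : A a -> lspan A a.
Proof.
by move=> Aa; exists 1%N, (fun=> 1), (fun=> a); split=> //; rewrite big_ord1 scale1r.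
Qed.

Lemma in_expv_closureD x y : in_expv_closure x -> in_expv_closure y -> in_expv_closure (x + y).
Proof.
move=> hx hy e e0; have e2 : 0 < e / 2 by rewrite divr_gt0.
have [a Aa ha] := hx _ e2; have [b Ab hb] := hy _ e2.
exists (a + b); first exact: lspanD.
by rewrite opprD addrACA (splitr e); apply: le_lt_trans (nmD _ _) (ltrD _ _).
Qed.

Lemma in_expv_closureZ z x : in_expv_closure x -> in_expv_closure (z *: x).
Proof.
move=> hx e e0; have e1 : 0 < e / (nm z + 1) by rewrite divr_gt0 // ltr_wpDl ?nm_ge0.
have [a Aa] := hx _ e1; rewrite ltr_pdivlMr ?ltr_wpDl ?nm_ge0 // => ha.
exists (z *: a); first exact: lspanZ.
by rewrite -scalerBr nmZ; apply: le_lt_trans ha; rewrite mulrC ler_wpM2l ?nm_ge0 // lerDl.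
Qed.

Lemma in_expv_closure_sum (I : Type) (r : seq I) (F : I -> G) :
  (forall i, in_expv_closure (F i)) -> in_expv_closure (\sum_(i <- r) F i).
Proof.
move=> h; elim: r => [|i r IH].
  rewrite big_nil => e e0; exists 0; last by rewrite subr0 nm0.
  by exists 0%N, (fun=> 0), (fun=> 0); split=> [[]|] //; rewrite big_ord0.
by rewrite big_cons; apply: in_expv_closureD.
Qed.

Lemma in_expv_closure_limit x : (forall e : R, 0 < e -> exists2 y, in_expv_closure y & nm (x - y) < e) ->
  in_expv_closure x.
Proof.
move=> h e e0; have e2 : 0 < e / 2 by rewrite divr_gt0.
have [y hy xy] := h _ e2; have [a Aa ya] := hy _ e2; exists a => //.
by rewrite (splitr e); apply: le_lt_trans (nmB_trans y _ _) (ltrD _ _).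
Qed.


(* The n-th power is n! ^ (1/2) times the n-th Taylor coefficient at 0 of
   [t |-> expv (t f)]. *)
Lemma pow_in_expv_closure n f : sqint f -> in_expv_closure (pow n f).
Proof.
move=> sf; elim/ltn_ind: n => n IH.
apply: in_expv_closure_limit => e e0.
set r := nm (pow 1 f) ^+ 2; set s := Num.sqrt (n`!%:R : R).
have s0 : 0 < s by rewrite sqrtr_gt0 ltr0n fact_gt0.
have C0 : 0 < s * (Num.sqrt (expR r) + 1) by rewrite mulr_gt0 // ltr_wpDl ?sqrtr_ge0.
(* The Taylor remainder is of order t^(n+1) and will be divided by t^n; the second bound on t makes
   the resulting error smaller than e. *)
pose t := Num.min 1 (e / 2 / (s * (Num.sqrt (expR r) + 1))).
have t0 : 0 < t by rewrite lt_min ltr01 divr_gt0 // divr_gt0.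
have t1 : t <= 1 by rewrite ge_min lexx.
have te : t * (s * (Num.sqrt (expR r) + 1)) < e.
  apply: le_lt_trans (_ : e / 2 < e); last by rewrite ltr_pdivrMr // ltr_pMr // ltr1n.
  by rewrite -ler_pdivlMr // ge_min lexx orbT.
have st := sqint_cscale t%:C sf.
(* The Taylor polynomial of degree below n, in the closure by induction, is subtracted from
   [expv (t f)]; the leading term of the rest is t^n / s times [pow n f]. *)
exists ((s * t ^- n)%:C *: (expv (cscale t%:C f) + (-1) *: \sum_(m < n) (nrm m * (t ^+ m)%:C) *: pow m f)).
  apply: in_expv_closureZ; apply: in_expv_closureD.
    move=> d' d0; exists (expv (cscale t%:C f)); last by rewrite subrr nm0.
    by apply: lspan1; exists (cscale t%:C f).
  apply: in_expv_closureZ; apply: in_expv_closure_sum => m.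
  by apply: in_expv_closureZ; exact: IH.
have h := nm_expv_part n.+1 st.
have rt : nm (pow 1 (cscale t%:C f)) ^+ 2 = t ^+ 2 * r.
  by rewrite pow_cscale // nmZ nmR expr1 exprMn ger0_norm // ltW.
rewrite rt in h.
have t2 : 0 <= t ^+ 2 <= 1 by rewrite sqr_ge0 /= expr_le1 // ltW.
have h2 := le_trans h (sexp_tail_le n.+1 (sqr_ge0 _) t2).
have {h h2} h : nm (expv (cscale t%:C f) - expv_part (cscale t%:C f) n.+1) <= t ^+ n.+1 * Num.sqrt (expR r).
  rewrite -(ler_pXn2r (n := 2)) ?nnegrE ?nm_ge0 ?mulr_ge0 ?sqrtr_ge0 ?exprn_ge0 ?(ltW t0) //.
  by rewrite exprMn sqr_sqrtr ?expR_ge0 // exprAC.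
have E : pow n f - (s * t ^- n)%:C *: (expv (cscale t%:C f) + (-1) *: \sum_(m < n) (nrm m * (t ^+ m)%:C) *: pow m f)
  = - (s * t ^- n)%:C *: (expv (cscale t%:C f) - expv_part (cscale t%:C f) n.+1).
  have -> : expv_part (cscale t%:C f) n.+1 =
      \sum_(m < n) (nrm m * (t ^+ m)%:C) *: pow m f + (s^-1 * t ^+ n)%:C *: pow n f.
    rewrite /expv_part big_nat_recr //= pow_cscale // scalerA -rmorphM /= big_mkord.
    by congr (_ + _); apply: eq_bigr => m _; rewrite pow_cscale // scalerA.
  apply: ip_inj => z; rewrite !(ipBr, ipNr, ipDr, ipZr).
  have c1 : (s * t ^- n)%:C * (s^-1 * t ^+ n)%:C = 1 :> R[i].
    rewrite -rmorphM /= mulrACA divff ?gt_eqF // mulVf ?mulr1 //.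
    by rewrite expf_neq0 // gt_eqF.
  move: (ip z _) (ip z _) (ip z _) c1 => a p b; move: (_%:C) (_%:C) => c c' c1.
  have -> : - c' * (p - (a + c * b)) = - c' * p + c' * a + c' * c * b by ring.
  by rewrite c1; ring.
rewrite E nmZ nmN nmR ger0_norm; last by rewrite mulr_ge0 ?invr_ge0 ?exprn_ge0 // ltW.
apply: le_lt_trans te; apply: le_trans (ler_wpM2l _ h) _.
  by rewrite mulr_ge0 ?invr_ge0 ?exprn_ge0 // ltW.
have -> : s / t ^+ n * (t ^+ n.+1 * Num.sqrt (expR r)) = t * (s * Num.sqrt (expR r)).
  by rewrite exprS; field; rewrite expf_neq0 // lt0r_neq0.
by rewrite !ler_pM2l // lerDl.
Qed.

Lemma expv_dense : dense (lspan [set expv f | f in @sqint R d]).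
Proof.
have [_ pd] := G_fock.
have h x : in_expv_closure x.
  apply: in_expv_closure_limit => e e0.
  have [a [n [c [v [Av ->]]]] ha] := dense_nm x pd e0.
  eexists; last exact: ha.
  apply: in_expv_closure_sum => i; apply: in_expv_closureZ.
  have [k [f [sf ->]]] := Av i; exact: pow_in_expv_closure.
move=> O [x Ox] oO; have := open_nbhs_nbhs (conj oO Ox).
move=> /nbhs_ballP[[e e'] /=]; rewrite ltcE /= => /andP[/eqP-> e0] hb.
have [a Aa ha] := h x e e0; exists a; split=> //; apply: hb.
by rewrite -ball_normE /= nmE ltcR.
Qed.

End Fock.

(** * Strong differentiability of displacement curves *)

Section ExpQuotient.
Context {R : realType}.
Implicit Types (a b : R[i]) (u : R).

(* The difference quotient at 0 of [u |-> cexp (u a + u^2 b)], extended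
   continuously by its limit [a]. *)
Definition cexpq a b u : R[i] :=
  if u == 0 then a else u^-1%:C * (cexp (u%:C * a + (u ^+ 2)%:C * b) - 1).

Lemma cexpqE a b u : cexp (u%:C * a + (u ^+ 2)%:C * b) = 1 + u%:C * cexpq a b u.
Proof.
rewrite /cexpq; case: eqVneq => [->|u0].
  by rewrite expr0n /= !mul0r addr0 cexp0 addr0.
have uu : u%:C * u^-1%:C = 1 :> R[i] by rewrite -rmorphM /= divff.
by rewrite [_ * (_ * _)]mulrA uu mul1r; ring.
Qed.

Lemma cexpq_cvg a b : (cexpq a b u : R[i]^o) @[u --> (0 : R)] --> (a : R[i]^o).
Proof.
(* For |u| <= 1 the exponent has modulus at most |u| D, so |u| <= 1 / D permits the Taylor bound; C
   collects its remainder and the quadratic term. The added 1 keeps both constants positive. *)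
set D := nm a + nm b + 1; set C := expR 1 * D ^+ 2 + nm b + 1.
have D0 : 0 < D by rewrite ltr_wpDl // addr_ge0 ?nm_ge0.
have C0 : 0 < C by rewrite ltr_wpDl // addr_ge0 ?nm_ge0 // mulr_ge0 ?expR_ge0 ?sqr_ge0.
have key u : `|u| <= Num.min 1 D^-1 -> nm (a - cexpq a b u) <= C * `|u|.
  rewrite le_min => /andP[u1 uD]; rewrite /cexpq; case: eqVneq => [->|u0].
    by rewrite subrr nm0 mulr_ge0 // ltW.
  set p := u%:C * a + (u ^+ 2)%:C * b.
  have hp : nm p <= `|u| * D.
    apply: le_trans (nmD _ _) _; rewrite !nmM !nmR /D !mulrDr mulr1 -addrA lerD2l.
    rewrite ler_wpDr // ler_wpM2r ?nm_ge0 // normrX expr2 ger_pMl // normr_gt0 //.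
  have p1 : nm p <= 1.
    by apply: le_trans hp _; rewrite -ler_pdivlMr // mul1r.
  have := cexp_taylor p1; set X := cexp p - 1 - p => hX.
  have -> : a - u^-1%:C * (cexp p - 1) = - (u^-1%:C * (X + (u ^+ 2)%:C * b)).
    have uu : u^-1%:C * u%:C = 1 :> R[i] by rewrite -rmorphM /= mulVf.
    have -> : X + (u ^+ 2)%:C * b = cexp p - 1 - u%:C * a by rewrite /X {2}/p; ring.
    rewrite -[a in LHS]mul1r -uu; move: (cexp p) => y; ring.
  rewrite nmN nmM nmR normfV ler_pdivrMl ?normr_gt0 //.
  apply: le_trans (nmD _ _) _; rewrite nmM nmR.
  apply: le_trans (_ : expR 1 * (`|u| * D) ^+ 2 + `|u ^+ 2| * nm b <= _).
    rewrite lerD2r; apply: le_trans hX _; rewrite ler_wpM2l ?expR_ge0 //.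
    by rewrite ler_sqr ?nnegrE ?nm_ge0 // mulr_ge0 // ltW.
  rewrite normrX /C -subr_ge0; apply: le_trans (sqr_ge0 `|u|) _.
  by rewrite le_eqVlt; apply/orP; left; apply/eqP; ring.
apply/cvg_nmP => e e0.
have m0 : 0 < Num.min (Num.min 1 D^-1) (e / (2 * C)).
  by rewrite !lt_min ltr01 invr_gt0 D0 divr_gt0 // mulr_gt0.
near=> u.
have : `|u| <= Num.min (Num.min 1 D^-1) (e / (2 * C)).
  near: u; exact: (@nbhs0_le _ R).
rewrite le_min => /andP[/key h1 h2]; apply: le_lt_trans h1 _.
rewrite mulrC -ltr_pdivlMr //; apply: le_lt_trans h2 _.
by rewrite invfM mulrA ltr_pM2r ?invr_gt0 // ltr_pdivrMr // ltr_pMr // ltr1n.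
Unshelve. all: by end_near.
Qed.

End ExpQuotient.

(** The last step of the Cauchy estimate, for |x - y|^2 = <x,x> + <y,y> - 2 Re <x,y>: three inner
    products within e / 5 of a common value leave an error of at most 4 e / 5. *)
Lemma polarization_gap (R : realType) (x p q r e : R) : 0 < e ->
  - (e / 5) < p -> - (e / 5) < q -> r < e / 5 -> x - p + (x - q) - 2 * (x - r) < e.
Proof. by move=> *; lra. Qed.

Section WeylCurve.
Context {R : realType} {d : nat} {G : hilbert R} (pow : nat -> cfun R d -> G).
Hypothesis G_fock : is_fock pow.
Variable g : cfun R d.
Hypothesis g_sqint : sqint g.
Implicit Types (f h : cfun R d) (s t : R).

Let gam : R := nm (pow 1 g) ^+ 2.
Let ggE : l2ip g g = gam%:C.
Proof. exact: l2ip_ge0. Qed.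

Definition displ f t : cfun R d := cadd f ('i%C * t%:C) g.

Lemma sqint_displ f t : sqint f -> sqint (displ f t).
Proof. by move=> sf; exact: sqint_cadd. Qed.

Lemma displ_displ f s t : displ (displ f s) t = displ f (s + t).
Proof.
apply/funext => k; apply/funext => u; rewrite /displ /cadd rmorphD /=; ring.
Qed.

Lemma displ0 f : displ f 0 = f.
Proof. by apply/funext => k; apply/funext => u; rewrite /displ /cadd mulr0 mul0r addr0. Qed.

(** The exponent is i t <g, f> - t^2 |g|^2 / 2. Its real part compensates the change of norm of the
    displaced exponential vector, so that the curve has constant norm. *)
Definition weyl_phase f t : R[i] :=
  cexp (t%:C * ('i%C * l2ip g f) + (t ^+ 2)%:C * (- (gam / 2))%:C).

(* exp(it(a^*(g) + a(g))) applied to [expv f], by the Baker-Campbell-Hausdorff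
   formula *)
Definition weyl_curve f t : G := weyl_phase f t *: expv pow (displ f t).

Lemma weyl_curve0 f : weyl_curve f 0 = expv pow f.
Proof. by rewrite /weyl_curve displ0 /weyl_phase expr0n /= !mul0r addr0 cexp0 scale1r. Qed.

Lemma l2ip_displr h f t : sqint h -> sqint f ->
  l2ip h (displ f t) = l2ip h f + 'i%C * t%:C * l2ip h g.
Proof. by move=> sh sf; rewrite l2ipDr. Qed.

(** Reduces the behaviour of the curve at time s to that of the curve of the displaced function at
    time 0. *)
Lemma weyl_curveD f s t : sqint f ->
  weyl_curve f (s + t) = weyl_phase f s *: weyl_curve (displ f s) t.
Proof.
move=> sf; rewrite /weyl_curve displ_displ scalerA -cexpD; congr (cexp _ *: _).
rewrite l2ip_displr // ggE; move: (l2ip g f) => [a b]; cring.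
Qed.

Lemma ip_expv_weyl h f t : sqint h -> sqint f ->
  ip (expv pow h) (weyl_curve f t) =
  cexp (l2ip h f) * cexp (t%:C * ('i%C * (l2ip g f + l2ip h g)) + (t ^+ 2)%:C * (- (gam / 2))%:C).
Proof.
move=> sh sf; have ss := sqint_displ t sf; rewrite ipZr ip_expv // -!cexpD l2ip_displr //.
by congr cexp; ring.
Qed.

Let curve_ip f s t : sqint f ->
  ip (weyl_curve f s) (weyl_curve f t) = cexp (l2ip f f) *
   cexp ((t - s)%:C * ('i%C * (2 * complex.Re (l2ip g f))%:C) + ((t - s) ^+ 2)%:C * (- (gam / 2))%:C).
Proof.
move=> sf; have ss := sqint_displ s sf.
rewrite {1}/weyl_curve ipZl ip_expv_weyl // mulrA.
have cexp_conj (z : R[i]) : conjc (cexp z) = cexp (conjc z).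
  by case: z => a b; rewrite /cexp /cis /= cosN sinN; cring.
rewrite /weyl_phase cexp_conj -!cexpD l2ipDl // l2ipDl // ggE (l2ipC g_sqint sf).
by congr cexp; move: (l2ip g f) (l2ip f f) => [a b] [a' b']; cring.
Qed.

(* Up to a factor, the Gram kernel of the difference quotients of a Weyl
   curve at 0; its continuity at (0, 0) makes them a Cauchy family. *)
Let gap (a : R[i]) (p : R * R) : R[i] :=
  (1 + p.2%:C * cexpq a (- (gam / 2))%:C p.2) * (1 - p.1%:C * cexpq a (- (gam / 2))%:C (- p.1))
    * cexpq gam%:C 0 (p.1 * p.2)
  - cexpq a (- (gam / 2))%:C p.2 * cexpq a (- (gam / 2))%:C (- p.1).

Let gap_cvg_gen a (T : Type) (F : set_system T) (FF : Filter F) (u v : T -> R) :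
  u x @[x --> F] --> (0 : R) -> v x @[x --> F] --> (0 : R) ->
  (gap a (u x, v x) : R[i]^o) @[x --> F] --> (gam%:C - a * a : R[i]^o).
Proof.
move=> c1 c2.
have c3 : - u x @[x --> F] --> (0 : R) by rewrite -oppr0; exact: cvgN.
have c4 : u x * v x @[x --> F] --> (0 : R) by rewrite -[X in _ --> X](mulr0 0); exact: cvgM.
have C (w : T -> R) : w p @[p --> F] --> (0 : R) ->
    ((w p)%:C : R[i]^o) @[p --> F] --> (0 : R[i]^o).
  move=> /cvgrPdist_lt h; apply/cvg_nmP => e /h; apply: filterS => p.
  by rewrite !sub0r nmN nmR normrN.
have q (b c : R[i]) (w : T -> R) : w p @[p --> F] --> (0 : R) ->
    (cexpq b c (w p) : R[i]^o) @[p --> F] --> (b : R[i]^o).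
  by move=> h; apply: (cvg_comp _ _ h); exact: cexpq_cvg.
set b := (- (gam / 2))%:C.
have p1 : ((v p)%:C * cexpq a b (v p) : R[i]^o) @[p --> F] --> (0 * a : R[i]^o).
  exact: cvgM (C _ c2) (q _ _ _ c2).
have p2 : ((u p)%:C * cexpq a b (- u p) : R[i]^o) @[p --> F] --> (0 * a : R[i]^o).
  exact: cvgM (C _ c1) (q _ _ _ c3).
have one : ((1 : R[i]) : R[i]^o) @[p --> F] --> (1 : R[i]^o) by exact: cvg_cst.
have p3 : (1 + (v p)%:C * cexpq a b (v p) : R[i]^o) @[p --> F] --> (1 + 0 * a : R[i]^o).
  exact: (@cvgD _ (R[i]^o)) one p1.
have p4 : (1 - (u p)%:C * cexpq a b (- u p) : R[i]^o) @[p --> F] --> (1 - 0 * a : R[i]^o).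
  exact: (@cvgB _ (R[i]^o)) one p2.
have -> : gam%:C - a * a = (1 + 0 * a) * (1 - 0 * a) * gam%:C - a * a by ring.
have p5 : ((1 + (v p)%:C * cexpq a b (v p)) * (1 - (u p)%:C * cexpq a b (- u p)) : R[i]^o)
  @[p --> F] --> ((1 + 0 * a) * (1 - 0 * a) : R[i]^o) by exact: cvgM p3 p4.
have p6 := cvgM p5 (q gam%:C 0 _ c4) _.
have p7 := cvgM (q a b _ c2) (q a b _ c3) _.
exact: (@cvgB _ (R[i]^o)) (p6 _) (p7 _).
Qed.

Let gap_cvg a : (gap a p : R[i]^o) @[p --> ((0 : R), (0 : R))] --> (gam%:C - a * a : R[i]^o).
Proof.
exact: (@gap_cvg_gen a _ _ _ fst snd cvg_fst cvg_snd).
Qed.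

Let diff_quot f t : G := t^-1%:C *: (weyl_curve f t - weyl_curve f 0).

Let diff_quot_ip f s t : sqint f -> s != 0 -> t != 0 ->
  ip (diff_quot f s) (diff_quot f t) = cexp (l2ip f f) * gap ('i%C * (2 * complex.Re (l2ip g f))%:C) (s, t).
Proof.
move=> sf s0 t0; rewrite /diff_quot ipZl ipZr !(ipBl, ipBr) !curve_ip //.
rewrite (_ : conjc s^-1%:C = s^-1%:C); last by cring.
set a := 'i%C * _; set b := (- (gam / 2))%:C.
rewrite subrr !subr0 !sub0r.
(* In (t - s)^2 b with b = - gam / 2 the mixed term is s t gam; it becomes a separate exponential,
   so that every factor is of the form that [cexpq] handles. *)
have -> : cexp ((t - s)%:C * a + ((t - s) ^+ 2)%:C * b) =
    cexp (t%:C * a + (t ^+ 2)%:C * b) * cexp ((- s)%:C * a + ((- s) ^+ 2)%:C * b)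
    * cexp ((s * t)%:C * gam%:C + ((s * t) ^+ 2)%:C * 0).
  rewrite -!cexpD; congr cexp; rewrite /b mulr0 addr0; case: a => a1 a2; cring.
rewrite !cexpqE /gap /= -/b.
have -> : (0 : R)%:C * cexpq a b 0 = 0 by rewrite mul0r.
have s1 : s^-1%:C * s%:C = 1 :> R[i] by rewrite -rmorphM /= mulVf.
have t1 : t^-1%:C * t%:C = 1 :> R[i] by rewrite -rmorphM /= mulVf.
rewrite rmorphM rmorphN /=.
move: (cexpq a b t) (cexpq a b (- s)) (cexpq _ 0 _) (cexp _) => x y z E.
transitivity (E * ((1 + t%:C * x) * (1 - s%:C * y) * ((s^-1%:C * s%:C) * (t^-1%:C * t%:C) * z)
    - (s^-1%:C * s%:C) * (t^-1%:C * t%:C) * (x * y))).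
  ring.
by rewrite s1 t1 !mul1r.
Qed.

(** The derivative is obtained by completeness and not by a formula: the Gram entries of two
    difference quotients at (s, s), (t, t) and (s, t) have the same limit, so the quotients are
    Cauchy. *)
Lemma weyl_curve_derivable f : sqint f ->
  exists v : G, t^-1%:C *: (weyl_curve f t - weyl_curve f 0) @[t --> 0^'] --> v.
Proof.
move=> sf; apply: nm_cauchy_cvg => e e0.
set a := 'i%C * (2 * complex.Re (l2ip g f))%:C.
set E := cexp (l2ip f f).
have E0 : 0 < nm E by rewrite nm_cexp expR_gt0.
have e4 : 0 < e ^+ 2 / (5 * nm E) by rewrite divr_gt0 ?exprn_gt0 // mulr_gt0.
have /cvg_nmP/(_ _ e4)[[A B] [/= A0 B0] hAB] := @gap_cvg a.
exists (fun t => [/\ A t, B t & t != 0]).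
  near=> t; split; near: t; [exact: nbhs_dnbhs|exact: nbhs_dnbhs|exact: nbhs_dnbhs_neq].
move=> s t [As Bs s0] [At Bt t0].
have hD u v : A u -> B v -> u != 0 -> v != 0 ->
    nm (E * (gam%:C - a * a) - ip (diff_quot f u) (diff_quot f v)) < e ^+ 2 / 5.
  move=> Au Bv u0 v0; rewrite diff_quot_ip // -mulrBr nmM -ltr_pdivlMl //.
  have /= := hAB (u, v) (conj Au Bv); rewrite -/a; move/lt_le_trans; apply.
  by rewrite invfM mulrA mulrC.
have h1 := hD s s As Bs s0 s0; have h2 := hD t t At Bt t0 t0; have h3 := hD s t As Bt s0 t0.
rewrite -/(diff_quot f s) -/(diff_quot f t).
move: h1 h2 h3; set L := E * _ => h1 h2 h3.
rewrite -(ltr_pXn2r (n := 2)) ?nnegrE ?nm_ge0 ?(ltW e0) // nm_sqB.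
have hR u v : complex.Re (ip u v) = complex.Re L - complex.Re (L - ip u v) :> R.
  by rewrite raddfB opprB addrC subrK.
have hq u : nm u ^+ 2 = complex.Re (ip u u) :> R by rewrite (ipxx u).
rewrite !hq !hR.
have lt_Re u v : nm (L - ip u v) < e ^+ 2 / 5 -> `|complex.Re (L - ip u v)| < e ^+ 2 / 5.
  exact: le_lt_trans (Re_abs_nm _).
move: h1 h2 h3 => /lt_Re h1 /lt_Re h2 /lt_Re h3.
move: h1 h2 h3; rewrite !ltr_norml => /andP[h1 _] /andP[h2 _] /andP[_ h3].
have e2 : 0 < e ^+ 2 by rewrite exprn_gt0.
exact: polarization_gap e2 h1 h2 h3.
Unshelve. all: by end_near.
Qed.

(** Recognizes the derivative as i (a^*(g) + a(g)) applied to [expv pow f], by matrix elements, the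
    form in which [quadrature_graph] prescribes the creation part. *)
Lemma ip_expv_weyl_deriv f v : sqint f ->
  t^-1%:C *: (weyl_curve f t - weyl_curve f 0) @[t --> 0^'] --> v ->
  forall h, sqint h -> ip (expv pow h) v = cexp (l2ip h f) * ('i%C * (l2ip g f + l2ip h g)).
Proof.
move=> sf hv h sh.
apply: (@cplx_cvg_uniq R _ (0 : R)^' _ (fun t => ip (expv pow h) (t^-1%:C *: (weyl_curve f t - weyl_curve f 0)))).
  exact: ip_cvg hv.
set a := 'i%C * _.
apply: (@cvg_trans _ ((fun t => cexp (l2ip h f) * cexpq a (- (gam / 2))%:C t : R[i]^o) @ 0^')).
  apply: near_eq_cvg; near=> t.
  have t0 : t != 0 by near: t; exact: nbhs_dnbhs_neq.
  rewrite ipZr ipBr !ip_expv_weyl // -/a !cexpqE mul0r addr0.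
  have t1 : t^-1%:C * t%:C = 1 :> R[i] by rewrite -rmorphM /= mulVf.
  move: (cexpq a _ t) (cexp _) => x E.
  transitivity (E * ((t^-1%:C * t%:C) * x)); last by ring.
  by rewrite t1 mul1r.
have hc := @cexpq_cvg R a (- (gam / 2))%:C.
apply/cvg_nmP => e e0.
have E0 : 0 < nm (cexp (l2ip h f)) by rewrite nm_cexp expR_gt0.
have e4 : 0 < e / nm (cexp (l2ip h f)) by rewrite divr_gt0.
move/cvg_nmP: hc => /(_ _ e4) hc; apply: nbhs_dnbhs; apply: filterS hc => t.
by rewrite ltr_pdivlMr // => h1; rewrite -mulrBr nmM mulrC.
Unshelve. all: by end_near.
Qed.

End WeylCurve.

(** * Unitary groups determined by their generator *)

Section WeylGroup.
Context {R : realType} {V : hilbert R} (W : R -> V -> V).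
Hypothesis W_group : unitary_group W.

Lemma ugroup_linear t : linear (W t).
Proof. by case: W_group => /(_ t)[]. Qed.

Lemma ugroup_ip t x y : ip (W t x) (W t y) = ip x y.
Proof. by case: W_group => /(_ t)[]. Qed.

Lemma ugroup_nm t x : nm (W t x) = nm x.
Proof. exact/isometry_nm/ugroup_ip. Qed.

Lemma ugroupD s t x : W (s + t) x = W s (W t x).
Proof. by case: W_group => _ h _; exact: h. Qed.

Lemma ugroup0 x : W 0 x = x.
Proof.
apply/eqP; rewrite -subr_eq0; apply/eqP/nm_eq0.
by rewrite -(ugroup_nm 0) (linB (ugroup_linear 0)) -ugroupD addr0 subrr nm0.
Qed.

(* A curve with [c (t + h) = W h (c t) + o(h)] is an orbit of the group:
   [W (- t) (c t)] has derivative zero. *)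
Lemma orbit_unique (c : R -> V) :
  (forall t, nm (h^-1%:C *: (c (t + h) - W h (c t))) @[h --> 0^'] --> (0 : R)) ->
  forall t, W t (c 0) = c t.
Proof.
move=> hc; pose y t := W (- t) (c t).
have yd z (t : R) : is_derive t (1 : R) (fun s => complex.Re (ip z (y s))) (0 : R).
  have lim0 : h^-1 *: (((fun s => complex.Re (ip z (y s))) \o shift t) (h *: (1 : R)) - complex.Re (ip z (y t)))
      @[h --> 0^'] --> (0 : R).
    apply/cvgrPdist_lt => e e0.
    have e1 : 0 < e / (nm z + 1) by rewrite divr_gt0 // ltr_wpDl ?nm_ge0.
    move/cvgrPdist_lt: (hc t) => /(_ _ e1); apply: filterS => h.
    rewrite sub0r normrN ger0_norm ?nm_ge0 // ltr_pdivlMr ?ltr_wpDl ?nm_ge0 //.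
    apply: le_lt_trans; rewrite sub0r normrN /= /GRing.scale /= mulr1 [h + t]addrC.
    have -> : h^-1 * (complex.Re (ip z (y (t + h))) - complex.Re (ip z (y t))) =
        complex.Re (ip z (h^-1%:C *: (y (t + h) - y t))).
      rewrite ipZr ipBr; case: (ip z (y (t + h))) => a b; case: (ip z (y t)) => a' b' /=; ring.
    apply: le_trans (Re_abs_nm _) _; apply: le_trans (CS _ _) _.
    rewrite mulrC; apply: ler_pM; rewrite ?nm_ge0 // ?lerDl // !nmZ.
    rewrite ler_wpM2l ?nm_ge0 // -(ugroup_nm (t + h)) (linB (ugroup_linear _)).
    by rewrite /y -!ugroupD subrr ugroup0 addrAC subrr add0r.
  split; first by apply/cvg_ex; exists 0.
  by rewrite /derive; apply/cvg_lim.
have yE t : y t = y 0.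
  apply/eqP; rewrite -subr_eq0; apply/eqP/nm_eq0/eqP; rewrite -sqrf_eq0; apply/eqP.
  set z := y t - y 0.
  have -> : nm z ^+ 2 = complex.Re (ip z (y t)) - complex.Re (ip z (y 0)).
    by rewrite -raddfB -ipBr -/z ipxx.
  by rewrite (is_derive_0_is_cst t 0 (yd z)) subrr.
move=> t; have := yE t; rewrite /y oppr0 ugroup0 => <-.
by rewrite -ugroupD subrr ugroup0.
Qed.

End WeylGroup.

Section WeylAction.
Context {R : realType} {d : nat} {G : hilbert R} (pow : nat -> cfun R d -> G).
Hypothesis G_fock : is_fock pow.
Variable g : cfun R d.
Hypothesis g_sqint : sqint g.
Variable W : R -> G -> G.
Hypothesis W_group : unitary_group W.
Hypothesis W_deriv : forall f (v : G), sqint f ->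
  t^-1%:C *: (weyl_curve pow g f t - weyl_curve pow g f 0) @[t --> 0^'] --> v ->
  t^-1%:C *: (W t (expv pow f) - expv pow f) @[t --> 0^'] --> v.

(** At any time s, the curve and the group orbit through its current point have the same derivative:
    by [weyl_curveD] both are the phase at s times the derivative at 0 for the displaced
    function. *)
Lemma weyl_action f t : sqint f -> W t (expv pow f) = weyl_curve pow g f t.
Proof.
move=> sf; rewrite -(weyl_curve0 pow g f); apply: orbit_unique => // s.
have ss := sqint_displ g_sqint s sf.
have [v hv] := weyl_curve_derivable G_fock g_sqint ss.
have hW := W_deriv ss hv.
set F := weyl_phase pow g f s.
have F0 : 0 <= nm F by exact: nm_ge0.
apply/cvgrPdist_lt => e e0.
have e1 : 0 < e / (2 * (nm F + 1)) by rewrite divr_gt0 // mulr_gt0 // ltr_wpDl.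
move/cvg_nmP: hv => /(_ _ e1) h1; move/cvg_nmP: hW => /(_ _ e1) h2.
apply: filterS2 h1 h2 => h h1 h2; rewrite sub0r normrN ger0_norm ?nm_ge0 //.
rewrite weyl_curveD // -/F.
rewrite (_ : weyl_curve pow g f s = F *: expv pow (displ g f s)) // (linZ (ugroup_linear W_group h)).
rewrite -scalerBr scalerA mulrC -scalerA nmZ.
rewrite weyl_curve0 in h1.
set x := weyl_curve _ _ _ _ in h1 *; set y := W h _ in h2 *; set z := expv _ _ in h1 h2.
have h3 : nm (h^-1%:C *: (x - y)) < e / (nm F + 1).
  have -> : h^-1%:C *: (x - y) = (v - h^-1%:C *: (y - z)) - (v - h^-1%:C *: (x - z)).
    by apply: ip_inj => w; rewrite !(ipBr, ipZr); ring.
  apply: le_lt_trans (nmD _ _) _; rewrite nmN.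
  rewrite (_ : e / (nm F + 1) = e / (2 * (nm F + 1)) + e / (2 * (nm F + 1))).
    exact: ltrD.
  by field; rewrite gt_eqF // ltr_wpDl.
apply: le_lt_trans (_ : (nm F + 1) * nm (h^-1%:C *: (x - y)) < _).
  by rewrite ler_wpM2r ?nm_ge0 // lerDl.
by rewrite mulrC -ltr_pdivlMr // ltr_wpDl.
Qed.

End WeylAction.

(** * Quadratures as field operators *)

Section Quadrature.
Context {R : realType} {d : nat}.
Notation mu := (@lebesgue_measure R).
Notation Rplus := (`[0%R, +oo[%classic : set R).
Implicit Types (f g : cfun R d.+1) (k : R -> R) (T th nu : R).

(** The function g for which \int_0^T k dQ is a^*(g) + a(g): it is the coefficient of the creation
    part, and its conjugate is that of the annihilation part. *)
Definition qfun T k th nu : cfun R d.+1 := fun j s =>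
  if (j == ord0) && (0 <= s <= T) then (k s)%:C * cis (- (nu * s + th)) else 0.

Lemma cisN (x : R) : conjc (cis (- x)) = cis x.
Proof. by rewrite /cis cosN sinN; cring. Qed.

Lemma leb_restrict T (F : R -> R[i]) :
  leb Rplus (fun s => if 0 <= s <= T then F s else 0) = leb `[0, T] F.
Proof.
have E : (`[0, T]%classic : set R) = Rplus `&` `[0, T]%classic.
  by apply/seteqP; split=> x /=; rewrite !in_itv /=; [move=> /andP[-> ->] | case].
rewrite /leb /cintegral E !Rintegral_mkcondr; congr (_ +i* _);
  by apply: eq_Rintegral => x _; rewrite patchE mem_setE in_itv /=; case: ifP.
Qed.

Lemma l2ip_qfunl T k th nu f :
  l2ip (qfun T k th nu) f = leb `[0, T] (fun s => (k s)%:C * cis (nu * s + th) * f ord0 s).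
Proof.
rewrite /l2ip big_ord_recl big1 ?addr0 => [|i _]; last first.
  rewrite -[RHS](leb0 Rplus); apply: eq_leb => s _.
  by rewrite /qfun /= rmorph0 mul0r.
rewrite -leb_restrict; apply: eq_leb => s _; rewrite /qfun /=.
case: ifP => _; last by rewrite rmorph0 mul0r.
by rewrite rmorphM /=; congr (_ * _ * _); [cring | exact: cisN].
Qed.

Lemma l2ip_qfunr T k th nu g :
  l2ip g (qfun T k th nu) = leb `[0, T] (fun s => conjc (g ord0 s) * ((k s)%:C * cis (- (nu * s + th)))).
Proof.
rewrite /l2ip big_ord_recl big1 ?addr0 => [|i _]; last first.
  by rewrite -[RHS](leb0 Rplus); apply: eq_leb => s _; rewrite /qfun /= mulr0.
rewrite -leb_restrict; apply: eq_leb => s _; rewrite /qfun /=.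
by case: ifP => _; rewrite ?mulr0.
Qed.

Lemma continuous_bounded_integrable T (w : R -> R) (K : R) : continuous w ->
  (forall s, `|w s| <= K) -> mu.-integrable `[0, T] (EFin \o w).
Proof.
move=> wc wK.
have fin : (lebesgue_measure (`[0%R, T]%classic : set R) < +oo)%E.
  by rewrite lebesgue_measure_itv /=; case: ifP => _; rewrite ?ltry.
apply: measurable_bounded_integrable => //.
- by apply: measurable_funTS; exact: measurable_realfun.continuous_measurable_fun.
- exists K; split; first by rewrite num_real.
  by move=> M KM s _; apply: le_trans (wK s) (ltW KM).
Qed.

Lemma continuous_phase_cos th nu : continuous (fun s : R => cos (- (nu * s + th))).
Proof.
move=> s; apply: continuous_comp; last exact: continuous_cos.
by apply: cvgN; apply: cvgD; [apply: cvgM; [exact: cvg_cst|exact: cvg_id]|exact: cvg_cst].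
Qed.

Lemma continuous_phase_sin th nu : continuous (fun s : R => sin (- (nu * s + th))).
Proof.
move=> s; apply: continuous_comp; last exact: continuous_sin.
by apply: cvgN; apply: cvgD; [apply: cvgM; [exact: cvg_cst|exact: cvg_id]|exact: cvg_cst].
Qed.

Lemma sqint_qfun T k th nu (K : R) : continuous k -> (forall s, `|k s| <= K) ->
  sqint (qfun T k th nu).
Proof.
move=> kc kK; apply/sqintP => j.
have mR : measurable (Rplus : set (measurableTypeR R)) by exact: measurable_itv.
have mT : measurable (`[0, T] : set (measurableTypeR R)) by exact: measurable_itv.
have meas (w : R -> R) : continuous w ->
    measurable_fun Rplus (fun s => if (j == ord0) && (0 <= s <= T) then w s else 0).
  move=> wc; case: (j == ord0) => /=; last exact: measurable_cst.
  rewrite (_ : (fun _ => _) = w \_ `[0, T]); last first.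
    by apply/funext => s; rewrite patchE mem_setE in_itv.
  apply/measurable_restrict => //; apply: measurable_funTS.
  exact: measurable_realfun.continuous_measurable_fun.
have m1 := meas (fun s => k s * cos (- (nu * s + th))).
have m2 := meas (fun s => k s * sin (- (nu * s + th))).
have c1 : continuous (fun s => k s * cos (- (nu * s + th))).
  by move=> s; apply: cvgM; [exact: kc | exact: continuous_phase_cos].
have c2 : continuous (fun s => k s * sin (- (nu * s + th))).
  by move=> s; apply: cvgM; [exact: kc | exact: continuous_phase_sin].
split.
- rewrite (_ : (fun _ => _) = fun s => if (j == ord0) && (0 <= s <= T) then k s * cos (- (nu * s + th)) else 0).
    exact: m1.
  by apply/funext => s; rewrite /qfun /cis; case: ifP => //= _; ring.
- rewrite (_ : (fun _ => _) = fun s => if (j == ord0) && (0 <= s <= T) then k s * sin (- (nu * s + th)) else 0).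
    exact: m2.
  by apply/funext => s; rewrite /qfun /cis; case: ifP => //= _; ring.
- rewrite (_ : _ \o _ = fun s => if (j == ord0) && (0 <= s <= T) then (k s ^+ 2)%:E else 0%E); last first.
    apply/funext => s; rewrite /qfun /=; case: ifP => _ /=; congr EFin.
      rewrite /cis /= !mul0r subr0 addr0 !exprMn -mulrDr cos2Dsin2 mulr1 //.
    by rewrite expr0n /= addr0.
  case: (j == ord0) => /=; last exact: integrable0.
  rewrite (_ : (fun _ => _) = (EFin \o (fun s => k s ^+ 2)) \_ `[0, T]); last first.
    by apply/funext => s; rewrite patchE mem_setE in_itv.
  apply/integrable_restrict => //.
  apply: (integrableS mT) => //; first exact: measurableI.
  apply: (@continuous_bounded_integrable _ _ (K ^+ 2)).
    by move=> s; apply: cvgM; exact: kc.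
  by move=> s; rewrite normrX ler_sqr ?nnegrE // (le_trans _ (kK s)).
Qed.

(** With a common frequency the rotating phases cancel, and the constant phase difference comes out
    of the integral. *)
Lemma l2ip_qfun T k1 k2 th1 th2 nu (K1 K2 : R) :
  continuous k1 -> (forall s, `|k1 s| <= K1) -> continuous k2 -> (forall s, `|k2 s| <= K2) ->
  l2ip (qfun T k1 th1 nu) (qfun T k2 th2 nu) =
  cis (th1 - th2) * (Rintegral mu `[0, T] (fun s => k1 s * k2 s))%:C.
Proof.
move=> c1 b1 c2 b2; rewrite l2ip_qfunl.
have mT : measurable (`[0, T] : set (measurableTypeR R)) by exact: measurable_itv.
have hi : mu.-integrable `[0, T] (EFin \o (fun s => k1 s * k2 s)).
  apply: (@continuous_bounded_integrable _ _ (K1 * K2)).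
    by move=> s; apply: cvgM; [exact: c1 | exact: c2].
  by move=> s; rewrite normrM ler_pM.
have -> : (Rintegral mu `[0, T] (fun s => k1 s * k2 s))%:C = leb `[0, T] (fun s => (k1 s * k2 s)%:C).
  by rewrite /leb /cintegral /= [X in _ +i* X]/Rintegral integral0.
rewrite -lebZ //; last by split=> //=; exact: integrable0.
apply: eq_leb => s; rewrite /= in_itv /= => sT; rewrite /qfun eqxx sT /= rmorphM /=.
rewrite (_ : th1 - th2 = (nu * s + th1) + - (nu * s + th2)); last by ring.
rewrite [X in _ = X * _]cisD; ring.
Qed.

End Quadrature.

Section QuadratureExponential.
Context {R : realType} {d : nat} {G : hilbert R} (pow : nat -> cfun R d.+1 -> G).
Hypothesis G_fock : is_fock pow.
Variables (T : R) (k : R -> R) (th nu : R).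
Let g := qfun (d := d) T k th nu.
Hypothesis g_sqint : sqint g.
Variable A : G -> G.
Hypothesis A_exp : is_exp_i (quadrature_graph pow T k th nu) A.

Let coh_norm (f : cfun R d.+1) : R := expR (- complex.Re (l2ip f f) / 2).

Let cohN f : coh pow f = (coh_norm f)%:C *: expv pow f.
Proof. exact: cohE. Qed.

(** The closed graph is the full generator of [W]. As it contains the coherent vectors with the
    values prescribed by the quadrature, the derivative of [W] there is that of the Weyl curve, and
    [weyl_action] applies. *)
Lemma quadrature_exp_group : exists2 W, unitary_group W & (forall f t, sqint f ->
  W t (expv pow f) = weyl_curve pow g f t) /\ A = W 1.
Proof.
have [W [Wg Wgen ->]] := A_exp; exists W => //; split=> // f0 t0 sf0.
apply: weyl_action => // f v sf hv.
have N0 : coh_norm f != 0 by rewrite gt_eqF ?expR_gt0.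
set N : R[i] := (coh_norm f)%:C.
have Nn0 : N != 0 by rewrite -(rmorph0 (real_complex R)) eqcR.
(* The generator must send [expv pow f] to -i v; taking away the annihilation part <g, f>
   [expv pow f] leaves the creation part. N restores the normalization of [coh]. *)
pose w : G := N *: (- 'i%C *: v - l2ip g f *: expv pow f).
have : quadrature_graph pow T k th nu
    (coh pow f, w + leb `[0, T] (fun s => (k s)%:C * cis (nu * s + th) * f ord0 s) *: coh pow f).
  apply: subset_closure.
  exists 1%N, (fun=> 1), (fun=> (coh pow f, w + leb `[0, T] (fun s => (k s)%:C * cis (nu * s + th) * f ord0 s) *: coh pow f)).
  split; last by rewrite big_ord1 scale1r.
  move=> _; exists f, w; split=> // h sh.
  rewrite -l2ip_qfunr -/g.
  rewrite (cohN f) (cohN h) /w.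
  rewrite !ipZl !ipZr ipBr !ipZr.
  rewrite ip_expv // (ip_expv_weyl_deriv G_fock g_sqint sf hv sh).
  have ii : 'i%C * 'i%C = -1 :> R[i] by cring.
  move: (cexp _) (l2ip g f) (l2ip h g) (conjc _) => E b c M.
  transitivity (M * (N * (E * (- ('i%C * 'i%C) * (b + c) - b)))); first by ring.
  by rewrite ii; ring.
rewrite -Wgen -l2ip_qfunl -/g /generator_graph /=.
have -> : 'i *: (w + l2ip g f *: coh pow f) = N *: v.
  rewrite iE (cohN f) /w; apply: ip_inj => z; rewrite !(ipZr, ipDr, ipNr).
  have ii : 'i%C * 'i%C = -1 :> R[i] by cring.
  move: (ip z v) (ip z (expv pow f)) => a b.
  transitivity (N * (- ('i%C * 'i%C) * a)); first by ring.
  by rewrite ii; ring.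
move=> /cvg_nmP h; apply/cvg_nmP => e e0.
have Np : 0 < nm N by rewrite nmR normr_gt0.
have e1 : 0 < nm N * e by rewrite mulr_gt0.
apply: filterS (h _ e1) => t; rewrite (cohN f) (linZ (ugroup_linear Wg t)).
by rewrite -scalerBr scalerA mulrC -scalerA -scalerBr nmZ ltr_pM2l.
Qed.

Lemma quadrature_exp_linear : linear A.
Proof. by have [W Wg [_ ->]] := quadrature_exp_group; exact: ugroup_linear. Qed.

Lemma quadrature_exp_ip x y : ip (A x) (A y) = ip x y.
Proof. by have [W Wg [_ ->]] := quadrature_exp_group; exact: ugroup_ip. Qed.

Lemma quadrature_exp_expv f : sqint f -> A (expv pow f) = weyl_curve pow g f 1.
Proof. by have [W Wg [h ->]] := quadrature_exp_group; exact: h. Qed.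

End QuadratureExponential.

(** * The Weyl relation *)

Section WeylRelation.
Context {R : realType} {d : nat} {G : hilbert R} (pow : nat -> cfun R d -> G).
Hypothesis G_fock : is_fock pow.
Implicit Types f g h : cfun R d.

Lemma weyl_curve1 g f : sqint g -> weyl_curve pow g f 1 =
  cexp ('i%C * l2ip g f - l2ip g g / 2) *: expv pow (displ g f 1).
Proof.
move=> sg; rewrite /weyl_curve /weyl_phase (l2ip_ge0 G_fock sg); congr (cexp _ *: _).
move: (l2ip g f) => [a b]; cring.
Qed.

Lemma isometry_bounded (V : hilbert R) (A : V -> V) : linear A ->
  (forall x, nm (A x) = nm x) -> bounded_op A.
Proof.
move=> Al An; split=> // x; apply/cvg_nmP => e e0.
apply/nbhs_ballP; exists e%:C; first by rewrite /= ltcR.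
by move=> y; rewrite -ball_normE /= nmE ltcR -(linB Al) An.
Qed.

(** On exponential vectors both orders produce the same displacement. The phases differ in one cross
    term, i <g, i h> = - <g, h> against i <h, i g> = - <h, g>, whose quotient is the scalar. Both
    sides are bounded, so density finishes. *)
Lemma weyl_relation g h (A B : G -> G) : sqint g -> sqint h ->
  linear A -> linear B -> (forall x, nm (A x) = nm x) -> (forall x, nm (B x) = nm x) ->
  (forall f, sqint f -> A (expv pow f) = weyl_curve pow g f 1) ->
  (forall f, sqint f -> B (expv pow f) = weyl_curve pow h f 1) ->
  forall x, A (B x) = cexp (l2ip h g - l2ip g h) *: B (A x).
Proof.
move=> sg sh Al Bl An Bn AE BE.
set eta := cexp _.
have etaE : nm eta = 1.
  rewrite /eta nm_cexp (l2ipC sg sh); case: (l2ip g h) => a b /=.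
  by rewrite subrr expR0.
apply: (total_op_eq (B := [set expv pow f | f in @sqint R d])).
- apply: isometry_bounded => [a x y|x]; last by rewrite An Bn.
  by rewrite (linD Bl) (linZ Bl) (linD Al) (linZ Al).
- apply: isometry_bounded => [a x y|x]; last by rewrite nmZ etaE mul1r Bn An.
  by rewrite (linD Al) (linZ Al) (linD Bl) (linZ Bl) scalerDr !scalerA mulrC.
- exact: expv_dense.
move=> _ [f sf <-].
have sgf := sqint_displ sg 1 sf; have shf := sqint_displ sh 1 sf.
rewrite AE // BE // !weyl_curve1 // (linZ Al) (linZ Bl) AE // BE // !weyl_curve1 //.
rewrite !scalerA -!cexpD.
have -> : displ g (displ h f 1) 1 = displ h (displ g f 1) 1.
  by apply/funext => j; apply/funext => s; rewrite /displ /cadd; ring.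
congr (cexp _ *: _); rewrite /displ !l2ipDr //.
have ii : 'i%C * 'i%C = -1 :> R[i] by cring.
move: (l2ip g f) (l2ip h f) (l2ip g h) (l2ip h g) (l2ip g g / 2) (l2ip h h / 2) => a b c c' p q.
transitivity ('i%C * a + 'i%C * b + ('i%C * 'i%C) * c - p - q); first by ring.
transitivity (c' - c + 'i%C * a + 'i%C * b + ('i%C * 'i%C) * c' - p - q); last by ring.
by rewrite ii; ring.
Qed.

End WeylRelation.

(** * Unitary conjugation and operators on tensor products *)

Section AdjointUnitary.
Context {R : realType} {V : hilbert R} (A : V -> V).
Hypothesis A_unitary : unitary_op A.

Lemma adj_unitaryK y : A (adj A y) = y.
Proof.
have [Al Aip As] := A_unitary; have [x Ax] := As y.
suff -> : adj A y = x by [].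
(* [adj] is a choice; for a surjective isometry the preimage of [y] is the only candidate. *)
apply: xget_unique => [u /=|z /= hz]; first by rewrite -Ax Aip.
by apply: ip_inj => u; rewrite -hz -Ax Aip.
Qed.

Lemma adj_unitary_ip x y : ip (A x) y = ip x (adj A y).
Proof. by have [_ Aip _] := A_unitary; rewrite -{1}(adj_unitaryK y) Aip. Qed.

Lemma unitary_conj_psd t : psd t -> psd (fun x => A (t (adj A x))).
Proof.
move=> [tl tp]; have [Al Aip As] := A_unitary.
have adjl : linear (adj A).
  move=> a x y; apply: ip_inj => z.
  by rewrite ipDr ipZr -!adj_unitary_ip ipDr ipZr.
split=> [a x y|x].
  by rewrite (linD adjl) (linZ adjl) (linD tl) (linZ tl) (linD Al) (linZ Al).
by rewrite -{1}(adj_unitaryK x) Aip.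
Qed.

End AdjointUnitary.

Section TensorOperators.
Context {R : realType} {H G HG : hilbert R} (tens : H -> G -> HG).
Hypothesis HG_tensor : is_tensor tens.

Let pure : set HG := [set z | exists x y, z = tens x y].

Let pure_dense : dense (lspan pure).
Proof. by case: HG_tensor. Qed.

Let tens_ip x y x' y' : ip (tens x y) (tens x' y') = ip x x' * ip y y'.
Proof. by case: HG_tensor => h _; exact: h. Qed.

Lemma tensZr x c y : tens x (c *: y) = c *: tens x y.
Proof.
apply: (total_inj pure_dense) => z [x' [y' ->]].
by rewrite ipZr !tens_ip ipZr mulrCA.
Qed.

Lemma optens_isometry W V : is_optens tens id W V -> (forall x y, ip (W x) (W y) = ip x y) ->
  forall x, nm (V x) = nm x.
Proof.
move=> [Vb VE] Wip; apply: (total_isometry Vb pure_dense).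
by move=> _ _ [x [y ->]] [x' [y' ->]]; rewrite !VE !tens_ip Wip.
Qed.

Lemma optens_weyl W1 W2 V1 V2 (eta : R[i]) :
  is_optens tens id W1 V1 -> is_optens tens id W2 V2 ->
  (forall x, nm (V1 x) = nm x) -> (forall x, nm (V2 x) = nm x) ->
  (forall y, W1 (W2 y) = eta *: W2 (W1 y)) -> nm eta = 1 ->
  forall x, V1 (V2 x) = eta *: V2 (V1 x).
Proof.
move=> [[V1l _] V1E] [[V2l _] V2E] n1 n2 W12 e1.
apply: (total_op_eq (B := pure)) => //.
- apply: isometry_bounded => [a x y|x]; last by rewrite n1 n2.
  by rewrite (linD V2l) (linZ V2l) (linD V1l) (linZ V1l).
- apply: isometry_bounded => [a x y|x]; last by rewrite nmZ e1 mul1r n2 n1.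
  by rewrite (linD V1l) (linZ V1l) (linD V2l) (linZ V2l) scalerDr !scalerA mulrC.
by move=> _ [x [y ->]]; rewrite V2E !V1E V2E W12 tensZr.
Qed.

Lemma optens_id W V : is_optens tens id W V -> (forall y, W y = y) -> forall x, V x = x.
Proof.
move=> [Vb VE] Wid; apply: (total_op_eq Vb (A' := id) _ pure_dense).
  exact: isometry_bounded.
by move=> _ [x [y ->]]; rewrite VE Wid.
Qed.

Lemma optens_uniq A B C C' : is_optens tens A B C -> is_optens tens A B C' -> C = C'.
Proof.
move=> [Cb CE] [Cb' CE']; apply/funext; apply: (total_op_eq Cb Cb' pure_dense).
by move=> _ [x [y ->]]; rewrite CE CE'.
Qed.

(** In [R[i]] being nonnegative includes being real, so the imaginary part has to pass to the limit
    as well. *)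
Lemma nonneg_limit (z : R[i]) :
  (forall e : R, 0 < e -> exists2 r : R[i], 0 <= r & nm (z - r) <= e) -> 0 <= z.
Proof.
case: z => a b h; rewrite lecE /=.
have hb : b = 0.
  apply/normr0_eq0/eq0_small; first exact: normr_ge0.
  move=> e /h [[r s]]; rewrite lecE /= => /andP[/eqP -> _] hr.
  by apply: le_trans hr; apply: le_trans (Im_abs_nm _); rewrite /= subr0.
rewrite hb eqxx /= leNgt; apply/negP => a0.
have [|[r s]] := h (- a / 2); first by rewrite divr_gt0 // oppr_gt0.
rewrite lecE /= => /andP[_ r0] hr.
have := le_trans (Re_abs_nm _) hr; rewrite /= ler_norml => /andP[h1 _].
by move: a0 r0 h1; lra.
Qed.

(** On a sum of c_i u_i (x) w_i the form of rho (x) |e><e| equals that of rho at the vector sum of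
    c_i <e, w_i> u_i. Density and boundedness extend positivity to all vectors. *)
Lemma optens_state_psd rho e sigma : psd rho -> is_optens tens rho (ketbra e) sigma ->
  psd sigma.
Proof.
move=> [rl rp] [sb sE]; have [sl _] := sb; split=> // x.
have [C C0 hC] := bounded_opP sb.
have hspan a : lspan pure a -> 0 <= ip a (sigma a).
  move=> [n [c [v [pv ->]]]].
  have [|u hu] := @boolp.choice _ _ (fun i (p : H * G) => v i = tens p.1 p.2).
    by move=> i; have [u [w vE]] := pv i; exists (u, w).
  have -> : ip (\sum_(i < n) c i *: v i) (sigma (\sum_(i < n) c i *: v i)) =
      ip (\sum_(i < n) (c i * ip e (u i).2) *: (u i).1) (rho (\sum_(i < n) (c i * ip e (u i).2) *: (u i).1)).
    rewrite (lin_sum sl) (lin_sum rl) !ip_suml; apply: eq_bigr => i _.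
    rewrite !ip_sumr; apply: eq_bigr => j _.
    rewrite (linZ sl) (linZ rl) !ipZl !ipZr !hu sE tens_ip /ketbra ipZr rmorphM /=.
    rewrite (ip_conj e (u i).2) conjcK; ring.
  exact: rp.
apply: nonneg_limit => e0 e00.
pose D := C * (2 * nm x + 1) + 1.
have D0 : 0 < D by rewrite ltr_wpDl // mulr_ge0 // addr_ge0 // mulr_ge0 // nm_ge0.
have e1 : 0 < Num.min 1 (e0 / D) by rewrite lt_min ltr01 divr_gt0.
have [a pa] := dense_nm x pure_dense e1; rewrite lt_min => /andP[xa1 xa].
exists (ip a (sigma a)); first exact: hspan.
have -> : ip x (sigma x) - ip a (sigma a) = ip (x - a) (sigma x) + ip a (sigma (x - a)).
  by rewrite (linB sl) ipBl ipBr; ring.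
have na : nm a <= nm x + 1.
  by have := nm_dist a x; rewrite nmBC lerBlDl => h; apply: le_trans h _; rewrite lerD2l ltW.
apply: le_trans (nmD _ _) _.
apply: le_trans (lerD (CS _ _) (CS _ _)) _.
apply: le_trans (_ : nm (x - a) * D <= _); last by rewrite -ler_pdivlMr // ltW.
apply: le_trans (_ : nm (x - a) * (C * nm x) + (nm x + 1) * (C * nm (x - a)) <= _).
  apply: lerD; first by rewrite ler_wpM2l ?nm_ge0.
  by apply: ler_pM; rewrite ?nm_ge0.
rewrite -subr_ge0 /D; apply: le_trans (nm_ge0 (x - a)) _.
by rewrite le_eqVlt; apply/orP; left; apply/eqP; ring.
Qed.

End TensorOperators.

(** * The uncertainty relation for the output state *)

Section OutputUncertainty.
Context {R : realType} {d : nat} {H G HG : hilbert R}.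
Variables (tens : H -> G -> HG) (pow : nat -> cfun R d.+1 -> G).
Hypotheses (G_fock : is_fock pow) (HG_tensor : is_tensor tens).
Variables (U : R -> HG -> HG) (T : R) (rho : H -> H) (f : cfun R d.+1).
Hypotheses (UT_unitary : unitary_op (U T)) (rho_psd : psd rho).

Lemma scaled_displacement (V : HG -> HG) (l : R[i]) phi :
  nm l = 1 -> (forall x, nm (V x) = nm x) ->
  nm (l *: V phi - phi) ^+ 2 = 2 * nm phi ^+ 2 - 2 * complex.Re (l * ip phi (V phi)).
Proof.
move=> l1 Vn; rewrite nmBC nm_sqB nmZ l1 mul1r Vn ipZr.
by rewrite [2 * nm phi ^+ 2]mulr_natl mulr2n.
Qed.

(** The expansion of the squares converges only as a whole. Since the terms are nonnegative, M may
    first be enlarged until the partial sum is close to [z]. *)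
Lemma scaled_displacement_sum (V : HG -> HG) (l z : R[i]) (phi : nat -> HG) :
  nm l = 1 -> (forall x, nm (V x) = nm x) ->
  (forall M, \sum_(0 <= m < M) nm (phi m) ^+ 2 <= 1) ->
  (\sum_(0 <= m < M) ip (phi m) (V (phi m)) : R[i]^o) @[M --> \oo] --> (z : R[i]^o) ->
  forall M, \sum_(0 <= m < M) nm (l *: V (phi m) - phi m) ^+ 2 <= 2 - 2 * complex.Re (l * z).
Proof.
move=> l1 Vn phi1 /cvg_nmP hz M; apply/ler_addgt0Pr => e e0.
have [M0 _ hM] := hz (e / 2) (divr_gt0 e0 (ltr0Sn R 1)).
pose N := maxn M M0.
have MN : (M <= N)%N by rewrite leq_maxl.
have := hM N; rewrite /= leq_maxr => /(_ isT) hN.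
apply: le_trans (_ : \sum_(0 <= m < N) nm (l *: V (phi m) - phi m) ^+ 2 <= _).
  rewrite [X in _ <= X](big_cat_nat (n := M)) //= lerDl.
  by apply: sumr_ge0 => m _; exact: sqr_ge0.
rewrite (eq_bigr (fun m => 2 * nm (phi m) ^+ 2 - 2 * complex.Re (l * ip (phi m) (V (phi m))))); last first.
  by move=> m _; rewrite scaled_displacement.
rewrite sumrB -!mulr_sumr -raddf_sum -mulr_sumr.
have : complex.Re (l * (z - \sum_(0 <= m < N) ip (phi m) (V (phi m)))) <= e / 2.
  by apply: le_trans (Re_le_nm _) _; rewrite nmM l1 mul1r ltW.
rewrite mulrBr raddfB /=; have := phi1 N.
by move: (\sum_(0 <= m < N) nm _ ^+ 2) (complex.Re (l * z)) (complex.Re _) => x y w *; lra.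
Qed.

Lemma Phi_uncertainty (k1 k2 : R -> R) th1 th2 nu (K1 K2 : R) (z1 z2 l1 l2 : R[i]) :
  continuous k1 -> (forall s, `|k1 s| <= K1) -> continuous k2 -> (forall s, `|k2 s| <= K2) ->
  nm l1 = 1 -> nm l2 = 1 ->
  Phi_is tens pow U rho f T (fun=> 0) th1 nu 1 ->
  Phi_is tens pow U rho f T k1 th1 nu z1 -> Phi_is tens pow U rho f T k2 th2 nu z2 ->
  nm (cexp ((cis (th2 - th1) - cis (th1 - th2)) *
      (Rintegral lebesgue_measure `[0, T] (fun s => k1 s * k2 s))%:C) - 1) *
    (1 - Num.sqrt (2 - 2 * complex.Re (l1 * z1)) - Num.sqrt (2 - 2 * complex.Re (l2 * z2)))
  <= 2 * (Num.sqrt (2 - 2 * complex.Re (l1 * z1)) * Num.sqrt (2 - 2 * complex.Re (l2 * z2))).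
Proof.
move=> c1 b1 c2 b2 hl1 hl2 [W0 [V0 [s0 [W0e V0o s0o [[b b_onb] tr0]]]]].
move=> [W1 [V1 [s1 [W1e V1o s1o [_ tr1]]]]] [W2 [V2 [s2 [W2e V2o s2o [_ tr2]]]]].
pose g1 := qfun (d := d) T k1 th1 nu; pose g2 := qfun (d := d) T k2 th2 nu.
have -> : (cis (th2 - th1) - cis (th1 - th2)) *
    (Rintegral lebesgue_measure `[0, T] (fun s => k1 s * k2 s))%:C = l2ip g2 g1 - l2ip g1 g2.
  rewrite (l2ip_qfun _ _ _ _ c1 b1 c2 b2) (l2ip_qfun _ _ _ _ c2 b2 c1 b1) mulrBl.
  by congr (_ * _%:C - _); apply: eq_Rintegral => s _; rewrite mulrC.

(* Each [Phi_is] comes with its own tensor operator for the state; uniqueness identifies them, so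
   all three speak of one state. *)
have E1 := optens_uniq HG_tensor s1o s0o; have E2 := optens_uniq HG_tensor s2o s0o.
rewrite {}E1 {s1 s1o} in tr1; rewrite {}E2 {s2 s2o} in tr2.
have sg1 : sqint g1 := sqint_qfun _ _ _ c1 b1.
have sg2 : sqint g2 := sqint_qfun _ _ _ c2 b2.
have sg0 : sqint (qfun (d := d) T (fun=> 0) th1 nu).
  by apply: (@sqint_qfun _ _ _ _ _ _ 0) => s; [exact: cvg_cst | rewrite normr0].
pose w x := U T (s0 (adj (U T) x)).
have wpsd : psd w := unitary_conj_psd UT_unitary (optens_state_psd HG_tensor rho_psd s0o).
(* For k = 0 the exponential is the identity, and the corresponding [Phi_is] with value 1 says that
   the state has trace one. *)
have W0id y : W0 y = y.
  have qf0 : qfun (d := d) T (fun=> 0) th1 nu = fun _ _ => 0.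
    by apply/funext => j; apply/funext => s; rewrite /qfun mul0r; case: ifP.
  apply: (total_op_eq (B := [set expv pow f | f in @sqint R d.+1]) (A' := id)).
  - apply: isometry_bounded; first exact: quadrature_exp_linear W0e.
    exact/isometry_nm/(quadrature_exp_ip G_fock sg0 W0e).
  - exact: isometry_bounded.
  - exact: expv_dense.
  move=> _ [h sh <-]; rewrite (quadrature_exp_expv G_fock sg0 W0e) // weyl_curve1 //.
  rewrite !l2ip_qfunl (eq_leb (G := fun=> 0)); last by move=> s _; rewrite !mul0r.
  rewrite (eq_leb (G := fun=> 0)); last by move=> s _; rewrite !mul0r.
  rewrite leb0 mulr0 mul0r subr0 cexp0 scale1r; congr (expv pow _).
  by apply/funext => j; apply/funext => s; rewrite /displ /cadd qf0 mulr0 addr0.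
have V0id := optens_id HG_tensor V0o W0id.
have wtr : (\sum_(0 <= n < N) ip (b n) (w (b n)) : R[i]^o) @[N --> \oo] --> (1 : R[i]^o).
  have := tr0 b b_onb; under eq_fun do under eq_bigr do rewrite V0id; exact.
have V1n := optens_isometry HG_tensor V1o (quadrature_exp_ip G_fock sg1 W1e).
have V2n := optens_isometry HG_tensor V2o (quadrature_exp_ip G_fock sg2 W2e).
have V1l : linear V1 by case: V1o => -[].
have V2l : linear V2 by case: V2o => -[].
pose phi := chol b w.
have mass M : \sum_(0 <= m < M) nm (phi m) ^+ 2 <= 1 := chol_mass_le1 b_onb wpsd wtr M.
have V1le x : nm (V1 x) <= nm x by rewrite V1n.
have V2le x : nm (V2 x) <= nm x by rewrite V2n.
have T1 := chol_trace b_onb wpsd wtr V1l V1le (tr1 b b_onb).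
have T2 := chol_trace b_onb wpsd wtr V2l V2le (tr2 b b_onb).
have rel := weyl_relation G_fock sg1 sg2 (quadrature_exp_linear G_fock sg1 W1e)
  (quadrature_exp_linear G_fock sg2 W2e) (isometry_nm (quadrature_exp_ip G_fock sg1 W1e))
  (isometry_nm (quadrature_exp_ip G_fock sg2 W2e)) (quadrature_exp_expv G_fock sg1 W1e)
  (quadrature_exp_expv G_fock sg2 W2e).
set eta := cexp _ in rel *.
have eta1 : nm eta = 1.
  rewrite /eta nm_cexp (l2ipC sg1 sg2); case: (l2ip g1 g2) => x y /=.
  by rewrite subrr expR0.
have relV := optens_weyl HG_tensor V1o V2o V1n V2n rel eta1.
(* The centring phases cancel from the Weyl relation, so [eta] also serves for the rescaled
   operators. *)
apply: (@state_uncertainty _ _ (fun x => l1 *: V1 x) (fun x => l2 *: V2 x) eta phi) => //.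
- by move=> a x y; rewrite (linD V1l) (linZ V1l) scalerDr !scalerA mulrC.
- by move=> a x y; rewrite (linD V2l) (linZ V2l) scalerDr !scalerA mulrC.
- by move=> x; rewrite nmZ hl1 mul1r.
- by move=> x; rewrite nmZ hl2 mul1r.
- move=> x; rewrite (linZ V1l) (linZ V2l) relV !scalerA; congr (_ *: _); ring.
- by move=> e /(chol_mass_cvg b_onb wpsd wtr)[M0 h]; exists M0; exact: h.
- exact: (scaled_displacement_sum (phi := phi) hl1 V1n mass T1).
- exact: (scaled_displacement_sum (phi := phi) hl2 V2n mass T2).
Qed.

End OutputUncertainty.

(** * Characteristic functions and second moments *)

Section CosBound.
Context {R : realType}.

Lemma sin_abs_le (y : R) : `|sin y| <= `|y|.
Proof.
wlog y0 : y / 0 <= y.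
  move=> h; have [/h//|y0] := leP 0 y.
  by rewrite -normrN -sinN -(normrN y); apply: h; rewrite oppr_ge0 ltW.
have [c _ hc] : exists2 c, c \in `[0, y] & sin y - sin 0 = cos c * (y - 0).
  apply: (@MVT_segment R sin cos) => //.
  by apply: continuous_subspaceT => x; exact: continuous_sin.
move: hc; rewrite sin0 !subr0 => ->; rewrite normrM ler_piMl // ler_norml.
by rewrite cos_geN1 cos_le1.
Qed.

(** With y = x / 2 the two sides are 4 (sin y)^2 and 4 y^2. *)
Lemma cos_quadratic_bound (x : R) : 2 - 2 * cos x <= x ^+ 2.
Proof.
have -> : x = (x / 2) *+ 2 by rewrite -mulr_natr divfK.
set y := x / 2; rewrite cos_mulr2n.
have -> : 2 - 2 * (cos y ^+ 2 *+ 2 - 1) = 4 * sin y ^+ 2.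
  by rewrite sin2cos2; ring.
have -> : (y *+ 2) ^+ 2 = 4 * y ^+ 2 by ring.
by rewrite ler_pM2l // -(ler_pXn2r (n := 2)) ?nnegrE ?sqr_ge0 // -[sin y ^+ 2]real_normK ?num_real // -[y ^+ 2]real_normK ?num_real // !ler_sqr ?nnegrE // sin_abs_le.
Qed.

End CosBound.

Section CharacteristicFunction.
Context {R : realType} {dO : measure_display} {Om : measurableType dO} (P : probability Om R).
Variable Y : {RV P >-> R}.

(* E|exp(ia(Y - c)) - 1|^2 *)
Definition char_defect (c a : R) : R :=
  2 - 2 * complex.Re (cis (- (a * c)) * exp_char P (fun w => a * Y w)).

Let trig_integrable (u : R -> R) (K : R) : continuous u -> (forall x, `|u x| <= K) ->
  P.-integrable setT (EFin \o (fun w => u (Y w))).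
Proof.
move=> uc uK; apply: measurable_bounded_integrable => //.
- by rewrite (le_lt_trans (probability_le1 _ _)) ?ltry.
- apply: (measurableT_comp (f := u)); last exact: measurable_funP.
  exact: measurable_realfun.continuous_measurable_fun.
- exists K; split; first by rewrite num_real.
  by move=> M KM w _; apply: le_trans (uK _) (ltW KM).
Qed.

Let cos_cont (a b : R) : continuous (fun x : R => cos (a * x + b)).
Proof.
move=> s; apply: continuous_comp; last exact: continuous_cos.
by apply: cvgD; [apply: cvgM; [exact: cvg_cst|exact: cvg_id]|exact: cvg_cst].
Qed.

Let sin_cont (a b : R) : continuous (fun x : R => sin (a * x + b)).
Proof.
move=> s; apply: continuous_comp; last exact: continuous_sin.
by apply: cvgD; [apply: cvgM; [exact: cvg_cst|exact: cvg_id]|exact: cvg_cst].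
Qed.

Lemma char_defectE c a :
  (char_defect c a)%:E = (\int[P]_w (2 - 2 * cos (a * (Y w - c)))%:E)%E.
Proof.
have cos1 (x : R) : `|cos x| <= 1 by rewrite ler_norml cos_geN1 cos_le1.
have i1 : P.-integrable setT (EFin \o (fun w => cos (a * Y w))).
  have := trig_integrable (@cos_cont a 0) (fun x => cos1 _).
  by under eq_fun do rewrite addr0.
have i2 : P.-integrable setT (EFin \o (fun w => sin (a * Y w))).
  have := trig_integrable (@sin_cont a 0) (fun x => sin_max _).
  by under eq_fun do rewrite addr0.
have i0 : P.-integrable setT (EFin \o (fun=> 2)) by exact: finite_measure_integrable_cst.
have j1 := integrableZ_EFin measurableT (- 2 * cos (a * c)) i1.
have j2 := integrableZ_EFin measurableT (- 2 * sin (a * c)) i2.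
have j3 := integrableD_EFin measurableT j1 j2.
have j4 := integrableD_EFin measurableT i0 j3.
have -> : (fun w => (2 - 2 * cos (a * (Y w - c)))%:E) = EFin \o (fun w =>
    2 + (- 2 * cos (a * c) * cos (a * Y w) + - 2 * sin (a * c) * sin (a * Y w))).
  by apply/funext => w /=; congr EFin; rewrite mulrBr cosB; ring.
rewrite -(fineK (integrable_fin_num measurableT j4)); congr EFin.
rewrite -/(Rintegral _ _ _) RintegralD // RintegralD // !RintegralZl //.
have -> : Rintegral P setT (fun=> 2) = 2 by rewrite Rintegral_cst // [X in fine X]probability_setT mulr1.
rewrite /char_defect /exp_char /cintegral /cis /= cosN sinN; ring.
Qed.

Let defect_measurable c a : measurable_fun setT (fun w => 2 - 2 * cos (a * (Y w - c))).
Proof.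
rewrite (_ : (fun _ => _) = (fun x : R => 2 - 2 * cos (a * (x - c))) \o Y) //.
apply: measurableT_comp; last exact: measurable_funP.
apply: measurable_realfun.continuous_measurable_fun => x.
apply: cvgB; first exact: cvg_cst.
apply: cvgM; first exact: cvg_cst.
rewrite (_ : (fun _ => _) = (fun x : R => cos (a * x + (- (a * c))))); last first.
  by apply/funext => y; rewrite mulrBr.
by rewrite mulrBr; exact: cos_cont.
Qed.

Let defect_ge0 c a w : 0 <= 2 - 2 * cos (a * (Y w - c)).
Proof. by rewrite subr_ge0 ger_pMr // cos_le1. Qed.

Lemma char_defect_le c a : ((char_defect c a)%:E <= (a ^+ 2)%:E * \int[P]_w ((Y w - c) ^+ 2)%:E)%E.
Proof.
have mY : measurable_fun setT (fun w => (Y w - c) ^+ 2).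
  apply: measurable_realfun.measurable_funX; apply: measurable_realfun.measurable_funB => //.
rewrite char_defectE -ge0_integralZl_EFin ?sqr_ge0 //; last first.
- by apply/measurable_realfun.measurable_EFinP.
- by move=> w _; rewrite lee_fin sqr_ge0.
apply: ge0_le_integral => //.
- by apply/measurable_realfun.measurable_EFinP.
- by apply/measurable_realfun.measurable_EFinP; exact: measurable_realfun.measurable_funM.
move=> w _; rewrite lee_fin; apply: le_trans (cos_quadratic_bound _) _.
by rewrite exprMn.
Qed.

(** Dominated convergence with the bound 4. It covers an infinite second moment, where
    [char_defect_le] gives no information for a nonzero parameter. *)
Lemma char_defect_small c e : 0 < e -> exists2 a, 0 < a & char_defect c a < e.
Proof.
move=> e0.
pose F n w := (2 - 2 * cos (n.+1%:R^-1 * (Y w - c)))%:E.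
have lim0 : (\int[P]_w F n w)%E @[n --> \oo] --> (\int[P]_w (cst 0%E w))%E.
  apply: (@dominated_cvg _ _ _ _ _ _ F _ (cst 4%:E)) => //.
  - by move=> n; apply/measurable_realfun.measurable_EFinP.
  - move=> w _; apply: cvg_EFin; first by near=> n.
    have -> : (0 : R) = 2 - 2 * cos (0 * (Y w - c)) by rewrite mul0r cos0; ring.
    apply: cvgB; first exact: cvg_cst.
    apply: cvgM; first exact: cvg_cst.
    have h : n.+1%:R^-1 * (Y w - c) @[n --> \oo] --> 0 * (Y w - c).
      by apply: cvgM; [exact: cvg_harmonic | exact: cvg_cst].
    exact: (cvg_comp _ _ h (@continuous_cos R _)).
  - exact: finite_measure_integrable_cst.
  - move=> n w _; rewrite /F gee0_abs ?lee_fin //.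
    by rewrite lerBlDr -lerBlDl; have := cos_geN1 (n.+1%:R^-1 * (Y w - c)); lra.
rewrite integral0 in lim0.
have /cvgrPdist_lt/(_ _ e0)[N _ /(_ N (leqnn N)) hN] :
    char_defect c n.+1%:R^-1 @[n --> \oo] --> (0 : R).
  have -> : (fun n => char_defect c n.+1%:R^-1) = fine \o (fun n => \int[P]_w F n w)%E.
    by apply/funext => n /=; rewrite -char_defectE.
  exact: fine_cvg.
exists (N.+1%:R^-1) => //.
by move: hN; rewrite /= sub0r normrN; apply: le_lt_trans; exact: ler_norm.
Unshelve. all: by end_near.
Qed.

End CharacteristicFunction.

(** * From characteristic functions to variances *)

Section VarianceProduct.
Context {R : realType}.

Lemma cexp_im_lower (y : R) : `|y| <= 1 ->
  `|y| - expR 1 * y ^+ 2 <= nm (cexp ('i%C * y%:C) - 1).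
Proof.
move=> y1; have ny : nm ('i%C * y%:C : R[i]) = `|y| by rewrite nmM nm_i mul1r nmR.
have := @cexp_taylor R ('i%C * y%:C); rewrite ny => /(_ y1).
rewrite real_normK ?num_real // => h; rewrite lerBlDr.
rewrite -[X in X <= _]ny; apply: le_trans (lerD (lexx _) h).
rewrite -[X in nm X <= _](subKr (cexp ('i%C * y%:C) - 1)).
by apply: le_trans (nmD _ _) _; rewrite nmN.
Qed.

(* Since [0 * +oo = 0] for extended reals, the conclusion also says that a
   variance cannot vanish if [0 < kap]; the two smallness hypotheses exclude this
   case when the other variance is infinite. *)
Lemma uncertainty_of_defects (D1 D2 : R -> R) (s1 s2 : \bar R) (kap sg : R) :
  0 <= kap -> `|sg| = 1 -> (0 <= s1)%E -> (0 <= s2)%E ->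
  (forall a, (D1 a)%:E <= (a ^+ 2)%:E * s1)%E ->
  (forall a, (D2 a)%:E <= (a ^+ 2)%:E * s2)%E ->
  (forall e, 0 < e -> exists2 a, 0 < a & D1 a < e) ->
  (forall e, 0 < e -> exists2 a, 0 < a & D2 a < e) ->
  (forall a b, 0 < a -> 0 < b ->
    nm (cexp ('i%C * (2 * sg * (a * b * kap))%:C) - 1) * (1 - Num.sqrt (D1 a) - Num.sqrt (D2 b))
      <= 2 * (Num.sqrt (D1 a) * Num.sqrt (D2 b))) ->
  ((kap ^+ 2)%:E <= s1 * s2)%E.
Proof.
move=> k0 sg1 s10 s20 h1 h2 small1 small2 hE.
have [->|kn0] := eqVneq kap 0; first by rewrite expr0n /= mule_ge0.
have kp : 0 < kap by rewrite lt_def kn0.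
have low x : 0 < x -> x <= 2^-1 ->
    2 * x - 4 * expR 1 * x ^+ 2 <= nm (cexp ('i%C * (2 * sg * x)%:C) - 1).
  move=> x0 x1; have ny : `|2 * sg * x| = 2 * x by rewrite !normrM sg1 mulr1 ger0_norm // gtr0_norm.
  apply: le_trans (cexp_im_lower _); rewrite ny.
    rewrite lerD2l lerN2 -[(2 * sg * x) ^+ 2]real_normK ?num_real // ny.
    by rewrite le_eqVlt; apply/orP; left; apply/eqP; ring.
  by rewrite -ler_pdivlMl // mulr1.
(* The maximizer of the lower bound 2 x - 4 e x^2, with value x0 again: a definite point at which
   eta differs from 1. *)
pose x0 : R := (4 * expR 1)^-1.
have e1 : 1 <= expR (1 : R) by apply: le_trans (expR_ge1Dx 1); rewrite lerDl.
have x0p : 0 < x0 by rewrite invr_gt0 mulr_gt0 // expR_gt0.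
have x0h : x0 <= 2^-1.
  by rewrite lef_pV2 ?posrE ?mulr_gt0 ?expR_gt0 //; move: e1; lra.
have Ex0 : 0 < nm (cexp ('i%C * (2 * sg * x0)%:C) - 1).
  apply: lt_le_trans (low _ x0p x0h).
  have -> : 2 * x0 - 4 * expR 1 * x0 ^+ 2 = x0.
    by rewrite /x0; field; rewrite gt_eqF // expR_gt0.
  exact: x0p.
(* If s2 is 0, D2 contributes nothing at any argument. With D1 a < 1 and b chosen such that a b kap
   = x0, the left side of the inequality is positive and the right side is 0. *)
have deg1 : s2 = 0%E -> False.
  move=> s2E; have [a a0 Da] := small1 1 ltr01.
  have b0 : 0 < x0 / (a * kap) by rewrite divr_gt0 // mulr_gt0.
  have := hE a (x0 / (a * kap)) a0 b0.
  have -> : a * (x0 / (a * kap)) * kap = x0 by field; rewrite kn0 gt_eqF.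
  have -> : Num.sqrt (D2 (x0 / (a * kap))) = 0.
    by apply/eqP; rewrite sqrtr_eq0 -lee_fin; have := h2 (x0 / (a * kap)); rewrite s2E mule0.
  rewrite subr0 !mulr0 pmulr_rle0 // subr_le0 leNgt => /negP; apply.
  by rewrite -sqrtr1 ltr_sqrt.
have deg2 : s1 = 0%E -> False.
  move=> s1E; have [b b0 Db] := small2 1 ltr01.
  have a0 : 0 < x0 / (b * kap) by rewrite divr_gt0 // mulr_gt0.
  have := hE (x0 / (b * kap)) b a0 b0.
  have -> : x0 / (b * kap) * b * kap = x0 by field; rewrite kn0 gt_eqF.
  have -> : Num.sqrt (D1 (x0 / (b * kap))) = 0.
    by apply/eqP; rewrite sqrtr_eq0 -lee_fin; have := h1 (x0 / (b * kap)); rewrite s1E mule0.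
  rewrite subr0 mul0r !mulr0 pmulr_rle0 // subr_le0 leNgt => /negP; apply.
  by rewrite -sqrtr1 ltr_sqrt.
case: s1 s10 h1 deg2 => [v1 s10 h1 deg2|_ _ deg2|//]; last first.
  have s2p : (0 < s2)%E by rewrite lt_def s20 andbT; apply/eqP => /deg1.
  by rewrite gt0_mulye // leey.
case: s2 s20 h2 deg1 => [v2 s20 h2 deg1|_ _ deg1|//]; last first.
  have s1p : (0 < v1%:E)%E by rewrite lt_def s10 andbT; apply/eqP => /deg2.
  by rewrite gt0_muley // leey.
rewrite -EFinM lee_fin.
rewrite !lee_fin in s10 s20.
pose q1 := Num.sqrt v1; pose q2 := Num.sqrt v2.
have q10 : 0 <= q1 := sqrtr_ge0 _; have q20 : 0 <= q2 := sqrtr_ge0 _.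
suff kq : kap <= q1 * q2.
  by rewrite -(sqr_sqrtr s10) -(sqr_sqrtr s20) -exprMn ler_sqr ?nnegrE // mulr_ge0.
have bnd (D : R -> R) v : 0 <= v -> (forall a, ((D a)%:E <= (a ^+ 2)%:E * v%:E)%E) ->
    forall a, 0 < a -> Num.sqrt (D a) <= a * Num.sqrt v.
  move=> v0 hD a a0; have := hD a; rewrite -EFinM lee_fin => /ler_wsqrtr.
  by rewrite sqrtrM ?sqr_ge0 // sqrtr_sqr gtr0_norm.
(* With a = b = h and after division by 2 h^2, the inequality reads kap <= q1 q2 up to errors from
   the square roots and from the Taylor remainder; for h <= 1 they are at most h M. *)
pose M := kap * (q1 + q2) + 2 * expR 1 * kap ^+ 2.
have M0 : 0 <= M by rewrite addr_ge0 ?mulr_ge0 ?addr_ge0 ?expR_ge0 ?sqr_ge0.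
have key h : 0 < h -> h <= 1 -> h ^+ 2 * kap <= 2^-1 -> 2 * expR 1 * (h ^+ 2 * kap) <= 1 ->
    h * (q1 + q2) <= 1 -> kap <= q1 * q2 + h * M.
  move=> h0 h_1 hk hk2 hq.
  have hx : 0 < h * h * kap by rewrite !mulr_gt0.
  have l := low _ hx; rewrite -expr2 in l hx; have {}l := l hk.
  have d1 := bnd _ _ s10 h1 h h0; have d2 := bnd _ _ s20 h2 h h0.
  have := hE h h h0 h0; rewrite -expr2.
  move: l; set E := nm _ => l hh.
  have hd : 2 * (Num.sqrt (D1 h) * Num.sqrt (D2 h)) <= 2 * (h * q1 * (h * q2)).
    by rewrite ler_pM2l // ler_pM ?sqrtr_ge0.
  have E0 : 0 <= E := nm_ge0 _.
  have hl : E * (1 - h * (q1 + q2)) <= 2 * (h * q1 * (h * q2)).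
    apply: le_trans (le_trans hh hd); rewrite ler_wpM2l //.
    by rewrite -addrA lerD2l -opprD lerN2 mulrDr lerD.
  have {}hl : (2 * (h ^+ 2 * kap) - 4 * expR 1 * (h ^+ 2 * kap) ^+ 2) * (1 - h * (q1 + q2))
      <= 2 * (h * q1 * (h * q2)).
    by apply: le_trans hl; rewrite ler_wpM2r // subr_ge0.
  have h2p : 0 < 2 * h ^+ 2 by rewrite mulr_gt0 ?exprn_gt0.
  have {}hl : (kap - 2 * expR 1 * h ^+ 2 * kap ^+ 2) * (1 - h * (q1 + q2)) <= q1 * q2.
    rewrite -(ler_pM2l h2p); apply: le_trans (le_trans _ hl) _; rewrite le_eqVlt; apply/orP; left; apply/eqP; ring.
  rewrite -lerBlDr; apply: le_trans hl.
  rewrite -subr_ge0 /M.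
  have -> : (kap - 2 * expR 1 * h ^+ 2 * kap ^+ 2) * (1 - h * (q1 + q2)) -
     (kap - h * (kap * (q1 + q2) + 2 * expR 1 * kap ^+ 2)) =
     2 * expR 1 * kap ^+ 2 * (h * (1 - h) + h ^+ 2 * (h * (q1 + q2))) by ring.
  have h10 : 0 <= 1 - h by rewrite subr_ge0.
  apply: mulr_ge0; first by rewrite !mulr_ge0 ?expR_ge0 ?sqr_ge0.
  have hp : 0 <= h := ltW h0.
  apply: addr_ge0; first exact: mulr_ge0.
  by apply: mulr_ge0; [exact: sqr_ge0 | apply: mulr_ge0 => //; exact: addr_ge0].
apply/ler_addgt0Pr => e e0.
(* Each summand takes care of one requirement on h = 1 / B in [key]; the last one makes h M at most
   e. *)
pose B := 1 + 2 * kap + 2 * expR 1 * kap + (q1 + q2) + M / e.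
have Me : 0 <= M / e by rewrite divr_ge0 // ltW.
have ek : 0 <= 2 * expR 1 * kap by rewrite !mulr_ge0 ?expR_ge0.
have B1 : 1 <= B by rewrite /B; move: k0 q10 q20 ek Me; lra.
have Bp : 0 < B by apply: lt_le_trans B1.
pose h := B^-1.
have h0 : 0 < h by rewrite invr_gt0.
have h_1 : h <= 1 by rewrite invf_le1.
have hB : h * B = 1 by rewrite mulVf // gt_eqF.
have hle y : y <= B -> h * y <= 1 by move=> yB; rewrite -hB ler_pM2l.
have h2le : h ^+ 2 <= h by rewrite expr2 ger_pMl.
apply: le_trans (key h h0 h_1 _ _ _) _.
- have : h * (2 * kap) <= 1 by apply: hle; rewrite /B; move: k0 q10 q20 ek Me; lra.
  have : h ^+ 2 * kap <= h * kap by rewrite ler_wpM2r.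
  by move: (h ^+ 2 * kap) => y; rewrite mulrCA; move: (h * kap) => z; lra.
- have : h * (2 * expR 1 * kap) <= 1 by apply: hle; rewrite /B; move: k0 q10 q20 ek Me; lra.
  apply: le_trans; have -> : h * (2 * expR 1 * kap) = 2 * expR 1 * (h * kap) by ring.
  by rewrite ler_wpM2l ?mulr_ge0 ?expR_ge0 // ler_wpM2r.
- by apply: hle; rewrite /B; move: k0 q10 q20 ek Me; lra.
rewrite lerD2l; have : h * (M / e) <= 1 by apply: hle; rewrite /B; move: k0 q10 q20 ek Me; lra.
by rewrite mulrA ler_pdivrMr // mul1r.
Qed.

End VarianceProduct.

(** The centre is a real number in all cases, as [fine] yields 0 at an infinite expectation, and
    [char_defect_le] holds for every real centre. *)
Lemma variance_integral (R : realType) d (O : measurableType d) (P : probability O R) (Y : {RV P >-> R}) :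
  'V_P[Y] = (\int[P]_w ((Y w - fine 'E_P[Y]) ^+ 2)%:E)%E.
Proof.
rewrite /variance covariance.unlock expectation.unlock.
by apply: eq_integral => w _ /=.
Qed.

(** * Combining products of extended-real variances *)

Section SpectrumBound.
Context {R : realType}.
Implicit Types (v u p q : \bar R) (x y T : R).

Lemma ereal_sum_product v1 v2 u1 u2 x y : 0 <= x -> 0 <= y -> 0 < x + y ->
  (0 <= v1)%E -> (0 <= v2)%E -> (0 <= u1)%E -> (0 <= u2)%E ->
  ((x ^+ 2)%:E <= v1 * v2)%E -> ((y ^+ 2)%:E <= u1 * u2)%E ->
  (((x + y) ^+ 2)%:E <= (v1 + u1) * (v2 + u2))%E.
Proof.
move=> x0 y0 xy v10 v20 u10 u20 hv hu.
(* If a factor of the product were 0, both of its summands would be, hence x and y too, against 0 <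
   x + y. After that an infinite summand makes the product infinite. *)
have deg (a b a' b' : \bar R) : (0 <= a)%E -> (0 <= b)%E -> ((x ^+ 2)%:E <= a * a')%E ->
    ((y ^+ 2)%:E <= b * b')%E -> (a + b)%E = 0%E -> False.
  move=> a0 b0 ha hb /eqP; rewrite padde_eq0 // => /andP[/eqP aE /eqP bE].
  have sq0 (r : R) : r ^+ 2 <= 0 -> r = 0.
    by move=> r2; apply/eqP; rewrite -sqrf_eq0 eq_le r2 sqr_ge0.
  move: ha hb; rewrite aE bE !mul0e !lee_fin => /sq0 xE /sq0 yE.
  by move: xy; rewrite xE yE addr0 ltxx.
have p0 : (0 < v1 + u1)%E.
  by rewrite lt_def adde_ge0 // andbT; apply/eqP => h; exact: deg v10 u10 hv hu h.
have q0 : (0 < v2 + u2)%E.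
  rewrite lt_def adde_ge0 // andbT; apply/eqP => h.
  by apply: (deg v2 u2 v1 u1) => //; rewrite muleC.
case: v1 v10 hv p0 => [v1| |//] v10 hv p0; last first.
  by rewrite addye ?gt0_mulye ?leey // gt_eqF // (lt_le_trans _ u10) ?ltNyr.
case: u1 u10 hu p0 => [u1| |//] u10 hu p0; last first.
  by rewrite addey ?gt0_mulye ?leey.
case: v2 v20 hv q0 => [v2| |//] v20 hv q0; last first.
  by rewrite addye ?gt0_muley ?leey // gt_eqF // (lt_le_trans _ u20) ?ltNyr.
case: u2 u20 hu q0 => [u2| |//] u20 hu q0; last first.
  by rewrite addey ?gt0_muley ?leey.
move: v10 u10 v20 u20 hv hu; rewrite -!EFinD -!EFinM !lee_fin => v10 u10 v20 u20 hv hu.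
have hx : x <= Num.sqrt v1 * Num.sqrt v2.
  rewrite -sqrtrM // -[x]ger0_norm // -sqrtr_sqr; exact: ler_wsqrtr.
have hy : y <= Num.sqrt u1 * Num.sqrt u2.
  rewrite -sqrtrM // -[y]ger0_norm // -sqrtr_sqr; exact: ler_wsqrtr.
apply: le_trans (_ : (Num.sqrt v1 * Num.sqrt v2 + Num.sqrt u1 * Num.sqrt u2) ^+ 2 <= _).
  by rewrite ler_sqr ?nnegrE ?addr_ge0 ?mulr_ge0 ?sqrtr_ge0 // lerD.
rewrite -{2}(sqr_sqrtr v10) -{2}(sqr_sqrtr v20) -{2}(sqr_sqrtr u10) -{2}(sqr_sqrtr u20) -subr_ge0.
move: (Num.sqrt v1) (Num.sqrt v2) (Num.sqrt u1) (Num.sqrt u2) => a b c e.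
apply: le_trans (sqr_ge0 (a * e - c * b)) _.
by rewrite le_eqVlt; apply/orP; left; apply/eqP; ring.
Qed.

Lemma ereal_amgm p q : (0 <= p)%E -> (0 <= q)%E -> (1 <= p * q)%E ->
  (1 <= (2^-1)%:E * (p + q))%E.
Proof.
have half : ((2^-1)%:E * +oo = +oo :> \bar R)%E.
  by apply: gt0_muley; rewrite lte_fin invr_gt0.
case: p => [p| |//] p0; case: q => [q| |//] q0.
- rewrite -EFinM -EFinD -EFinM !lee_fin => pq; rewrite !lee_fin in p0 q0.
  rewrite ler_pdivlMl // mulr1.
  rewrite -(ler_pXn2r (n := 2)) ?nnegrE ?addr_ge0 //.
  have := sqr_ge0 (p - q); move: pq; rewrite !expr2; nra.
- by move=> _; rewrite addey // half leey.
- by move=> _; rewrite addye // half leey.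
- by move=> _; rewrite addey // half leey.
Qed.

End SpectrumBound.

(** * Variances of the output integrals *)

Section OutputVariance.
Context {R : realType} {d : nat} {H G HG : hilbert R}.
Variables (tens : H -> G -> HG) (pow : nat -> cfun R d.+1 -> G).
Hypotheses (G_fock : is_fock pow) (HG_tensor : is_tensor tens).
Variables (U : R -> HG -> HG) (T : R) (rho : H -> H) (f : cfun R d.+1).
Hypotheses (UT_unitary : unitary_op (U T)) (rho_psd : psd rho).
Variables (th nu : R) (sgn : bool).
Context {dO1 dO2 : measure_display} {Om1 : measurableType dO1} {Om2 : measurableType dO2}.
Variables (P1 : probability Om1 R) (P2 : probability Om2 R).
Variables (Y1 : {RV P1 >-> R}) (Y2 : {RV P2 >-> R}) (k : R -> R).
Hypotheses (k_cont : continuous k) (k_bd : forall s, `|k s| <= 1).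
Let th' := th + (-1) ^+ sgn * (pi / 2).
Hypothesis char1 : forall a, Phi_is tens pow U rho f T (fun s => a * k s) th nu
  (exp_char P1 (fun w => a * Y1 w)).
Hypothesis char2 : forall a, Phi_is tens pow U rho f T (fun s => a * k s) th' nu
  (exp_char P2 (fun w => a * Y2 w)).

Lemma exp_char0 : exp_char P1 (fun w => 0 * Y1 w) = 1.
Proof.
rewrite /exp_char /cintegral.
under eq_Rintegral do rewrite mul0r /cis cos0 /=.
under [X in _ +i* X]eq_Rintegral do rewrite mul0r /cis sin0 /=.
rewrite !Rintegral_cst // mul0r [X in fine X]probability_setT mulr1.
by [].
Qed.

Lemma variance_product :
  ((Rintegral lebesgue_measure `[0, T] (fun s => k s ^+ 2) ^+ 2)%:E <= 'V_P1[Y1] * 'V_P2[Y2])%E.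
Proof.
rewrite !variance_integral.
set c1 := fine _; set c2 := fine _.
have zero : Phi_is tens pow U rho f T (fun=> 0) th nu 1.
  rewrite -exp_char0; have := char1 0; rewrite (_ : (fun s => 0 * k s) = fun=> 0) //.
  by apply/funext => s; rewrite mul0r.
apply: (@uncertainty_of_defects R (char_defect Y1 c1) (char_defect Y2 c2) _ _ _ ((-1) ^+ sgn)).
- by apply: Rintegral_ge0 => s _; exact: sqr_ge0.
- by rewrite normrX normrN1 expr1n.
- by apply: integral_ge0 => w _; rewrite lee_fin sqr_ge0.
- by apply: integral_ge0 => w _; rewrite lee_fin sqr_ge0.
- exact: char_defect_le.
- exact: char_defect_le.
- exact: char_defect_small.
- exact: char_defect_small.
move=> a b a0 b0.
have cont c : continuous (fun s => c * k s).
  by move=> s; apply: cvgM; [exact: cvg_cst | exact: k_cont].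
have bd c s : `|c * k s| <= `|c| by rewrite normrM ler_piMr.
have := Phi_uncertainty G_fock HG_tensor UT_unitary rho_psd (cont a) (bd a) (cont b) (bd b)
  (nm_cis (- (a * c1))) (nm_cis (- (b * c2))) zero (char1 a) (char2 b).
rewrite -/(char_defect Y1 c1 a) -/(char_defect Y2 c2 b).
suff -> : (cis (th' - th) - cis (th - th')) *
   (Rintegral lebesgue_measure `[0, T] (fun s => a * k s * (b * k s)))%:C =
   'i%C * (2 * (-1) ^+ sgn * (a * b * Rintegral lebesgue_measure `[0, T] (fun s => k s ^+ 2)))%:C by [].
have mT : measurable (`[0, T] : set (measurableTypeR R)) by exact: measurable_itv.
have -> : Rintegral lebesgue_measure `[0, T] (fun s => a * k s * (b * k s)) =
    a * b * Rintegral lebesgue_measure `[0, T] (fun s => k s ^+ 2).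
  rewrite -RintegralZl //; first by apply: eq_Rintegral => s _; ring.
  apply: (@continuous_bounded_integrable _ _ _ 1).
    by move=> s; apply: cvgM; exact: k_cont.
  by move=> s; rewrite normrX expr_le1.
(* The angles differ by a quarter turn, so the two phases are i and -i in one order or the other,
   and their difference is 2 i up to sign. *)
have -> : cis (th' - th) - cis (th - th') = 'i%C * (2 * (-1) ^+ sgn)%:C.
  have -> : th - th' = - (th' - th) by ring.
  have -> : th' - th = (-1) ^+ sgn * (pi / 2) by rewrite /th'; ring.
  rewrite /cis cosN sinN; case: sgn; rewrite ?expr1 ?expr0 ?mulN1r ?mul1r ?cosN ?sinN cos_pihalf sin_pihalf; cring.
by rewrite -[LHS]mulrA -rmorphM.
Qed.

End OutputVariance.

Lemma output_model_char (R : realType) (d : nat) (H G HG : hilbert R) (tens : H -> G -> HG)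
    (pow : nat -> cfun R d.+1 -> G) U rho f T mu th nu
    (dO : measure_display) (Om : measurableType dO) (P : probability Om R) (X : R -> {RV P >-> R}) (IC IS : {RV P >-> R}) :
  output_model tens pow U rho f th nu T mu X IC IS ->
  (forall a, Phi_is tens pow U rho f T (fun s => a * cos (mu * s)) th nu (exp_char P (fun w => a * IC w))) /\
  (forall a, Phi_is tens pow U rho f T (fun s => a * sin (mu * s)) th nu (exp_char P (fun w => a * IS w))).
Proof.
move=> [_ _ _ h]; split=> a.
  have := h a 0.
  rewrite (_ : (fun s => _) = (fun s => a * cos (mu * s))); last by apply/funext => s; rewrite mul0r addr0.
  by rewrite (_ : (fun w => _ + 0 * _) = (fun w => a * IC w)) //; apply/funext => w; rewrite mul0r addr0.
have := h 0 a.
rewrite (_ : (fun s => _) = (fun s => a * sin (mu * s))); last by apply/funext => s; rewrite mul0r add0r.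
by rewrite (_ : (fun w => 0 * _ + _) = (fun w => a * IS w)) //; apply/funext => w; rewrite mul0r add0r.
Qed.

Theorem theorem1 (R : realType) (d : nat) (H G HG : hilbert R)
    (tens : H -> G -> HG) (pow : nat -> cfun R d.+1 -> G)
    (H_separable : separable_hilbert H)
    (G_fock : is_fock pow)
    (HG_tensor : is_tensor tens)
    (Ham : H -> H) (Rk : 'I_d.+1 -> H -> H) (S : 'I_d.+1 -> 'I_d.+1 -> H -> H)
    (Ham_bounded : bounded_op Ham)
    (Rk_bounded : forall k, bounded_op (Rk k))
    (S_bounded : forall k l, bounded_op (S k l))
    (Ham_selfadjoint : forall x, adj Ham x = Ham x)
    (S_isometry : forall k l x,
       \sum_j adj (S j k) (S j l x) = (k == l)%:R *: x)
    (S_coisometry : forall k l x,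
       \sum_j S k j (adj (S l j) x) = (k == l)%:R *: x)
    (U : R -> HG -> HG) (U_HP : HP_solution tens pow Ham Rk S U)
    (rho : H -> H) (rho_state : statistical_op rho)
    (f : cfun R d.+1) (f_sqint : sqint f)
    (T mu th nu : R) (T_gt0 : 0 < T) (nu_gt0 : 0 < nu)
    (th_angle : - pi < th <= pi) (sgn : bool)
    (dO1 : measure_display) (Om1 : measurableType dO1) (P1 : probability Om1 R)
    (X1 : R -> {RV P1 >-> R}) (IC1 IS1 : {RV P1 >-> R})
    (out1 : output_model tens pow U rho f th nu T mu X1 IC1 IS1)
    (dO2 : measure_display) (Om2 : measurableType dO2) (P2 : probability Om2 R)
    (X2 : R -> {RV P2 >-> R}) (IC2 IS2 : {RV P2 >-> R})
    (out2 : output_model tens pow U rho f (th + (-1) ^+ sgn * (pi / 2)) nu T mu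
              X2 IC2 IS2) :
  (1 <= (2^-1)%:E * (S_inel T IC1 IS1 + S_inel T IC2 IS2))%E /\
  (1 <= S_inel T IC1 IS1 * S_inel T IC2 IS2)%E.
Proof.
have [U_unitary _ _ _ _] := U_HP; have UT := U_unitary T (ltW T_gt0).
have [[rhol _] rhop _] := rho_state.
have rho_psd : psd rho by [].
have [C1 S1] := output_model_char out1; have [C2 S2] := output_model_char out2.
have cosc : continuous (fun s : R => cos (mu * s)).
  move=> s; apply: continuous_comp; last exact: continuous_cos.
  by apply: cvgM; [exact: cvg_cst | exact: cvg_id].
have sinc : continuous (fun s : R => sin (mu * s)).
  move=> s; apply: continuous_comp; last exact: continuous_sin.
  by apply: cvgM; [exact: cvg_cst | exact: cvg_id].
have cos1 (s : R) : `|cos (mu * s)| <= 1 by rewrite ler_norml cos_geN1 cos_le1.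
have sin1 (s : R) : `|sin (mu * s)| <= 1 by exact: sin_max.
have HC := variance_product G_fock HG_tensor UT rho_psd cosc cos1 C1 C2.
have HS := variance_product G_fock HG_tensor UT rho_psd sinc sin1 S1 S2.
have sq_int (k : R -> R) : continuous k -> (forall s, `|k s| <= 1) ->
    lebesgue_measure.-integrable `[0, T] (EFin \o (fun s => k s ^+ 2)).
  move=> kc k1; apply: (@continuous_bounded_integrable _ _ _ 1).
    by move=> s; apply: cvgM; exact: kc.
  by move=> s; rewrite normrX expr_le1.
have mT : measurable (`[0, T] : set (measurableTypeR R)) by exact: measurable_itv.
(* The two time integrals add up to T for every [mu]; T^2 then cancels the two factors 1 / T of the
   spectra. *)
have total : Rintegral lebesgue_measure `[0, T] (fun s => cos (mu * s) ^+ 2) +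
    Rintegral lebesgue_measure `[0, T] (fun s => sin (mu * s) ^+ 2) = T.
  rewrite -RintegralD //; [|exact: sq_int|exact: sq_int].
  under eq_Rintegral do rewrite cos2Dsin2.
  rewrite Rintegral_cst // mul1r.
  have E : lebesgue_measure (`[0%R, T]%classic : set R) = T%:E; last by rewrite [X in fine X]E.
  by rewrite lebesgue_measure_itv /= lte_fin T_gt0 oppr0 adde0.
have var_ge0 d' (O : measurableType d') (P : probability O R) (Y : {RV P >-> R}) : (0 <= 'V_P[Y])%E.
  by rewrite variance_integral; apply: integral_ge0 => w _; rewrite lee_fin sqr_ge0.
have prod := ereal_sum_product (Rintegral_ge0 _ _) (Rintegral_ge0 _ _) _
  (var_ge0 _ _ _ _) (var_ge0 _ _ _ _) (var_ge0 _ _ _ _) (var_ge0 _ _ _ _) HC HS.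
have {}prod : ((T ^+ 2)%:E <= ('V_P1[IC1] + 'V_P1[IS1]) * ('V_P2[IC2] + 'V_P2[IS2]))%E.
  rewrite -[in X in (X <= _)%E]total; apply: prod.
  - by move=> s _; exact: sqr_ge0.
  - by move=> s _; exact: sqr_ge0.
  - by rewrite total.
have Ti0 : 0 <= T^-1 by rewrite invr_ge0 ltW.
have v1 : (0 <= 'V_P1[IC1] + 'V_P1[IS1])%E by rewrite adde_ge0.
have v2 : (0 <= 'V_P2[IC2] + 'V_P2[IS2])%E by rewrite adde_ge0.
have -> : S_inel T IC1 IS1 = ((T^-1)%:E * ('V_P1[IC1] + 'V_P1[IS1]))%E by rewrite ge0_muleDr.
have -> : S_inel T IC2 IS2 = ((T^-1)%:E * ('V_P2[IC2] + 'V_P2[IS2]))%E by rewrite ge0_muleDr.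
have sp : (1 <= (T^-1)%:E * ('V_P1[IC1] + 'V_P1[IS1]) * ((T^-1)%:E * ('V_P2[IC2] + 'V_P2[IS2])))%E.
  rewrite muleACA -EFinM; apply: le_trans (lee_wpmul2l _ prod).
    rewrite -EFinM lee_fin le_eqVlt; apply/orP; left; apply/eqP; field.
    by rewrite gt_eqF.
  by rewrite lee_fin mulr_ge0.
by split=> //; apply: ereal_amgm => //; apply: mule_ge0; rewrite ?lee_fin.
Qed.
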